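(* Suppose $\mathcal{T}$ is a Delaunay geometric triangulation of the complex plane $\mathbb{C}$ whose vertex set is a lattice, and let $l_{st}:E(\mathcal{T})\to\mathbb{R}_{>0}$ be the Euclidean edge length function of $\mathcal{T}$. Let $w:V(\mathcal{T})\to\mathbb{R}$. If $(\mathbb{C},\mathcal{T},w*l_{st})$ is a Delaunay triangulated (PL) surface which is isometric to an open set in the Euclidean plane $\mathbb{C}$, then $w$ is a constant function.
   Context: A lattice in $\mathbb{C}$ is a subgroup $u_1\mathbb{Z}+u_2\mathbb{Z}$ with $u_1,u_2$ linearly independent over $\mathbb{R}$. A triangulation is geometric if its edges are geodesic (straight) segments. $V(\mathcal T),E(\mathcal T)$ are the vertex and edge sets. A PL metric on a triangulated surface $(S,\mathcal{T})$ is a function $l:E(\mathcal{T})\to\mathbb{R}_{>0}$ satisfying the strict triangle inequality on every triangle; $(S,\mathcal{T},l)$ is then the surface obtained by gluing the corresponding Euclidean triangles isometrically along edges. It is Delaunay if for each interior edge the sum of the two angles facing that edge is at most $\pi$. For $w:V(\mathcal{T})\to\mathbb{R}$, the vertex scaling $w*l$ is defined by $(w*l)(e)=e^{w(v)+w(v')}l(e)$ for each edge $e$ with end points $v,v'$. ''Isometric to an open set'' means that there is a homeomorphism from the glued surface onto an open subset of $\mathbb{C}$ (with its flat Riemannian metric) which is an isometric embedding on each triangle. *)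

(* Defs.v *)
From HB Require Import structures.
From mathcomp Require Import all_boot all_order all_algebra finmap.
From mathcomp Require Import all_classical all_reals all_analysis.
From mathcomp Require Import complex.

Set Implicit Arguments.
Unset Strict Implicit.
Unset Printing Implicit Defensive.

Import Order.TTheory GRing.Theory Num.Theory.
Import numFieldNormedType.Exports.

Local Open Scope classical_set_scope.
Local Open Scope ring_scope.
Local Open Scope complex_scope.

Section Definitions.
Context {R : realType}.
Implicit Types (a b c d u v z : R[i]) (t e : {fset R[i]}) (T : set {fset R[i]}).
Implicit Types (l : R[i] -> R[i] -> R) (w : R[i] -> R).

(* The topology of the complex plane is the one of R[i]^o, the normed module  *)
(* over itself; its balls are the discs `|x - y| < r.                         *)
Definition openC (W : set R[i]) : Prop := open (W : set R[i]^o).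

(* R[i] carries a norm with values in R[i]; normc is the real-valued modulus. *)
Definition cdist (u v : R[i]) : R := ComplexField.Normc.normc (u - v).

Definition R_independent (u v : R[i]) : Prop :=
  forall x y : R, x%:C * u + y%:C * v = 0 -> x = 0 /\ y = 0.

Definition lattice (L : set R[i]) : Prop :=
  exists u1 u2, R_independent u1 u2 /\
    L = [set z | exists m n : int, z = u1 *~ m + u2 *~ n].

(** Geometric triangulations *)

(* A triangulation is given by the set T of the vertex sets of its triangles. *)

Definition triangle t : Prop :=
  exists a b c, t = [fset a; b; c]%fset /\ R_independent (b - a) (c - a).

Definition hull (s : {fset R[i]}) : set R[i] :=
  [set z | exists p : R[i] -> R,
    [/\ forall x, x \in s -> 0 <= p x,
        \sum_(x <- s) p x = 1 &
        z = \sum_(x <- s) (p x)%:C * x]].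

(* In the second clause, hull fset0 is empty: two triangles are disjoint or   *)
(* meet exactly in a common vertex, a common edge, or are equal.              *)
Definition geometric_triangulation T : Prop :=
  [/\ forall t, T t -> triangle t,
      forall t t', T t -> T t' -> hull t `&` hull t' = hull (t `&` t')%fset,
      forall z, exists2 t, T t & hull t z &
      forall z, exists U : set R[i], [/\ openC U, U z &
        finite_set [set t | T t /\ hull t `&` U !=set0]]].

Definition vertices T : set R[i] := [set v | exists2 t, T t & v \in t].

Definition edge T (u v : R[i]) : Prop :=
  u != v /\ exists t, [/\ T t, u \in t & v \in t].

(** Polyhedral metrics *)

(* A function on edges is a function of two end points, of which only the     *)
(* values at pairs of adjacent vertices matter.                               *)

Definition PL_metric T l : Prop :=
  [/\ forall u v, edge T u v -> l u v = l v u,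
      forall u v, edge T u v -> 0 < l u v &
      forall a b c, T [fset a; b; c]%fset -> l b c < l a b + l a c].

(* Angle at a, facing the edge bc, by the law of cosines. *)
Definition angle l a b c : R :=
  acos ((l a b ^+ 2 + l a c ^+ 2 - l b c ^+ 2) / (2 * l a b * l a c)).

(* The interior edges are those shared by two distinct triangles. *)
Definition Delaunay T l : Prop :=
  forall a b c d, c != d ->
    T [fset a; b; c]%fset -> T [fset a; b; d]%fset ->
    angle l c a b + angle l d a b <= pi.

Definition vertex_scaling w l : R[i] -> R[i] -> R :=
  fun u v => expR (w u + w v) * l u v.

(** The glued surface *)

(* A point of a triangle is given by its barycentric coordinates              *)
(* (1 - p.1 - p.2, p.1, p.2) with respect to an ordering of the vertices.     *)
Definition simplex : set (R * R) :=
  [set p | [/\ 0 <= p.1, 0 <= p.2 & p.1 + p.2 <= 1]].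

Definition plane_point a b c (p : R * R) : R[i] :=
  a + p.1%:C * (b - a) + p.2%:C * (c - a).

(* The Euclidean triangle with side lengths l a b, l a c, l b c is realised   *)
(* with vertices 0, l a b and (l a c) exp(i theta), theta the angle at a.     *)
Definition model_point l a b c (p : R * R) : R[i] :=
  (p.1 * l a b)%:C +
  (p.2 * l a c)%:C * (cos (angle l a b c) +i* sin (angle l a b c)).

(* Gluing the model triangles along their edges by isometries, which are      *)
(* affine, identifies two points exactly when they have the same plane_point: *)
(* so the points of the glued surface are the points of the plane, and its    *)
(* topology is the quotient topology of the disjoint union of the model       *)
(* triangles, namely W is open iff its trace on each of them is.              *)
Definition glued_open T l (W : set R[i]) : Prop :=
  forall a b c, T [fset a; b; c]%fset ->
    exists U : set R[i], openC U /\
      forall p, simplex p ->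
        (W (plane_point a b c p) <-> U (model_point l a b c p)).

Definition isometric_to_open_set T l : Prop :=
  exists (f : R[i] -> R[i]) (U : set R[i]),
  [/\ openC U,
      set_bij setT U f,
      forall W : set R[i], glued_open T l W <-> openC (f @` W) &
      forall a b c, T [fset a; b; c]%fset ->
        forall p q, simplex p -> simplex q ->
          cdist (f (plane_point a b c p)) (f (plane_point a b c q)) =
          cdist (model_point l a b c p) (model_point l a b c q)].

End Definitions.

(* Main.v *)
Require Import Defs.
From mathcomp Require Import all_boot all_order all_algebra finmap.
From mathcomp Require Import all_classical all_reals all_analysis.
From mathcomp Require Import complex ring lra zify.

(* Read the scaling factor on Z^2, through a basis of the lattice given by a  *)
(* triangle without obtuse angles, as W, and put y = exp (- 2 W). Inverting   *)
(* the star of a vertex in a circle around it turns the Delaunay condition    *)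
(* into the convexity of an octagon, whose sides do not depend on W and       *)
(* whose angles at the centre have sum 2 pi. Convexity gives a maximum        *)
(* principle (two such stars with y <= y' have the same y at the neighbours)  *)
(* and a bound for y at the neighbours. So, if W were not constant,           *)
(* translates along a sequence maximising an increment of W would have a      *)
(* limit where this increment is constant; doing this in two directions       *)
(* produces a limit with W linear and not constant. There the vertices form   *)
(* a spiral p + c A^m B^n. If A and B are not both real, the almost returns   *)
(* of A^m B^n to 1 make triangles overlap. If both are positive, the limit    *)
(* contradicts the absence of obtuse angles. Otherwise rows of vertices lie   *)
(* alternately on the two sides of a line and move away from it, which is     *)
(* impossible in a plane triangulation close to the limit.                    *)

Set Implicit Arguments.
Unset Strict Implicit.
Unset Printing Implicit Defensive.
Import Order.TTheory GRing.Theory Num.Theory.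
Import numFieldNormedType.Exports.
Local Open Scope classical_set_scope.
Local Open Scope ring_scope.
Local Open Scope complex_scope.

(** * Angles of convex stars *)

Section Arc.
Context {R : realType}.
Implicit Types (c x y p q d e t : R).

(** Shape of the triangulation. The Delaunay condition and the lattice condition together exclude
    obtuse triangles ([nonobtuse]): across the longest side of an obtuse triangle lies another
    obtuse one with a longer side, and a fixed segment would meet infinitely many of them. Hence, in
    the basis given by a suitable triangle, the triangulation is the unit grid with one diagonal in
    each cell, and the choice of the diagonal is free only for rectangles ([lattice_cells]). The
    isometry becomes a developing map, injective and affine on triangles, and w becomes a function W
    on Z^2.

    Local estimate. Fix a vertex z and put y x = exp (- 2 (W (z + x) - W z)). Inversion in a circle
    around z sends the star of z to an octagon whose side lengths do not depend on W and whose
    corners have squared distances to the centre that increase with y. The Delaunay condition says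
    that the octagon is convex, and embeddedness that its angles at the centre have sum 2 pi
    ([vertex_star]). Two such polygons with Y <= Z are equal ([star_rigidity]): on the segment from
    Y to Z the derivative of the angle sum is minus a weighted sum of cotangents, which convexity
    makes nonnegative. This is a strong maximum principle ([star_ok_rigid]); there is also a bound
    on the increments of W ([star_ok_bounded]).

    Compactness. By this bound, the normalised translates of W and of the development have limits
    along ultrafilters. Such limits may contain degenerate triangles, so [admissible] keeps only
    properties that survive. If W is not constant, translates along a maximising sequence of an
    increment give a limit where this increment is constant; a second limit makes W linear and not
    constant ([linear_limit]).

    Linear case. All cells are similar, so the vertices satisfy P (z + x) - p = E x (P z - p) with E
    multiplicative ([spiral]). If E is not real, E k comes arbitrarily close to 1 with k != 0, and
    two triangles overlap ([spiral_is_real]). If E is positive on both axes, three vertices of a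
    triangle are collinear, against the inequalities inherited from the original triangle without
    obtuse angles ([collinear_A], [collinear_B]). Otherwise E e < 0 < E g for some basis e, g of
    edge directions, and rows of vertices jump across a line while moving away from it, which no
    plane triangulation near the limit allows ([no_strip]). So W is constant. *)

Definition cosl y p c : R := (y + p - c ^+ 2) / (2 * Num.sqrt (y * p)).

Definition clamp x : R := Num.max (-1) (Num.min 1 x).

(* The angle at the origin of the triangle with two sides of squared lengths  *)
(* y, p and opposite side c; the clamping makes it continuous in y, p > 0.    *)
Definition arc y p c : R := acos (clamp (cosl y p c)).

(** Heron's formula: sixteen times the squared area of the triangle with squared sides y, p and
    [c ^+ 2]. *)
Definition heron y p c : R := 4 * y * p - (y + p - c ^+ 2) ^+ 2.

(* 2 * sqrt y times the cosine of the angle at the end of the side sqrt y.    *)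
Definition tang y p c : R := (y - p + c ^+ 2) / c.

Lemma clamp_itv x : -1 <= clamp x <= 1.
Proof.
rewrite /clamp; apply/andP; split; rewrite ?le_max ?lexx//.
by rewrite ge_max; apply/andP; split; [lra|rewrite ge_min lexx].
Qed.

Lemma clamp_id x : -1 <= x <= 1 -> clamp x = x.
Proof. by move=> /andP[h1 h2]; rewrite /clamp (min_idPr h2) (max_idPr h1). Qed.

Lemma clamp_lipschitz x y : `|clamp x - clamp y| <= `|x - y|.
Proof.
have h1 := ler_norm (x - y); have h2 := ler_norm (y - x).
rewrite distrC in h2; rewrite ler_norml /clamp /Order.max /Order.min.
case: (ltP 1 x) => ?; case: (ltP 1 y) => ?; case: (ltP (-1) x) => ?;
  case: (ltP (-1) y) => ?; rewrite ?ltr1N1 ?ltrN1ltr1; try (apply/andP; split; lra).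
all: case: (ltP (-1) 1) => ?; apply/andP; split; lra.
Qed.

Lemma continuous_acos_clamp : continuous (fun x : R => acos (clamp x)).
Proof.
have cw : {within `[(-1 : R), 1], continuous (@acos R)}.
  (* [acos] is decreasing and onto [0, pi], hence continuous up to the end points. *)
  apply: segment_dec_surj_continuous.
    move=> x y xi yi; rewrite -[in RHS](acosK xi) -[in RHS](acosK yi) leNgt.
    rewrite (leNgt (cos _)) ltr_cos //; move: xi yi; rewrite !in_itv/= => *;
      by rewrite acos_ge0// acos_lepi.
  move=> y /=; rewrite acos1 acosN1 => yi; exists (cos y); last by apply: cosK.
  by rewrite /= in_itv/= cos_geN1 cos_le1.
move=> x; apply/cvgrPdist_lt => e e0.
have xi : `[(-1 : R), 1]%classic (clamp x) by rewrite /= in_itv/= clamp_itv.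
move/subspace_continuousP/(_ _ xi)/cvgrPdist_lt/(_ _ e0) : cw.
rewrite near_withinE => -[d /= d0 hd].
exists d => //= z hz; apply: hd; last by rewrite /= in_itv/= clamp_itv.
by rewrite /= (le_lt_trans (clamp_lipschitz _ _)).
Qed.

Lemma cosl_heron y p c : 0 < y -> 0 < p ->
  1 - cosl y p c ^+ 2 = heron y p c / (4 * y * p).
Proof.
move=> y0 p0; have yp0 : 0 < y * p by rewrite mulr_gt0.
rewrite /cosl exprMn exprVn exprMn sqr_sqrtr ?ltW// /heron.
by field; rewrite !gt_eqF.
Qed.

Lemma sqr_le1_itv x : 0 <= 1 - x ^+ 2 -> -1 <= x <= 1.
Proof. by move=> h; apply/andP; split; nra. Qed.

Lemma cosl_bound y p c : 0 < y -> 0 < p -> 0 <= heron y p c ->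
  -1 <= cosl y p c <= 1.
Proof.
move=> y0 p0 h; apply: sqr_le1_itv; rewrite cosl_heron// divr_ge0//.
by rewrite !mulr_ge0 // ltW.
Qed.

Lemma arcE y p c : 0 < y -> 0 < p -> 0 <= heron y p c ->
  arc y p c = acos (cosl y p c).
Proof. by move=> y0 p0 h; rewrite /arc clamp_id// cosl_bound. Qed.

Lemma cvg_arc (T : Type) (F : set_system T) (FF : Filter F) (f g : T -> R) y p c :
  0 < y -> 0 < p -> f x @[x --> F] --> y -> g x @[x --> F] --> p ->
  arc (f x) (g x) c @[x --> F] --> arc y p c.
Proof.
move=> y0 p0 fy gp; rewrite /arc.
have fgM : f x * g x @[x --> F] --> y * p by exact: cvgM.
have sq : Num.sqrt (f x * g x) @[x --> F] --> Num.sqrt (y * p).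
  by move=> A /(@sqrt_continuous R (y * p)) /fgM.
have cc : cosl (f x) (g x) c @[x --> F] --> cosl y p c.
  apply: cvgM; first by apply: cvgB; [exact: cvgD|exact: cvg_cst].
  apply: cvgV; first by rewrite mulf_neq0// gt_eqF// sqrtr_gt0 mulr_gt0.
  by apply: cvgM; first exact: cvg_cst.
by move=> A /continuous_acos_clamp /cc.
Qed.

Lemma cvg_sumr (T : Type) (F : set_system T) (FF : Filter F) (J : finType)
    (f : J -> T -> R) (a : J -> R) :
  (forall j, f j x @[x --> F] --> a j) ->
  \sum_j f j x @[x --> F] --> \sum_j a j.
Proof.
move=> fa; elim: (index_enum J) => [|j r IH].
  under eq_fun do rewrite big_nil.
  by rewrite big_nil; exact: cvg_cst.
under eq_fun do rewrite big_cons.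
by rewrite big_cons; apply: cvgD.
Qed.

(** Differentiate the law of cosines. The coefficient of [d] is minus the cotangent of the angle at
    the end of the side of squared length [f t], divided by [2 * f t]. Strict positivity of [heron]
    keeps the cosine away from -1 and 1. *)
Lemma is_derive_arc (f g : R -> R) t d e c : 0 < f t -> 0 < g t ->
  0 < heron (f t) (g t) c -> is_derive t 1 f d -> is_derive t 1 g e ->
  is_derive t 1 (fun x => arc (f x) (g x) c)
    (- (d * (f t - g t + c ^+ 2) / (2 * f t) + e * (g t - f t + c ^+ 2) / (2 * g t))
       / Num.sqrt (heron (f t) (g t) c)).
Proof.
move=> f0 g0 h0 fd gd; have fg0 : 0 < f t * g t by rewrite mulr_gt0.
have s0 : 0 < Num.sqrt (f t * g t) by rewrite sqrtr_gt0.
have dM : is_derive t 1 (fun x => f x * g x) (f t * e + g t * d).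
  exact: (is_deriveM fd gd).
have dS : is_derive t 1 (fun x => Num.sqrt (f x * g x))
    ((2 * Num.sqrt (f t * g t))^-1 * (f t * e + g t * d)).
  exact: (@is_derive1_comp _ Num.sqrt (fun x => f x * g x) t _ _ (is_derive1_sqrt fg0) dM).
have dS2 : is_derive t 1 (fun x => 2 * Num.sqrt (f x * g x))
    (2 * ((2 * Num.sqrt (f t * g t))^-1 * (f t * e + g t * d))).
  exact: (is_deriveZ 2 dS).
have n0 : 2 * Num.sqrt (f t * g t) != 0 by rewrite gt_eqF// mulr_gt0.
have dV := @is_deriveV _ (fun x => 2 * Num.sqrt (f x * g x)) _ _ _ n0 dS2.
have dN : is_derive t 1 (fun x => f x + g x - c ^+ 2) (d + e - 0).
  exact: (is_deriveB (is_deriveD fd gd) (is_derive_cst _ _ _)).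
have := is_deriveM dN dV => dC.
have dC' : is_derive t 1 (fun x => cosl (f x) (g x) c)
  ((d * (f t - g t + c ^+ 2) / (2 * f t) + e * (g t - f t + c ^+ 2) / (2 * g t)) / (2 * Num.sqrt (f t * g t))).
  apply: (@is_derive_eq _ _ _ (fun x => cosl (f x) (g x) c) t 1 _ _ dC).
  rewrite /GRing.scale /= exprMn sqr_sqrtr ?ltW//.
  have := s0; set r := Num.sqrt _ => r0.
  by field; rewrite !gt_eqF.
have b1 : -1 < cosl (f t) (g t) c < 1.
  have : 0 < 1 - cosl (f t) (g t) c ^+ 2 by rewrite cosl_heron// divr_gt0// !mulr_gt0.
  by move=> h; apply/andP; split; nra.
have dA := @is_derive1_comp _ acos (fun x => cosl (f x) (g x) c) t _ _ (is_derive1_acos b1) dC'.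
have cC : cosl (f x) (g x) c @[x --> t] --> cosl (f t) (g t) c.
  by have [+ _] := dC' => /derivable1_diffP /differentiable_continuous.
have /andP[b2 b3] := b1.
have {}dA := near_eq_is_derive (g := fun x => arc (f x) (g x) c) _ dA.
apply: is_derive_eq.
  apply: dA; rewrite /arc /=.
  near=> x; rewrite clamp_id//; apply/andP; split; apply: ltW; near: x.
  - exact: (cvgr_gt _ cC).
  - exact: (cvgr_lt _ cC).
rewrite cosl_heron// sqrtrM ?ltW// sqrtrV; last by rewrite !mulr_ge0// ltW.
rewrite -mulrA sqrtrM // (_ : (4 : R) = 2 ^+ 2); last by rewrite -natrX.
rewrite sqrtr_sqr ger0_norm//.
have h1 : 0 < Num.sqrt (heron (f t) (g t) c) by rewrite sqrtr_gt0.
by field; rewrite !gt_eqF.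
Unshelve. all: by end_near. Qed.

(** The function x / sqrt (m - x^2) is odd and strictly increasing: it is cot phi for x = sqrt m cos
    phi. So two cosines with nonnegative sum have cotangents with nonnegative sum, and the two sums
    vanish together. *)
Lemma bend_strict x y m : x ^+ 2 < m -> y ^+ 2 < m -> 0 <= x + y ->
  0 <= x / Num.sqrt (m - x ^+ 2) + y / Num.sqrt (m - y ^+ 2)
    ?= iff (x + y == 0).
Proof.
move=> hx hy; wlog : x y hx hy / y <= x.
  move=> H xy; case: (lerP y x) => h; first exact: H.
  rewrite addrC (addrC x); apply: H => //; first exact: ltW.
  by rewrite addrC.
move=> yx xy.
have sx : 0 < Num.sqrt (m - x ^+ 2) by rewrite sqrtr_gt0 subr_gt0.
have sy : 0 < Num.sqrt (m - y ^+ 2) by rewrite sqrtr_gt0 subr_gt0.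
have x0 : 0 <= x by lra.
have [y0|y0] := lerP 0 y.
  split; first by rewrite addr_ge0// divr_ge0// ltW.
  rewrite eq_sym (paddr_eq0 x0 y0) paddr_eq0 ?divr_ge0 ?(ltW sx) ?(ltW sy)//.
  by rewrite !mulf_eq0 !invr_eq0 (gt_eqF sx) (gt_eqF sy) !orbF.
have e1 : y / Num.sqrt (m - y ^+ 2) = - ((- y) / Num.sqrt (m - (- y) ^+ 2)).
  by rewrite sqrrN mulNr opprK.
have le1 (u v : R) : 0 <= u -> u <= v -> v ^+ 2 < m ->
    u / Num.sqrt (m - u ^+ 2) <= v / Num.sqrt (m - v ^+ 2).
  move=> u0 uv vm; have su : 0 < Num.sqrt (m - v ^+ 2) by rewrite sqrtr_gt0 subr_gt0.
  apply: ler_pM => //; rewrite ?invr_ge0 ?sqrtr_ge0//.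
  rewrite lef_pV2 ?posrE//; last first.
    by rewrite sqrtr_gt0 subr_gt0 (le_lt_trans _ vm)// ler_sqr ?nnegrE// (le_trans u0).
  by rewrite ler_wsqrtr// lerB// ler_sqr ?nnegrE// (le_trans u0).
rewrite e1; split; first by rewrite subr_ge0; apply: le1 => //; lra.
apply/eqP/eqP; last first.
  move=> k; have e : - y = x by lra.
  by rewrite e subrr.
have [//|ne] := eqVneq (x + y) 0 => h.
have yx' : - y < x by rewrite lt_neqAle; apply/andP; split; [apply: contra_neq ne|]; lra.
have : - y / Num.sqrt (m - (- y) ^+ 2) < x / Num.sqrt (m - x ^+ 2).
  apply: lt_le_trans (_ : x / Num.sqrt (m - (- y) ^+ 2) <= _).
    by rewrite ltr_pM2r// invr_gt0 sqrrN.
  rewrite ler_pM2l; last lra.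
  rewrite lef_pV2 ?posrE ?sqrrN//.
  by rewrite ler_wsqrtr// lerB// -(sqrrN y) ler_sqr ?nnegrE; lra.
by lra.
Qed.

End Arc.

(** * Rigidity of convex polygons around a point *)

Section Rigidity.
Context {R : realType} {I : finType} (s t : I -> I) (c : I -> R).
Hypotheses (sK : cancel s t) (tK : cancel t s) (c_gt0 : forall i, 0 < c i).
Implicit Types (Y Z : I -> R).

(* [s] walks once around polygons whose vertices i are at squared distance    *)
(* Y i from the origin, c i being the length of the side from i to s i;       *)
(* up to a positive factor, turn is the sum of the cosines of the two parts   *)
(* into which the origin divides the interior angle at i.                     *)
Definition turn Y i : R :=
  tang (Y i) (Y (s i)) (c i) + tang (Y i) (Y (t i)) (c (t i)).

Definition angle_sum Y : R := \sum_i arc (Y i) (Y (s i)) (c i).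

Definition convex_star Y : Prop :=
  [/\ forall i, 0 < Y i, forall i, 0 <= heron (Y i) (Y (s i)) (c i) &
      forall i, 0 <= turn Y i].

Lemma turnD Y Z x i : turn (fun j => Y j + x * (Z j - Y j)) i =
  (1 - x) * turn Y i + x * turn Z i.
Proof.
by rewrite /turn /tang; field; rewrite !gt_eqF.
Qed.

(** [heron] is concave along a segment, strictly unless the two increments agree, and then it is
    affine with positive slope. So, strictly between two polygons, every triangle that moves is
    nondegenerate. *)
Lemma heron_concave (y z y' z' a x : R) : 0 < a -> 0 < x < 1 ->
  y <= y' -> z <= z' -> (y, z) != (y', z') ->
  0 <= heron y z a -> 0 <= heron y' z' a ->
  0 < heron (y + x * (y' - y)) (z + x * (z' - z)) a.
Proof.
move=> a0 /andP[x0 x1] yy zz ne h h'.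
have e : heron (y + x * (y' - y)) (z + x * (z' - z)) a =
  (1 - x) * heron y z a + x * heron y' z' a +
  x * (1 - x) * ((y' - y) - (z' - z)) ^+ 2.
  by rewrite /heron; ring.
have [d|d] := eqVneq (y' - y) (z' - z); last first.
  rewrite e ltr_wpDl//; first by rewrite addr_ge0 // mulr_ge0; lra.
  rewrite mulr_gt0//; first by nra.
  by rewrite lt_neqAle eq_sym sqrf_eq0 subr_eq0 d sqr_ge0.
have lt : 0 < y' - y.
  rewrite subr_gt0 lt_neqAle yy andbT; apply: contra ne => /eqP e1.
  by apply/eqP; congr (_, _) => //; lra.
have : heron (y + x * (y' - y)) (z + x * (z' - z)) a =
  heron y z a + 4 * a ^+ 2 * (x * (y' - y)).
  by rewrite d /heron; ring.
move=> ->; rewrite ltr_wpDl// !mulr_gt0//.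
Qed.

(** The quotients are the cotangents of the two parts of the interior angle at i, and [tang] is a
    multiple of the cosine; [bend_strict] applies with m = 4 Y i. *)
Lemma turn_angle_derivative Y i : 0 < Y i ->
  0 < heron (Y i) (Y (s i)) (c i) -> 0 < heron (Y (t i)) (Y i) (c (t i)) ->
  0 <= turn Y i ->
  0 <= (Y i - Y (s i) + c i ^+ 2) / Num.sqrt (heron (Y i) (Y (s i)) (c i)) +
    (Y i - Y (t i) + c (t i) ^+ 2) / Num.sqrt (heron (Y (t i)) (Y i) (c (t i)))
    ?= iff (turn Y i == 0).
Proof.
move=> y0 h1 h2 ti.
have key (y p a : R) : 0 < a -> 0 < heron y p a ->
    tang y p a ^+ 2 < 4 * y /\ (y - p + a ^+ 2) / Num.sqrt (heron y p a) =
      tang y p a / Num.sqrt (4 * y - tang y p a ^+ 2).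
  move=> a0 h.
  have e : heron y p a = a ^+ 2 * (4 * y - tang y p a ^+ 2).
    by rewrite /heron /tang; field; rewrite gt_eqF.
  have h' : 0 < 4 * y - tang y p a ^+ 2.
    by move: h; rewrite e pmulr_rgt0// exprn_gt0.
  split; first by rewrite -subr_gt0.
  rewrite e sqrtrM ?sqr_ge0// sqrtr_sqr gtr0_norm// /tang.
  have h3 : 0 < Num.sqrt (4 * y - ((y - p + a ^+ 2) / a) ^+ 2) by rewrite sqrtr_gt0.
  by field; rewrite !gt_eqF.
have heronC (y p a : R) : heron y p a = heron p y a by rewrite /heron; ring.
rewrite (heronC (Y (t i))) in h2 *.
have [k1 ->] := key _ _ _ (c_gt0 i) h1.
have [k2 ->] := key _ _ _ (c_gt0 (t i)) h2.
exact: bend_strict.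
Qed.

(** Move linearly from Y to Z. Regrouped by vertices, the derivative of the angle sum is minus a sum
    of nonnegative terms; as the angle sum is the same at both ends, it vanishes at some time by
    Rolle's theorem. Then every vertex that moves is flat in both polygons. The vertices with the
    largest increment, if it is positive, are closed under passing to neighbours, and a closed
    polygon cannot be flat at each of its vertices. *)
Theorem star_rigidity Y Z : convex_star Y -> convex_star Z ->
  (forall i, Y i <= Z i) -> angle_sum Y = angle_sum Z -> Y =1 Z.
Proof.
move=> [Y0 hY tY] [Z0 hZ tZ] YZ AA.
pose d i := Z i - Y i.
pose P (x : R) i := Y i + x * d i.
have d0 i : 0 <= d i by rewrite subr_ge0.
have P0 (x : R) i : 0 <= x -> 0 < P x i.
  by move=> x0; rewrite ltr_wpDr// mulr_ge0.
have hP (x : R) i : 0 < x < 1 -> (d i != 0) || (d (s i) != 0) ->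
    0 < heron (P x i) (P x (s i)) (c i).
  move=> x01 ne; apply: heron_concave => //.
  apply: contraL ne; rewrite xpair_eqE negb_or !negbK /d !subr_eq0.
  by rewrite (eq_sym (Z i)) (eq_sym (Z (s i))).
have PD i (x : R) : is_derive x 1 (fun x => P x i) (d i).
  have := is_deriveD (is_derive_cst (Y i) x 1) (is_deriveM (is_derive_id x (1 : R)) (is_derive_cst (d i) x 1)).
  by move/is_derive_eq; apply; rewrite /GRing.scale/= mulr0 add0r add0r mulr1.
pose D (x : R) i := - (d i * (P x i - P x (s i) + c i ^+ 2) / (2 * P x i) +
  d (s i) * (P x (s i) - P x i + c i ^+ 2) / (2 * P x (s i))) /
  Num.sqrt (heron (P x i) (P x (s i)) (c i)).
have aD (x : R) i : 0 < x < 1 ->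
    is_derive x 1 (fun x => arc (P x i) (P x (s i)) (c i)) (D x i).
  move=> x01; have [x0 x1] := andP x01.
  have [|/norP[]] := boolP ((d i != 0) || (d (s i) != 0)) => [ne|].
    by apply: is_derive_arc => //; rewrite ?P0 ?ltW//; exact: hP.
  (* If neither end of the side moves, the triangle may be degenerate, but its angle is constant. *)
  rewrite !negbK => /eqP e1 /eqP e2.
  rewrite /D e1 e2 !mul0r addr0 oppr0 mul0r.
  have -> : (fun x => arc (P x i) (P x (s i)) (c i)) = cst (arc (Y i) (Y (s i)) (c i)).
    by apply/funext => z; rewrite /P e1 e2 !mulr0 !addr0.
  exact: is_derive_cst.
pose g (x : R) : R := angle_sum (P x).
have gD (x : R) : 0 < x < 1 -> is_derive x 1 g (\sum_i D x i).
  move=> x01; rewrite /g /angle_sum.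
  have -> : (fun x => \sum_i arc (P x i) (P x (s i)) (c i)) =
      \sum_(j < #|I|) (fun x => arc (P x (enum_val j)) (P x (s (enum_val j))) (c (enum_val j))).
    by apply/funext => z; rewrite fct_sumE (reindex _ (onW_bij _ (@enum_val_bij I))).
  rewrite (reindex _ (onW_bij _ (@enum_val_bij I))).
  by apply: is_derive_sum => j; exact: aD.
have g01 : g 0 = g 1.
  have e0 : P 0 = Y by apply/funext => i; rewrite /P mul0r addr0.
  have e1 : P 1 = Z by apply/funext => i; rewrite /P mul1r addrC subrK.
  by rewrite /g e0 e1.
have gd (x : R) : x \in `]0, 1[ -> derivable g x 1.
  by rewrite in_itv => /gD [].
have gc : {within `[0, 1], continuous g}.
  apply: continuous_in_subspaceT => x; rewrite inE/= in_itv/= => /andP[x0 _].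
  apply: cvg_sumr => i; apply: cvg_arc; rewrite ?P0//.
    by have [+ _] := PD i x => /derivable1_diffP /differentiable_continuous.
  by have [+ _] := PD (s i) x => /derivable1_diffP /differentiable_continuous.
have [x xi gx] := Rolle ltr01 gd gc g01.
have {xi}x01 : 0 < x < 1 by move: xi; rewrite in_itv.
have [x0 x1] := andP x01.
pose B i := (P x i - P x (s i) + c i ^+ 2) / Num.sqrt (heron (P x i) (P x (s i)) (c i)) +
  (P x i - P x (t i) + c (t i) ^+ 2) / Num.sqrt (heron (P x (t i)) (P x i) (c (t i))).
have tP i : turn (P x) i = (1 - x) * turn Y i + x * turn Z i by rewrite -turnD.
have bP i : d i != 0 -> 0 <= B i ?= iff (turn (P x) i == 0).
  move=> di; apply: turn_angle_derivative; first by rewrite P0 ?ltW.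
  - by apply: hP => //; rewrite di.
  - by have := hP x (t i) x01; rewrite tK di orbT; apply.
  - by rewrite tP addr_ge0// mulr_ge0// ?subr_ge0 ?(ltW x0) ?(ltW x1).
(* Summation by parts: each vertex collects the contributions of the two triangles that share its
   spoke. *)
have S0 : \sum_i d i / (2 * P x i) * B i = 0.
  have : \sum_i D x i = 0 by rewrite -(@derive_val _ _ _ _ _ _ _ (gD x x01)) derive_val.
  have -> : \sum_i D x i = - \sum_i d i / (2 * P x i) * B i; last by move/eqP; rewrite oppr_eq0 => /eqP.
  transitivity (- (\sum_i d i / (2 * P x i) * ((P x i - P x (s i) + c i ^+ 2) / Num.sqrt (heron (P x i) (P x (s i)) (c i))) +
    \sum_i d (s i) / (2 * P x (s i)) * ((P x (s i) - P x i + c i ^+ 2) / Num.sqrt (heron (P x i) (P x (s i)) (c i))))).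
    rewrite -big_split -sumrN; apply: eq_bigr => i _; rewrite /D /=; ring.
  rewrite [X in _ + X](reindex_inj (can_inj tK)) -big_split/=; congr (- _).
  by apply: eq_bigr => i _; rewrite tK /B; ring.
(* Each nonnegative term vanishes. As [turn] is affine in time and nonnegative at both ends, it
   vanishes at both ends. *)
have flat i : d i != 0 -> turn Y i = 0 /\ turn Z i = 0.
  move=> di; have dB j : 0 <= d j / (2 * P x j) * B j.
    have [->|dj] := eqVneq (d j) 0; first by rewrite !mul0r.
    apply: mulr_ge0; last by have [] := bP j dj.
    by rewrite divr_ge0// mulr_ge0// (ltW (P0 _ _ (ltW x0))).
  have := psumr_eq0P (fun j _ => dB j) S0 (isT : xpredT i).
  move/eqP; rewrite mulf_eq0 mulf_eq0 invr_eq0 mulf_eq0 (negbTE di) pnatr_eq0 /= (gt_eqF (P0 _ _ _)) ?ltW//= => B0.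
  have [_] := bP i di; rewrite eq_sym B0 => /esym /eqP; rewrite tP => e.
  by have := tY i; have := tZ i => z1 z2; split; nra.
have [/forallP h i|] := boolP [forall i, d i == 0].
  by apply/eqP; rewrite eq_sym -subr_eq0 -/(d i) h.
rewrite negb_forall => /existsP[i0 di0]; exfalso.
pose k := [arg max_(i > i0) d i]%O.
have km i : d i <= d k by rewrite /k; case: arg_maxP => // j _; apply.
have k0 : 0 < d k by rewrite (lt_le_trans _ (km i0))// lt_neqAle eq_sym di0 d0.
pose A i := d i == d k.
have AF i : A i -> d i != 0 by move=> /eqP ->; rewrite gt_eqF.
(* Flatness in Y and in Z makes a discrete Laplacian of d vanish; at a maximum of d this forces both
   neighbours to be maximal. *)
have Ast i : A i -> A (s i) && A (t i).
  move=> Ai; have [f1 f2] := flat _ (AF _ Ai).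
  have : turn Z i - turn Y i = (d k - d (s i)) / c i + (d k - d (t i)) / c (t i).
    by rewrite -(eqP Ai) /turn /tang /d; field; rewrite !gt_eqF.
  rewrite f1 f2 subrr => /esym /eqP.
  rewrite paddr_eq0 ?divr_ge0 ?subr_ge0 ?km ?ltW// !mulf_eq0 !invr_eq0 !(gt_eqF (c_gt0 _)) !orbF !subr_eq0.
  by rewrite /A ![_ == d k]eq_sym.
have As i : A (s i) = A i.
  apply/idP/idP => [/Ast|/Ast] /andP[] //.
  by rewrite sK.
have : \sum_(i | A i) turn Y i = 0 by rewrite big1// => i /AF /flat [].
(* Over a set stable under s the terms in Y cancel, and each side contributes [c i] from both of its
   ends. *)
have -> : \sum_(i | A i) turn Y i = \sum_(i | A i) (2 * c i).
  rewrite /turn big_split/= [X in _ + X](reindex_inj (can_inj sK)) /=.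
  under [X in _ + X]eq_bigl => i do rewrite As.
  by rewrite -big_split/=; apply: eq_bigr => i _; rewrite sK /tang; field; rewrite !gt_eqF.
move=> S; have := psumr_eq0P (fun i _ => mulr_ge0 (ler0n _ _) (ltW (c_gt0 i))) S (eqxx (d k) : A k).
by move/eqP; rewrite mulf_eq0 pnatr_eq0 /= gt_eqF.
Qed.

End Rigidity.

(** * The plane *)

Section Plane.
Context {R : realType}.
Implicit Types (a b c d u v z : R[i]) (x y : R).

Definition dot u v : R := complex.Re u * complex.Re v + complex.Im u * complex.Im v.
Definition cross u v : R := complex.Re u * complex.Im v - complex.Im u * complex.Re v.
Definition area a b c : R := cross (b - a) (c - a).

Lemma crossNC u v : cross u v = - cross v u.
Proof. by rewrite /cross; ring. Qed.

Lemma dotC u v : dot u v = dot v u.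
Proof. by rewrite /dot; ring. Qed.

Lemma dot_ge0 u : 0 <= dot u u.
Proof. by rewrite /dot addr_ge0// -expr2 sqr_ge0. Qed.

Lemma dot_eq0 u : (dot u u == 0) = (u == 0).
Proof.
case: u => x y; rewrite /dot /= -!expr2 paddr_eq0 ?sqr_ge0// !sqrf_eq0.
by rewrite eq_complex.
Qed.

Lemma dot_gt0 u : u != 0 -> 0 < dot u u.
Proof. by move=> u0; rewrite lt_neqAle eq_sym dot_eq0 u0 dot_ge0. Qed.

Lemma cdistE u v : cdist u v = Num.sqrt (dot (u - v) (u - v)).
Proof. by rewrite /cdist /dot; case: (u - v) => x y /=; rewrite -!expr2. Qed.

Lemma cdist_sqr u v : cdist u v ^+ 2 = dot (u - v) (u - v).
Proof. by rewrite cdistE sqr_sqrtr ?dot_ge0. Qed.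

Lemma cdist_gt0 u v : u != v -> 0 < cdist u v.
Proof. by move=> uv; rewrite cdistE sqrtr_gt0 dot_gt0// subr_eq0. Qed.

Lemma cdistC u v : cdist u v = cdist v u.
Proof. by rewrite !cdistE; congr (Num.sqrt _); rewrite /dot; case: u v => ? ? [? ?] /=; ring. Qed.

Lemma areaC a b c : area a b c = area b c a.
Proof. by rewrite /area /cross; case: a b c => ? ? [? ?] [? ?] /=; ring. Qed.

Lemma areaN a b c : area a c b = - area a b c.
Proof. by rewrite /area crossNC. Qed.

Lemma R_independentP u v : R_independent u v <-> cross u v != 0.
Proof.
split=> [h|].
  apply/eqP => e.
  have [|v1 v2] := h (complex.Re v) (- complex.Re u).
    apply/eqP; case: u v e {h} => ? ? [? ?]; rewrite /cross /= => e.
    by rewrite eq_complex /=; apply/andP; split; apply/eqP; lra.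
  have [|v3 v4] := h (complex.Im v) (- complex.Im u).
    apply/eqP; case: u v e {h v1 v2} => ? ? [? ?]; rewrite /cross /= => e.
    by rewrite eq_complex /=; apply/andP; split; apply/eqP; lra.
  have [|] := h 1 0; last by move/eqP; rewrite oner_eq0.
  move: v2 v4 => /eqP; rewrite oppr_eq0 => /eqP v2 /eqP; rewrite oppr_eq0 => /eqP v4.
  have -> : u = 0 by apply/eqP; rewrite eq_complex v2 v4 !eqxx.
  by rewrite mulr0 mul0r addr0.
case: u v => u1 u2 [v1 v2]; rewrite /cross /= => ne x y.
move/eqP; rewrite eq_complex /= => /andP[/eqP e1 /eqP e2].
have f1 : x * u1 + y * v1 = 0 by lra.
have f2 : x * u2 + y * v2 = 0 by lra.
split; apply/eqP; rewrite -(mulIr_eq0 _ (mulIf ne)); apply/eqP.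
  transitivity ((x * u1 + y * v1) * v2 - (x * u2 + y * v2) * v1); first by ring.
  by rewrite f1 f2; ring.
transitivity ((x * u2 + y * v2) * u1 - (x * u1 + y * v1) * u2); first by ring.
by rewrite f1 f2; ring.
Qed.

Lemma sub_fset3 (s : {fset R[i]}) a b c (F : R[i] -> R) :
  a != b -> a != c -> b != c -> (s `<=` [fset a; b; c])%fset ->
  forall G : R[i] -> R[i], \sum_(x <- s) (F x)%:C * G x =
  (if a \in s then F a else 0)%:C * G a + (if b \in s then F b else 0)%:C * G b
    + (if c \in s then F c else 0)%:C * G c.
Proof.
move=> ab ac bc /fsubsetP sub G.
transitivity (\sum_(x <- [:: a; b; c] | x \in s) (F x)%:C * G x).
  rewrite -[RHS]big_filter; apply: perm_big; apply: uniq_perm.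
  - exact: fset_uniq.
  - by rewrite filter_uniq//= !inE negb_or ab ac bc.
  - move=> x; rewrite mem_filter; apply/idP/andP => [xs|[]//]; split=> //.
    by have := sub _ xs; rewrite !inE orbA.
rewrite !big_cons big_nil.
by case: ifP; case: ifP; case: ifP => *; rewrite ?mul0r; ring.
Qed.

(** Barycentric coordinates padded with zeros: a triangle, an edge and a vertex, the possible
    intersections of two triangles, are handled in the same way. *)
Lemma hull_sub (s : {fset R[i]}) a b c z :
  a != b -> a != c -> b != c -> (s `<=` [fset a; b; c])%fset -> hull s z ->
  exists p q r : R, [/\ [/\ 0 <= p, 0 <= q & 0 <= r], p + q + r = 1,
    z = p%:C * a + q%:C * b + r%:C * c &
    [/\ a \notin s -> p = 0, b \notin s -> q = 0 & c \notin s -> r = 0]].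
Proof.
move=> ab ac bc sub [F [F0 F1 ->]].
exists (if a \in s then F a else 0), (if b \in s then F b else 0), (if c \in s then F c else 0).
split.
- by split; case: ifP => // /F0.
- have := sub_fset3 F ab ac bc sub (fun=> 1).
  under eq_bigr do rewrite mulr1.
  rewrite -raddf_sum /= F1 !mulr1 -!rmorphD /=.
  by move/eqP; rewrite eq_complex /= => /andP[/eqP <-].
- exact: sub_fset3.
- by split; case: ifP.
Qed.

Lemma hull3 a b c z (p q r : R) : a != b -> a != c -> b != c ->
  0 <= p -> 0 <= q -> 0 <= r -> p + q + r = 1 ->
  z = p%:C * a + q%:C * b + r%:C * c -> hull [fset a; b; c]%fset z.
Proof.
move=> ab ac bc p0 q0 r0 e ->.
pose F (x : R[i]) := if x == a then p else if x == b then q else r.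
have Fa : F a = p by rewrite /F eqxx.
have Fb : F b = q by rewrite /F eq_sym (negbTE ab) eqxx.
have Fc : F c = r by rewrite /F eq_sym (negbTE ac) eq_sym (negbTE bc).
exists F; have S := sub_fset3 F ab ac bc (fsubset_refl _).
move: S; rewrite !inE !eqxx !orbT /= Fa Fb Fc => S.
split; last by rewrite S.
- by move=> x _; rewrite /F; case: ifP => // _; case: ifP.
- have := S (fun=> 1); under eq_bigr do rewrite mulr1.
  rewrite -raddf_sum /= !mulr1 -!rmorphD /= e.
  by move/eqP; rewrite eq_complex /= => /andP[/eqP].
Qed.

Lemma bary_coord a b c z (p q r : R) : p + q + r = 1 ->
  z = p%:C * a + q%:C * b + r%:C * c ->
  [/\ area z b c = p * area a b c, area a z c = q * area a b c &
      area a b z = r * area a b c].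
Proof.
move=> e ->; have -> : p = 1 - q - r by lra.
by rewrite /area /cross; case: a b c => ? ? [? ?] [? ?] /=; split; ring.
Qed.

Lemma area_bary a b c z : area a b c != 0 ->
  z = (area z b c / area a b c)%:C * a + (area a z c / area a b c)%:C * b +
      (area a b z / area a b c)%:C * c.
Proof.
rewrite /area /cross; case: a b c z => a1 a2 [b1 b2] [c1 c2] [z1 z2] /= ne.
by apply/eqP; rewrite eq_complex /=; apply/andP; split; apply/eqP; field.
Qed.

Lemma area_sum a b c z : area z b c + area a z c + area a b z = area a b c.
Proof. by rewrite /area /cross; case: a b c z => ? ? [? ?] [? ?] [? ?] /=; ring. Qed.

Lemma area_neq a b c : area a b c != 0 -> [/\ a != b, a != c & b != c].
Proof.
move=> ne; split; apply: contra_neq ne => ->;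
  by rewrite /area /cross ?subrr /=; ring.
Qed.

Lemma hull3P a b c z : area a b c != 0 -> hull [fset a; b; c]%fset z <->
  [/\ 0 <= area z b c / area a b c, 0 <= area a z c / area a b c &
      0 <= area a b z / area a b c].
Proof.
move=> ne; have [ab ac bc] := area_neq ne; split.
  move=> /(hull_sub ab ac bc (fsubset_refl _)) [p [q [r [[p0 q0 r0] e ze _]]]].
  by have [-> -> ->] := bary_coord e ze; rewrite !mulfK.
move=> [h1 h2 h3]; apply: (hull3 ab ac bc h1 h2 h3); last exact: area_bary.
by rewrite -!mulrDl area_sum divff.
Qed.

End Plane.

Lemma int_ind2 (Q : int * int -> Prop) : Q 0 ->
  (forall z, Q z -> [/\ Q (z + (1, 0)), Q (z - (1, 0)), Q (z + (0, 1)) & Q (z - (0, 1))]) ->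
  forall z, Q z.
Proof.
move=> Q0 QS.
have Q1 m : Q (m, 0).
  elim/int_ind: m => [//|m /QS[+ _ _ _]|m /QS[_ + _ _]].
    by rewrite /GRing.add /= /add_pair /= intS addr0 addrC.
  by rewrite /GRing.add /= /add_pair /= intS opprD addr0 addrC.
case=> m; elim/int_ind => [|n /QS[_ _ + _]|n /QS[_ _ _ +]]; first exact: Q1.
  by rewrite /GRing.add /= /add_pair /= intS addr0 addrC.
by rewrite /GRing.add /= /add_pair /= intS opprD oppr0 addr0 addrC.
Qed.

(** * Geometric triangulations *)

Section Triangulation.
Context {R : realType}.
Implicit Types (a b c d u v z : R[i]) (x y : R) (T : set {fset R[i]}) (s : {fset R[i]}).

Lemma openCP (U : set R[i]) z : Defs.openC U -> U z ->
  exists2 e : R, 0 < e & forall z', cdist z z' < e -> U z'.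
Proof.
move=> oU Uz; have : nbhs (z : R[i]^o) U by apply: open_nbhs_nbhs.
move=> /nbhs_ballP[e /= e0 he]; move: e0 he.
case: e => e1 e2; rewrite ltcE /= => /andP[/eqP -> e0] he.
exists e1 => // z' hz; apply: he; rewrite /ball /= /cdist in hz *.
by rewrite normc_def ltcR; case: (z - z') hz.
Qed.

Lemma intCE u (m : int) : u *~ m = (m%:~R : R)%:C * u.
Proof. by rewrite -mulrzl rmorph_int. Qed.

Lemma fset3_rot a b c : [fset a; b; c]%fset = [fset b; c; a]%fset.
Proof. by apply/fsetP => x; rewrite !inE -orbA orbC. Qed.

Lemma fset3_swap a b c : [fset a; b; c]%fset = [fset a; c; b]%fset.
Proof. by apply/fsetP => x; rewrite !inE -!orbA [(x == b) || _]orbC. Qed.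

Lemma geometric_area T a b c : geometric_triangulation T ->
  T [fset a; b; c]%fset -> area a b c != 0.
Proof.
move=> [+ _ _ _] Tt => /(_ _ Tt) [a' [b' [c' [e]]]].
rewrite R_independentP; apply: contra_neq => h; rewrite -/(area a' b' c').
have mem (x : R[i]) : x \in [fset a'; b'; c']%fset -> [\/ x = a, x = b | x = c].
  by rewrite -e !inE -orbA => /or3P[] /eqP; [constructor 1|constructor 2|constructor 3].
have [] := (mem a', mem b', mem c') => [[]]; rewrite !inE !eqxx !orbT => /(_ isT) ma /(_ isT) mb /(_ isT) mc.
move: h; rewrite /area /cross.
by case: ma => ->; case: mb => ->; case: mc => ->;
  case: (a) (b) (c) => ? ? [? ?] [? ?] /=; lra.
Qed.

Lemma triangle_at T t a : geometric_triangulation T -> T t -> a \in t ->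
  exists b c, t = [fset a; b; c]%fset.
Proof.
move=> [+ _ _ _] Tt => /(_ _ Tt) [a' [b' [c' [-> _]]]].
rewrite !inE -orbA => /or3P[] /eqP ->.
- by exists b', c'.
- by exists c', a'; rewrite fset3_rot.
- by exists a', b'; rewrite -fset3_rot.
Qed.

Lemma triangle_edge T t b c : geometric_triangulation T -> T t -> b \in t ->
  c \in t -> b != c -> exists d, t = [fset b; c; d]%fset.
Proof.
move=> gT Tt bt; have [x [y tE]] := triangle_at gT Tt bt.
rewrite {1}tE !inE -orbA => /or3P[] /eqP e.
- by rewrite e eqxx.
- by exists y; rewrite e.
- by exists x; rewrite e tE fset3_swap.
Qed.

Lemma hull_meet T t t' z : geometric_triangulation T -> T t -> T t' ->
  hull t z -> hull t' z -> hull (t `&` t')%fset z.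
Proof. by move=> [_ + _ _] Tt Tt' h h' => /(_ _ _ Tt Tt') <-. Qed.

(** The two triangles meet in the hull of their common vertices, and v is an extreme point of its
    own triangle. *)
Lemma vertex_in_hull T t v : geometric_triangulation T -> T t ->
  vertices T v -> hull t v -> v \in t.
Proof.
move=> gT Tt [t' Tt' vt'] hv.
have [b [c tE]] := triangle_at gT Tt' vt'.
have ne := geometric_area gT (eq_ind _ T Tt' _ tE).
have [vb vc bc] := area_neq ne.
have hv' : hull t' v.
  by rewrite tE; apply: (@hull3 _ v b c v 1 0 0) => //; rewrite ?addr0// !mul0r !addr0 mul1r.
have sub : (t `&` t' `<=` [fset v; b; c])%fset by rewrite -tE fsubsetIr.
have := hull_sub vb vc bc sub (hull_meet gT Tt Tt' hv hv').
move=> [p [q [r [_ e vE [+ _ _]]]]].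
have [h _ _] := bary_coord e vE.
have p1 : p = 1 by apply: (mulIf ne); rewrite -h mul1r.
by rewrite p1 !inE vt' andbT; case: (v \in t) => // /(_ isT)/eqP; rewrite oner_eq0.
Qed.

Lemma near_all_seq (X : eqType) (F : set_system R) (FF : Filter F) (r : seq X)
    (P : X -> R -> Prop) :
  (forall t, t \in r -> \forall s \near F, P t s) ->
  \forall s \near F, forall t, t \in r -> P t s.
Proof.
elim: r => [|t r IH] h; first by near=> s.
have h1 := h t (mem_head _ _).
have h2 : \forall s \near F, forall t, t \in r -> P t s.
  by apply: IH => t' t'r; apply: h; rewrite inE t'r orbT.
near=> s => t'; rewrite inE => /predU1P[->|]; last first.
  by move: t'; near: s.
by near: s.
Unshelve. all: by end_near. Qed.

(** Walk from a through the midpoint m of bc and slightly beyond it. By local finiteness, a triangle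
    that covers the points reached must contain m. Its intersection with abc is a common face
    through m, which is interior to the edge bc, so it has both b and c as vertices. *)
Lemma neighbor T a b c : geometric_triangulation T -> T [fset a; b; c]%fset ->
  exists2 d, T [fset b; c; d]%fset & area b c d * area a b c < 0.
Proof.
move=> gT Tt; have ne := geometric_area gT Tt.
have [ab ac bc] := area_neq ne.
pose m := (2^-1 : R)%:C * (b + c); pose p (x : R) := m + x%:C * (m - a).
have pE x : area b c (p x) = - x * area a b c.
  rewrite /p /m /area /cross; case: (a) (b) (c) => ? ? [? ?] [? ?] /=.
  by field.
have [_ _ cov /(_ m) [U [oU Um fU]]] := gT.
have [r rE] : exists r : seq {fset R[i]}, [set t | T t /\ hull t `&` U !=set0] = [set` r].
  by apply/finite_seqP.
have [e e0 eU] := openCP oU Um.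
have h1 : \forall x \near 0^'+, U (p x).
  near=> x; apply: eU; rewrite cdistE.
  have -> : dot (m - p x) (m - p x) = x ^+ 2 * dot (m - a) (m - a).
    by rewrite /p /dot; case: (m) (a) => ? ? [? ?] /=; ring.
  have x0 : 0 < x by near: x; exact: nbhs_right_gt.
  have xe : x < e / (Num.sqrt (dot (m - a) (m - a)) + 1).
    by near: x; apply: nbhs_right_lt; rewrite divr_gt0// ltr_wpDl// sqrtr_ge0.
  have k : 0 < Num.sqrt (dot (m - a) (m - a)) + 1 by rewrite ltr_wpDl// sqrtr_ge0.
  rewrite sqrtrM ?sqr_ge0// sqrtr_sqr gtr0_norm//.
  by move: xe; rewrite ltr_pdivlMr//; nra.
(* A triangle that misses m has a negative barycentric coordinate there, which is affine in x and
   stays negative for small x. *)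
have h2 : \forall x \near 0^'+, forall t, t \in r -> ~ hull t m -> ~ hull t (p x).
  apply: near_all_seq => t tr.
  have [Tt' _] : [set t | T t /\ hull t `&` U !=set0] t by rewrite rE.
  have [hm|hm] := pselect (hull t m); first by near=> x.
  have [a' [b' [c' [tE _]]]] : triangle t by have [+ _ _ _] := gT; exact.
  have ne' : area a' b' c' != 0 by apply: (geometric_area gT); rewrite -tE.
  pose f1 z := area z b' c' / area a' b' c'.
  pose f2 z := area a' z c' / area a' b' c'.
  pose f3 z := area a' b' z / area a' b' c'.
  have aff (f : R[i] -> R) : (forall x, f (p x) = f m + x * (f (p 1) - f m)) -> f m < 0 ->
     \forall x \near 0^'+, f (p x) < 0.
    move=> fE fm; near=> x; rewrite fE.
    have x0 : 0 < x by near: x; exact: nbhs_right_gt.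
    have : x < - f m / (`|f (p 1) - f m| + 1).
      by near: x; apply: nbhs_right_lt; rewrite divr_gt0 ?oppr_gt0// ltr_wpDl.
    have := ler_norm (f (p 1) - f m); set n := `|_| => hn.
    have n0 : 0 <= n by exact: normr_ge0.
    by rewrite ltr_pdivlMr; nra.
  have E1 x : f1 (p x) = f1 m + x * (f1 (p 1) - f1 m).
    by rewrite /f1 /p /area /cross; case: (m) (a) (b') (c') => ? ? [? ?] [? ?] [? ?] /=; ring.
  have E2 x : f2 (p x) = f2 m + x * (f2 (p 1) - f2 m).
    by rewrite /f2 /p /area /cross; case: (m) (a) (a') (c') => ? ? [? ?] [? ?] [? ?] /=; ring.
  have E3 x : f3 (p x) = f3 m + x * (f3 (p 1) - f3 m).
    by rewrite /f3 /p /area /cross; case: (m) (a) (a') (b') => ? ? [? ?] [? ?] [? ?] /=; ring.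
  have neg : [\/ f1 m < 0, f2 m < 0 | f3 m < 0].
    case: (ltP (f1 m) 0) => [|g1]; first by constructor 1.
    case: (ltP (f2 m) 0) => [|g2]; first by constructor 2.
    case: (ltP (f3 m) 0) => [|g3]; first by constructor 3.
    by exfalso; apply: hm; rewrite tE; apply/(hull3P _ ne').
  suff : \forall x \near 0^'+, [\/ f1 (p x) < 0, f2 (p x) < 0 | f3 (p x) < 0].
    apply: filterS => x h _; rewrite tE => /(hull3P _ ne').
    by rewrite -/(f1 (p x)) -/(f2 (p x)) -/(f3 (p x)) => -[g1 g2 g3]; case: h; rewrite ltNge ?g1 ?g2 ?g3.
  case: neg => hn.
  - by apply: filterS (aff f1 E1 hn) => x; constructor 1.
  - by apply: filterS (aff f2 E2 hn) => x; constructor 2.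
  - by apply: filterS (aff f3 E3 hn) => x; constructor 3.
have [x [x0 Ux hx]] : exists x, [/\ 0 < x, U (p x) & forall t, t \in r -> ~ hull t m -> ~ hull t (p x)].
  near (0:R)^'+ => x; exists x; split; last 1 first.
  - by near: x.
  - by near: x; exact: nbhs_right_gt.
  - by near: x.
have [t' Tt' ht'] := cov (p x).
have t'r : t' \in r.
  have : [set t | T t /\ hull t `&` U !=set0] t' by split=> //; exists (p x).
  by rewrite rE.
have {}hx : hull t' m by apply: contrapT => /(hx _ t'r).
have hm : hull [fset a; b; c]%fset m.
  apply: (@hull3 _ a b c m 0 2^-1 2^-1) => //; first by field.
  by rewrite /m mul0r add0r mulrDr.
have := hull_sub ab ac bc (fsubsetIl _ _) (hull_meet gT Tt Tt' hm hx).
move=> [p1 [p2 [p3 [_ e1 mE [_ hb hc]]]]].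
have [_ k2 k3] := bary_coord e1 mE.
have bt : b \in t'.
  apply/negP => /negP bt; have : p2 = 0 by apply: hb; rewrite !inE negb_and bt orbT.
  move=> e2; move: k2; rewrite e2 mul0r => /eqP; apply/negP.
  rewrite (_ : area _ _ _ = area a b c / 2) ?mulf_neq0 ?invr_eq0 ?pnatr_eq0//.
  by rewrite /m /area /cross; case: (a) (b) (c) => ? ? [? ?] [? ?] /=; field.
have ct : c \in t'.
  apply/negP => /negP ct; have : p3 = 0 by apply: hc; rewrite !inE negb_and ct orbT.
  move=> e2; move: k3; rewrite e2 mul0r => /eqP; apply/negP.
  rewrite (_ : area _ _ _ = area a b c / 2) ?mulf_neq0 ?invr_eq0 ?pnatr_eq0//.
  by rewrite /m /area /cross; case: (a) (b) (c) => ? ? [? ?] [? ?] /=; field.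
have [d t'E] := triangle_edge gT Tt' bt ct bc.
exists d; first by rewrite -t'E.
have ne' : area b c d != 0 by apply: (geometric_area gT); rewrite -t'E.
move: ht'; rewrite t'E => /(hull3P _ ne') [_ _]; rewrite pE => k.
have l1 : - x * area a b c != 0 by rewrite mulf_neq0// oppr_eq0 gt_eqF.
have l2 : 0 < - x * area a b c / area b c d by rewrite lt_neqAle k andbT eq_sym mulf_neq0// invr_eq0.
have : 0 < - x * area a b c / area b c d * (area b c d ^+ 2).
  by rewrite pmulr_rgt0// lt_neqAle eq_sym sqrf_eq0 ne' sqr_ge0.
by rewrite expr2 mulrA mulfVK//; nra.
Unshelve. all: by end_near. Qed.

Lemma segment_finite T p q : geometric_triangulation T ->
  finite_set [set t | T t /\ exists2 x, 0 <= x <= 1 & hull t (p + x%:C * (q - p))].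
Proof.
move=> gT; have [_ _ _ lf] := gT.
pose f (x : R) := p + x%:C * (q - p).
have /choice[e he] : forall x : R, exists e : R, 0 < e /\
    finite_set [set t | T t /\ exists2 y, ball x e y & hull t (f y)].
  move=> x; have [U [oU Um fU]] := lf (f x).
  have [e e0 eU] := openCP oU Um.
  have n0 : 0 < Num.sqrt (dot (q - p) (q - p)) + 1 by rewrite ltr_wpDl// sqrtr_ge0.
  exists (e / (Num.sqrt (dot (q - p) (q - p)) + 1)).
  split; first by rewrite divr_gt0.
  apply: sub_finite_set fU => t [Tt [y xy hy]]; split=> //; exists (f y); split=> //.
  apply: eU; rewrite cdistE.
  have -> : dot (f x - f y) (f x - f y) = (x - y) ^+ 2 * dot (q - p) (q - p).
    by rewrite /f /dot; case: (q) (p) => ? ? [? ?] /=; ring.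
  move: xy; rewrite /ball /= ltr_pdivlMr// => h.
  rewrite sqrtrM ?sqr_ge0// sqrtr_sqr.
  by apply: le_lt_trans h; rewrite ler_wpM2l// lerDl.
have : compact `[(0 : R), 1]%classic by exact: segment_compact.
rewrite compact_cover => /(_ R setT (fun x => ball x (e x))) [x _||D _ cD].
- by apply: ball_open; have [] := he x.
- by move=> x _; exists x => //; apply: ballxx; have [] := he x.
apply: (@sub_finite_set _ _ (\bigcup_(x in [set` D]) [set t | T t /\ exists2 y, ball x (e x) y & hull t (f y)])).
  move=> t [Tt [x x01 hx]]; have [|y Dy xy] := cD x; first by rewrite /= in_itv.
  by exists y => //; split=> //; exists x.
by apply: bigcup_finite => // x _; have [] := he x.
Qed.

End Triangulation.

(** * The Delaunay condition and bases of the lattice *)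

Section Delaunay.
Context {R : realType}.
Implicit Types (a b c d u v z : R[i]) (x y : R) (T : set {fset R[i]}) (l : R[i] -> R[i] -> R).

Definition cosang l c a b : R :=
  (l c a ^+ 2 + l c b ^+ 2 - l a b ^+ 2) / (2 * l c a * l c b).

Lemma law_of_cosines_itv (x y z : R) : 0 < x -> 0 < y -> 0 < z ->
  z < x + y -> x < y + z -> y < x + z ->
  -1 <= (x ^+ 2 + y ^+ 2 - z ^+ 2) / (2 * x * y) <= 1.
Proof.
move=> x0 y0 z0 h1 h2 h3; have p : 0 < 2 * x * y by rewrite !mulr_gt0.
by rewrite ler_pdivlMr// ler_pdivrMr//; apply/andP; split; nra.
Qed.

Lemma PL_cosang T l a b c : geometric_triangulation T -> PL_metric T l ->
  T [fset a; b; c]%fset -> -1 <= cosang l c a b <= 1.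
Proof.
move=> gT [lC l0 lt] Tt; have [ab ac bc] := area_neq (geometric_area gT Tt).
have E u v : u != v -> u \in [fset a; b; c]%fset -> v \in [fset a; b; c]%fset -> edge T u v.
  by move=> uv ut vt; split=> //; exists [fset a; b; c]%fset.
have in3 : [/\ a \in [fset a; b; c]%fset, b \in [fset a; b; c]%fset & c \in [fset a; b; c]%fset].
  by rewrite !inE !eqxx !orbT.
case: in3 => ia ib ic.
have Tt1 := Tt; rewrite fset3_rot in Tt1; have Tt2 := Tt1; rewrite fset3_rot in Tt2.
have := lt _ _ _ Tt; have := lt _ _ _ Tt1; have := lt _ _ _ Tt2.
rewrite (lC b a) ?(lC b c) ?(lC a c); try by apply: E => //; rewrite eq_sym.
rewrite /cosang => h1 h2 h3; apply: law_of_cosines_itv.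
- by apply: l0; apply: E => //; rewrite eq_sym.
- by apply: l0; apply: E => //; rewrite eq_sym.
- by apply: l0; apply: E.
- by lra.
- by lra.
- by lra.
Qed.

(** As cos decreases on [0, pi], two angles with sum at most pi have cosines with nonnegative
    sum. *)
Lemma Delaunay_cosang T l a b c d : geometric_triangulation T -> PL_metric T l ->
  Delaunay T l -> T [fset a; b; c]%fset -> T [fset a; b; d]%fset -> c != d ->
  0 <= cosang l c a b + cosang l d a b.
Proof.
move=> gT PL D Tc Td cd; have := D _ _ _ _ cd Tc Td.
rewrite /angle -/(cosang l c a b) -/(cosang l d a b) => le.
have ic := PL_cosang gT PL Tc; have id := PL_cosang gT PL Td.
have iN : -1 <= - cosang l c a b <= 1 by move: ic => /andP[? ?]; apply/andP; split; lra.
rewrite leNgt; apply/negP => lt.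
have : acos (- cosang l c a b) < acos (cosang l d a b).
  rewrite -ltr_cos ?in_itv/= ?acos_ge0 ?acos_lepi// !acosK//.
  by lra.
by rewrite acosN//; lra.
Qed.

Lemma cosang_cdist c a b : a != c -> b != c ->
  cosang cdist c a b = dot (a - c) (b - c) / (cdist c a * cdist c b).
Proof.
move=> ac bc; have h1 : 0 < cdist c a by rewrite cdist_gt0// eq_sym.
have h2 : 0 < cdist c b by rewrite cdist_gt0// eq_sym.
have e : cdist c a ^+ 2 + cdist c b ^+ 2 - cdist a b ^+ 2 = 2 * dot (a - c) (b - c).
  by rewrite !cdist_sqr /dot; case: (a) (b) (c) => ? ? [? ?] [? ?] /=; ring.
by rewrite /cosang e; field; rewrite !gt_eqF.
Qed.

Lemma PL_metric_cdist T : geometric_triangulation T -> PL_metric T cdist.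
Proof.
move=> gT; split=> [u v _|u v [uv _]|a b c Tt]; [exact: cdistC|exact: cdist_gt0|].
have := geometric_area gT Tt; have [ab ac bc] := area_neq (geometric_area gT Tt) => ne.
have h1 := cdist_gt0 ab; have h2 := cdist_gt0 ac; have h3 := cdist_gt0 bc.
rewrite -(ltr_pXn2r (n := 2)) ?nnegrE ?addr_ge0// ?ltW//.
rewrite sqrrD !cdist_sqr.
have e : dot (b - c) (b - c) = dot (a - b) (a - b) + dot (a - c) (a - c) - 2 * dot (b - a) (c - a).
  by rewrite /dot; case: (a) (b) (c) => ? ? [? ?] [? ?] /=; ring.
have e2 : (cdist a b * cdist a c) ^+ 2 = dot (b - a) (c - a) ^+ 2 + area a b c ^+ 2.
  rewrite exprMn !cdist_sqr /dot /area /cross; case: (a) (b) (c) => ? ? [? ?] [? ?] /=; ring.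
have k : - dot (b - a) (c - a) < cdist a b * cdist a c.
  rewrite ltNge; apply/negP => k.
  have : 0 < area a b c ^+ 2 by rewrite lt_neqAle eq_sym sqrf_eq0 ne sqr_ge0.
  have : 0 < cdist a b * cdist a c by rewrite mulr_gt0.
  by nra.
by rewrite e mulr2n; lra.
Qed.

Lemma Delaunay_dot T a b c d : geometric_triangulation T -> Delaunay T cdist ->
  T [fset a; b; c]%fset -> T [fset a; b; d]%fset -> c != d ->
  dot (a - c) (b - c) < 0 -> 0 < dot (a - d) (b - d).
Proof.
move=> gT D Tc Td cd neg.
have [ab ac bc] := area_neq (geometric_area gT Tc).
have [_ ad bd] := area_neq (geometric_area gT Td).
have := Delaunay_cosang gT (PL_metric_cdist gT) D Tc Td cd.
rewrite !cosang_cdist//.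
have p1 : 0 < cdist c a * cdist c b by rewrite mulr_gt0// cdist_gt0// eq_sym.
have p2 : 0 < cdist d a * cdist d b by rewrite mulr_gt0// cdist_gt0// eq_sym.
have n1 : dot (a - c) (b - c) / (cdist c a * cdist c b) < 0.
  by rewrite pmulr_llt0// invr_gt0.
move=> h; have : 0 < dot (a - d) (b - d) / (cdist d a * cdist d b) by lra.
by rewrite pmulr_lgt0// invr_gt0.
Qed.

Lemma lattice_affine (L : set R[i]) a b c (m : int) : lattice L ->
  L a -> L b -> L c -> L (a + (b - c) *~ m).
Proof.
move=> [u1 [u2 [_ ->]]] [m1 [n1 ->]] [m2 [n2 ->]] [m3 [n3 ->]] /=.
exists (m1 + (m2 - m3) * m), (n1 + (n2 - n3) * m).
rewrite !intCE !rmorphD/= !rmorphM/= !rmorphB/=.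
by case: u1 u2 => ? ? [? ?]; apply/eqP; rewrite eq_complex /=; apply/andP; split; apply/eqP; ring.
Qed.

Lemma tri_vertices T a b c : T [fset a; b; c]%fset ->
  [/\ vertices T a, vertices T b & vertices T c].
Proof. by move=> Tt; split; exists [fset a; b; c]%fset; rewrite // !inE !eqxx ?orbT. Qed.

(** A triangle of T contains no vertex but its corners. Reducing d modulo the edge vectors gives a
    vertex in the half-open parallelogram on them; this vertex, or its mirror image in the centre of
    the parallelogram, lies in the triangle, hence is a corner. *)
Lemma lattice_basis T a b c d : geometric_triangulation T ->
  lattice (vertices T) -> T [fset a; b; c]%fset -> vertices T d ->
  exists m n : int, d = a + (b - a) *~ m + (c - a) *~ n.
Proof.
move=> gT L Tt Ld; have [La Lb Lc] := tri_vertices Tt.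
have ne := geometric_area gT Tt; have [ab ac bc] := area_neq ne.
pose s := area a d c / area a b c; pose t := area a b d / area a b c.
have dE : d = a + s%:C * (b - a) + t%:C * (c - a).
  rewrite {1}(area_bary d ne) -/s -/t; have : s + t + area d b c / area a b c = 1.
    by rewrite -!mulrDl addrC addrA area_sum divff.
  move=> h; have -> : area d b c / area a b c = 1 - s - t by lra.
  by case: (a) (b) (c) => ? ? [? ?] [? ?]; apply/eqP; rewrite eq_complex /=; apply/andP; split; apply/eqP; ring.
pose m := Num.floor s; pose n := Num.floor t.
pose s' := s - m%:~R; pose t' := t - n%:~R.
have [s0 s1] : 0 <= s' /\ s' < 1.
  by rewrite /s' subr_ge0 ltrBlDl floor_le; split=> //; rewrite -[X in _ + X]/(1%:~R) -intrD floorD1_gt.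
have [t0 t1] : 0 <= t' /\ t' < 1.
  by rewrite /t' subr_ge0 ltrBlDl floor_le; split=> //; rewrite -[X in _ + X]/(1%:~R) -intrD floorD1_gt.
pose x := a + s'%:C * (b - a) + t'%:C * (c - a).
have Lx : vertices T x.
  have -> : x = (d + (a - b) *~ m) + (a - c) *~ n.
    rewrite dE /x /s' /t' !intCE; case: (a) (b) (c) => ? ? [? ?] [? ?].
    by apply/eqP; rewrite eq_complex /=; apply/andP; split; apply/eqP; ring.
  by do 2!apply: lattice_affine => //.
suff [s'0 t'0] : s' = 0 /\ t' = 0.
  exists m, n; rewrite dE !intCE; congr (_ + _%:C * _ + _%:C * _); rewrite /s' /t' in s'0 t'0; lra.
have in_tri p q : 0 <= p -> 0 <= q -> p + q <= 1 -> vertices T (a + p%:C * (b - a) + q%:C * (c - a)) ->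
    [\/ p = 0 /\ q = 0, p = 1 /\ q = 0 | p = 0 /\ q = 1].
  move=> p0 q0 pq Lp; set y := (X in vertices T X) in Lp.
  have k1 : area a y c = p * area a b c.
    by rewrite /y /area /cross; case: (a) (b) (c) => ? ? [? ?] [? ?] /=; ring.
  have k2 : area a b y = q * area a b c.
    by rewrite /y /area /cross; case: (a) (b) (c) => ? ? [? ?] [? ?] /=; ring.
  have hy : hull [fset a; b; c]%fset y.
    apply: (@hull3 _ a b c y (1 - p - q) p q) => //; [by rewrite -addrA -opprD subr_ge0|by ring|].
    rewrite /y; case: (a) (b) (c) => ? ? [? ?] [? ?].
    by apply/eqP; rewrite eq_complex /=; apply/andP; split; apply/eqP; ring.
  have := vertex_in_hull gT Tt Lp hy; rewrite !inE -orbA.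
  have zz : area a a c = 0 /\ area a b b = 0 /\ area a b a = 0 /\ area a c c = 0.
    by rewrite /area /cross; case: (a) (b) (c) => ? ? [? ?] [? ?] /=; do !split; ring.
  case: zz => z1 [z2 [z3 z4]].
  move=> /or3P[] /eqP e; move: k1 k2; rewrite e ?z1 ?z2 ?z3 ?z4 => k1 k2.
  - by constructor 1; split; apply: (mulIf ne); rewrite mul0r.
  - by constructor 2; split; apply: (mulIf ne); rewrite ?mul0r ?mul1r.
  - by constructor 3; split; apply: (mulIf ne); rewrite ?mul0r ?mul1r.
have [le|gt] := leP (s' + t') 1.
  by case: (in_tri s' t' s0 t0 le Lx) => -[] //; lra.
have : vertices T (a + (1 - s')%:C * (b - a) + (1 - t')%:C * (c - a)).
  have -> : a + (1 - s')%:C * (b - a) + (1 - t')%:C * (c - a) = (b + (c - x) *~ 1).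
    rewrite /x intCE; case: (a) (b) (c) => ? ? [? ?] [? ?].
    by apply/eqP; rewrite eq_complex /=; apply/andP; split; apply/eqP; ring.
  exact: lattice_affine.
by move=> /(in_tri _ _ _ _ _) [|||[]|[]|[]]; lra.
Qed.

(** Both triangles give bases of the lattice, so their signed areas agree up to a sign, and the
    signs differ because the triangles lie on opposite sides of bc. So the apex lies on the parallel
    to bc through b + c - a. *)
Lemma neighbor_lattice T a b c : geometric_triangulation T ->
  lattice (vertices T) -> T [fset a; b; c]%fset ->
  exists2 k : int, T [fset b; c; (b + c - a + (c - b) *~ k)%R]%fset &
    a != b + c - a + (c - b) *~ k.
Proof.
move=> gT L Tt; have [d Td lt] := neighbor gT Tt.
have [La Lb Lc] := tri_vertices Tt; have [_ _ Ld] := tri_vertices Td.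
have ne := geometric_area gT Tt.
have [m [n dE]] := lattice_basis gT L Tt Ld.
have [m' [n' aE]] := lattice_basis gT L Td La.
have e1 : area b c d = (1 - m - n)%:~R * area a b c.
  by rewrite dE !intCE /area /cross !rmorphB/=; case: (a) (b) (c) => ? ? [? ?] [? ?] /=; ring.
have e2 : area a b c = n'%:~R * area b c d.
  by rewrite {1}aE !intCE /area /cross; case: (b) (c) (d) => ? ? [? ?] [? ?] /=; ring.
have e3 : n' * (1 - m - n) = 1.
  apply/eqP; rewrite -(eqr_int R) rmorphM/=; apply/eqP; apply: (mulIf ne).
  by rewrite -mulrA -e1 -e2 mul1r.
have e4 : (1 - m - n)%:~R < 0 :> R.
  have : 0 < area a b c ^+ 2 by rewrite lt_neqAle eq_sym sqrf_eq0 ne sqr_ge0.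
  by move: lt; rewrite e1; nra.
rewrite ltrz0 in e4.
have e5 : m = 2 - n.
  have [h|h] : n' <= -1 \/ 0 <= n' by lia.
    have [|h'] : 1 - m - n <= -2 \/ 1 - m - n = -1 by lia.
      by move=> h'; exfalso; clear -h h' e3; nia.
    by lia.
  by exfalso; clear -h e4 e3; nia.
have dE' : d = b + c - a + (c - b) *~ (n - 1).
  rewrite dE e5 !intCE; rewrite !rmorphB/=; case: (a) (b) (c) => ? ? [? ?] [? ?].
  by apply/eqP; rewrite eq_complex /=; apply/andP; split; apply/eqP; ring.
exists (n - 1); rewrite -dE'//; apply: contraTneq lt => <-.
by rewrite -leNgt areaC areaC -expr2 sqr_ge0.
Qed.

Lemma no_increasing_seq (r : seq R) (P : R -> Prop) :
  (forall x, P x -> x \in r) -> (forall x, P x -> exists2 y, P y & x < y) ->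
  forall x, ~ P x.
Proof.
move=> Pr Pinc v Pv.
have sm x : P x -> exists n, (count (fun y => (x <= y)%R) r <= n)%N by move=> _; eexists.
have [n] := sm v Pv; elim: n v Pv => [|n IH] v Pv; have [v' Pv' lt] := Pinc v Pv.
  rewrite leqn0 -leqn0 leqNgt -has_count => /negP; apply.
  by apply/hasP; exists v; [exact: Pr|rewrite lexx].
move=> h; apply: (IH v' Pv'); rewrite -ltnS (leq_trans _ h)//.
have /permP pr := perm_to_rem (Pr v Pv).
rewrite !pr /= lexx leNgt lt /= add0n add1n ltnS.
by apply: sub_count => y /=; apply: le_trans; exact: ltW.
Qed.

End Delaunay.

(** * Absence of obtuse angles *)

Section Nonobtuse.
Context {R : realType} (T : set {fset R[i]}).
Hypotheses (gT : geometric_triangulation T) (latT : lattice (vertices T))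
  (delT : Delaunay T cdist).
Implicit Types (a b c d p q : R[i]) (x y : R).

(* An obtuse triangle abc which is met by the segment from o to p, where p    *)
(* lies beyond the longest edge bc.                                           *)
Definition obtuse_chain o p a b c : Prop :=
  [/\ T [fset a; b; c]%fset, dot (b - a) (c - a) < 0,
    exists m n : int, [/\ 1 <= m, 1 <= n & p = a + (b - a) *~ m + (c - a) *~ n] &
    exists2 x : R, 0 <= x <= 1 & hull [fset a; b; c]%fset (o + x%:C * (p - o))].

Lemma obtuse_chainC o p a b c : obtuse_chain o p a b c -> obtuse_chain o p a c b.
Proof.
move=> [Tt neg [m [n [m1 n1 pE]]] hs]; split.
- by rewrite fset3_swap.
- by rewrite dotC.
- by exists n, m; split=> //; rewrite addrAC.
- by rewrite fset3_swap.
Qed.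

(* The triangle across bc, with apex d = b + c - a + k (c - b): Delaunay      *)
(* excludes k = 0, and for k > 0 the angle at c is obtuse.                    *)
Lemma obtuse_chain_step_pos o p a b c (k : int) : obtuse_chain o p a b c -> 0 < k ->
  T [fset b; c; (b + c - a + (c - b) *~ k)%R]%fset ->
  let d := b + c - a + (c - b) *~ k in
  obtuse_chain o p c b d /\ dot (b - c) (b - c) < dot (b - d) (b - d).
Proof.
move=> [Tt neg [m [n [m1 n1 pE]]] [x x01 hx]] k0 Td d; rewrite -/d in Td.
have dE : d = b + c - a + (k%:~R : R)%:C * (c - b) by rewrite /d intCE.
have k1 : (1 : R) <= k%:~R by rewrite ler1z; lia.
have m1' : (1 : R) <= m%:~R by rewrite ler1z.
have n1' : (1 : R) <= n%:~R by rewrite ler1z.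
have ne := geometric_area gT Tt; have [ab ac bc] := area_neq ne.
have ne' := geometric_area gT Td; have [_ bd cd] := area_neq ne'.
have pos : 0 < dot (b - c) (b - c) by rewrite dot_gt0// subr_eq0.
have pos2 : 0 < dot (d - c) (d - c) by rewrite dot_gt0// subr_eq0 eq_sym.
have pos3 : 0 < dot (c - a) (c - a) by rewrite dot_gt0// subr_eq0 eq_sym.
have neg' : dot (b - c) (d - c) < 0.
  have : dot (b - c) (d - c) = (1 - k%:~R) * dot (b - c) (b - c) + dot (b - a) (c - a) - dot (c - a) (c - a).
    by rewrite dE /dot; case: (a) (b) (c) => ? ? [? ?] [? ?] /=; ring.
  move=> ->; have : (1 - k%:~R) * dot (b - c) (b - c) <= 0 by rewrite pmulr_lle0// subr_le0.
  by clear -neg pos3; lra.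
have pE' : p = a + (m%:~R : R)%:C * (b - a) + (n%:~R : R)%:C * (c - a) by rewrite pE !intCE.
split; last first.
  have -> : dot (b - d) (b - d) = dot (b - c) (b - c) + dot (d - c) (d - c) - 2 * dot (b - c) (d - c).
    by rewrite /dot; case: (b) (c) (d) => ? ? [? ?] [? ?] /=; ring.
  by clear -neg' pos2; lra.
split=> //.
- by rewrite fset3_swap -fset3_rot.
- exists (m + (m + n - 1) * (k - 1)), (m + n - 1); split; [clear -m1 n1 k0; nia|clear -m1 n1; lia|].
  rewrite pE dE !intCE !rmorphB /= !rmorphD !rmorphM /= !rmorphB /=.
  rewrite !rmorphD /=.
  case: (a) (b) (c) => ? ? [? ?] [? ?].
  by apply/eqP; rewrite eq_complex /=; apply/andP; split; apply/eqP; ring.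
have [h1 h2 h3] := (hull3P _ ne).1 hx.
pose q := o + x%:C * (p - o).
rewrite -/q in h1 h2 h3; set l := area q b c / _ in h1; set u := area a q c / _ in h2.
set v := area a b q / _ in h3.
have qE : q = l%:C * a + u%:C * b + v%:C * c by exact: area_bary.
have luv : l + u + v = 1 by rewrite /l /u /v -!mulrDl area_sum divff.
(* [al] is the first barycentric coordinate of p, negative because p lies beyond bc; the parameter
   [s] is where the segment from q to p crosses the line bc. *)
pose al : R := 1 - m%:~R - n%:~R.
have al0 : al < 0 by rewrite /al; clear -m1' n1'; lra.
have D0 : 0 < l - al by clear -h1 al0; lra.
pose s := l / (l - al).
have s0 : 0 <= s by rewrite divr_ge0// ltW.
have s1 : s <= 1 by rewrite ler_pdivrMr// mul1r; clear -al0; lra.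
have sE : (1 - s) * l + s * al = 0 by rewrite /s; field; rewrite gt_eqF.
have [x0 x1] := andP x01.
exists ((1 - s) * x + s); first by apply/andP; split; clear -s0 s1 x0 x1; nra.
have -> : o + ((1 - s) * x + s)%:C * (p - o) = (1 - s)%:C * q + s%:C * p.
  rewrite /q; case: (o) (p) => ? ? [? ?].
  by apply/eqP; rewrite eq_complex /=; apply/andP; split; apply/eqP; ring.
apply: (@hull3 _ c b d _ ((1 - s) * v + s * n%:~R) ((1 - s) * u + s * m%:~R) 0) => //.
- by rewrite eq_sym.
- by rewrite addr_ge0// mulr_ge0// ?subr_ge0// (le_trans ler01).
- by rewrite addr_ge0// mulr_ge0// ?subr_ge0// (le_trans ler01).
- move: sE luv; rewrite /al => e1 e2; clear -e1 e2; nra.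
have -> : (1 - s) * v + s * n%:~R = (1 - s) * v + s * n%:~R + ((1 - s) * l + s * al) by rewrite sE addr0.
have vE : v = 1 - l - u by clear -luv; lra.
have : ((1 - s) * l + s * al)%:C = 0 :> R[i] by rewrite sE.
rewrite qE pE' vE /al mul0r addr0.
case: (a) (b) (c) => a1 a2 [b1 b2] [c1 c2] /eqP; rewrite eq_complex /= => /andP[/eqP e _].
apply/eqP; rewrite eq_complex /=; apply/andP; split; apply/eqP.
  by transitivity (((1 - s) * l + s * (1 - m%:~R - n%:~R)) * (a1 - c1) + ((1 - s) * (1 - l - u) + s * n%:~R + ((1 - s) * l + s * (1 - m%:~R - n%:~R))) * c1 + ((1 - s) * u + s * m%:~R) * b1); [ring|rewrite e; ring].
by transitivity (((1 - s) * l + s * (1 - m%:~R - n%:~R)) * (a2 - c2) + ((1 - s) * (1 - l - u) + s * n%:~R + ((1 - s) * l + s * (1 - m%:~R - n%:~R))) * c2 + ((1 - s) * u + s * m%:~R) * b2); [ring|rewrite e; ring].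
Qed.

Lemma obtuse_chain_step o p a b c : obtuse_chain o p a b c ->
  exists a' b' c', obtuse_chain o p a' b' c' /\
    dot (b - c) (b - c) < dot (b' - c') (b' - c').
Proof.
move=> ch; have [Tt neg _ _] := ch.
have [k Td ad] := neighbor_lattice gT latT Tt.
have [k0|k0|k0] := ltgtP k 0; last 1 first.
- move: Td ad; rewrite k0 mulr0z addr0 => Td ad.
  have := Delaunay_dot gT delT _ Td ad.
  rewrite -fset3_rot => /(_ Tt neg).
  suff -> : dot (b - (b + c - a)) (c - (b + c - a)) = dot (b - a) (c - a).
    by rewrite ltNge (ltW neg).
  by rewrite /dot; case: (a) (b) (c) => ? ? [? ?] [? ?] /=; ring.
- have dE : b + c - a + (c - b) *~ k = c + b - a + (b - c) *~ (- k).
    by rewrite mulrNz -mulNrz opprB (addrC b).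
  have Td' : T [fset c; b; (c + b - a + (b - c) *~ (- k))%R]%fset.
    by move: Td; rewrite dE [X in T X]fset3_rot fset3_swap -fset3_rot.
  have := obtuse_chain_step_pos (obtuse_chainC ch) _ Td'.
  rewrite oppr_gt0 => /(_ k0) [ch' lt]; eexists _, _, _; split; first exact: ch'.
  move: lt; set d := c + b - a + _ => lt; apply: le_lt_trans lt.
  by rewrite /dot; case: (b) (c) => ? ? [? ?] /=; rewrite le_eqVlt; apply/orP; left; apply/eqP; ring.
- have [ch' lt] := obtuse_chain_step_pos ch k0 Td.
  by eexists _, _, _; split; first exact: ch'.
Qed.

(** An obtuse triangle starts a chain of obtuse triangles whose longest sides grow strictly. All of
    them meet the segment from a to the opposite corner p of the parallelogram, which meets only
    finitely many triangles. *)
Theorem nonobtuse a b c : T [fset a; b; c]%fset -> 0 <= dot (b - a) (c - a).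
Proof.
move=> Tt; rewrite leNgt; apply/negP => neg.
pose p := a + (b - a) *~ 1 + (c - a) *~ 1.
have ch : obtuse_chain a p a b c.
  split=> //; first by exists 1, 1.
  exists 0; first by rewrite lexx ler01.
  have [ab ac bc] := area_neq (geometric_area gT Tt).
  apply: (@hull3 _ a b c _ 1 0 0) => //; first by rewrite !addr0.
  by rewrite !mul0r !addr0 mul1r.
have [r rE] : exists r : seq {fset R[i]}, [set t | T t /\ exists2 x : R, 0 <= x <= 1 & hull t (a + x%:C * (p - a))] = [set` r].
  by apply/finite_seqP; exact: segment_finite.
pose pts : seq R[i] := flatten [seq enum_fset t | t <- r].
pose P x := exists a' b' c', obtuse_chain a p a' b' c' /\ x = dot (b' - c') (b' - c').
suff [h1 h2] : (forall x, P x -> x \in [seq dot (u - v) (u - v) | u <- pts, v <- pts]) /\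
    (forall x, P x -> exists2 y, P y & x < y).
  by apply: (no_increasing_seq h1 h2); exists a, b, c.
split.
  move=> x [a' [b' [c' [[Tt' _ _ hs] ->]]]].
  have tr : [fset a'; b'; c']%fset \in r.
    have : [set t | T t /\ exists2 x : R, 0 <= x <= 1 & hull t (a + x%:C * (p - a))] [fset a'; b'; c']%fset by [].
    by rewrite rE.
  have mem z : z \in [fset a'; b'; c']%fset -> z \in pts.
    by move=> zt; apply/flattenP; exists (enum_fset [fset a'; b'; c']%fset) => //; exact: map_f.
  by apply: allpairs_f; apply: mem; rewrite !inE eqxx ?orbT.
move=> x [a' [b' [c' [ch' ->]]]].
have [a'' [b'' [c'' [ch'' lt]]]] := obtuse_chain_step ch'.
by exists (dot (b'' - c'') (b'' - c'')) => //; exists a'', b'', c''.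
Qed.

End Nonobtuse.

(** * The developing map *)

Section Developing.
Context {R : realType} (T : set {fset R[i]}) (l : R[i] -> R[i] -> R).
Hypotheses (gT : geometric_triangulation T) (plT : PL_metric T l).
Implicit Types (a b c d p q z : R[i]) (x y : R).

(* The vertices of a developing map are those of an isometric embedding of    *)
(* the glued surface, which is affine on each triangle.                       *)
Definition developing (f : R[i] -> R[i]) : Prop :=
  injective f /\ forall a b c, T [fset a; b; c]%fset ->
   [/\ dot (f a - f b) (f a - f b) = l a b ^+ 2, area (f a) (f b) (f c) != 0 &
    forall x y, 0 <= x -> 0 <= y -> x + y <= 1 ->
     f (a + x%:C * (b - a) + y%:C * (c - a)) = f a + x%:C * (f b - f a) + y%:C * (f c - f a)].

Lemma PL_triangle a b c : T [fset a; b; c]%fset ->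
  [/\ [/\ 0 < l a b, 0 < l a c & 0 < l b c], l b c < l a b + l a c,
      l a c < l a b + l b c & l a b < l a c + l b c].
Proof.
move=> Tt; have [lC l0 lt] := plT; have [ab ac bc] := area_neq (geometric_area gT Tt).
have E u v : u != v -> u \in [fset a; b; c]%fset -> v \in [fset a; b; c]%fset -> edge T u v.
  by move=> uv ut vt; split=> //; exists [fset a; b; c]%fset.
have in3 : [/\ a \in [fset a; b; c]%fset, b \in [fset a; b; c]%fset & c \in [fset a; b; c]%fset].
  by rewrite !inE !eqxx !orbT.
case: in3 => ia ib ic.
have Tt1 := Tt; rewrite fset3_rot in Tt1; have Tt2 := Tt1; rewrite fset3_rot in Tt2.
have := lt _ _ _ Tt; have := lt _ _ _ Tt1; have := lt _ _ _ Tt2.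
rewrite (lC b a) ?(lC c b) ?(lC c a); try by apply: E => //; rewrite eq_sym.
by move=> h1 h2 h3; split; first split; try (by apply: l0; apply: E); lra.
Qed.

Lemma model_dist a b c x y x' y' : T [fset a; b; c]%fset ->
  cdist (model_point l a b c (x, y)) (model_point l a b c (x', y')) ^+ 2 =
  (x - x') ^+ 2 * l a b ^+ 2 +
  (x - x') * (y - y') * (l a b ^+ 2 + l a c ^+ 2 - l b c ^+ 2) +
  (y - y') ^+ 2 * l a c ^+ 2.
Proof.
move=> Tt; have [[ab ac bc] h1 h2 h3] := PL_triangle Tt.
rewrite cdist_sqr /model_point /angle /=.
set k := (X in acos X).
have ki : -1 <= k <= 1 by apply: law_of_cosines_itv; rewrite // addrC.
have kE : 2 * l a b * l a c * k = l a b ^+ 2 + l a c ^+ 2 - l b c ^+ 2.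
  by rewrite /k; field; rewrite !gt_eqF.
rewrite -kE; have := cos2Dsin2 (acos k); rewrite acosK ?in_itv//.
set s := sin _ => e; rewrite /dot /=.
transitivity ((x - x') ^+ 2 * l a b ^+ 2 + (x - x') * (y - y') * (2 * l a b * l a c * k) + (y - y') ^+ 2 * l a c ^+ 2 * (k ^+ 2 + s ^+ 2)).
  by ring.
by rewrite e mulr1.
Qed.

Lemma heron_area (A B C : R[i]) : 4 * area A B C ^+ 2 =
  4 * dot (A - B) (A - B) * dot (A - C) (A - C) -
  (dot (A - B) (A - B) + dot (A - C) (A - C) - dot (B - C) (B - C)) ^+ 2.
Proof. by rewrite /area /cross /dot; case: A B C => ? ? [? ?] [? ?] /=; ring. Qed.

Lemma eq_dot2 (u v z : R[i]) : cross u v != 0 -> dot z u = 0 -> dot z v = 0 -> z = 0.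
Proof.
case: u v z => u1 u2 [v1 v2] [z1 z2]; rewrite /cross /dot /= => ne e1 e2.
apply/eqP; rewrite eq_complex /=; apply/andP; split; apply/eqP; apply: (mulIf ne); rewrite mul0r.
  by transitivity ((z1 * u1 + z2 * u2) * v2 - (z1 * v1 + z2 * v2) * u2); [ring|rewrite e1 e2; ring].
by transitivity ((z1 * v1 + z2 * v2) * u1 - (z1 * u1 + z2 * u2) * v1); [ring|rewrite e1 e2; ring].
Qed.

(** An isometric embedding of a Euclidean triangle is affine: the image of a point is determined by
    its distances to the images of the corners, which are not collinear by Heron's formula. *)
Lemma developing_exists : isometric_to_open_set T l -> exists f, developing f.
Proof.
move=> [f [U [_ [_ finj _] _ fiso]]]; exists f; split.
  by move=> x y; apply: finj; rewrite inE.
move=> a b c Tt; have [[ab ac bc] h1 h2 h3] := PL_triangle Tt.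
have D x y x' y' : simplex (x, y) -> simplex (x', y') ->
    dot (f (plane_point a b c (x, y)) - f (plane_point a b c (x', y')))
      (f (plane_point a b c (x, y)) - f (plane_point a b c (x', y'))) =
    (x - x') ^+ 2 * l a b ^+ 2 +
    (x - x') * (y - y') * (l a b ^+ 2 + l a c ^+ 2 - l b c ^+ 2) +
    (y - y') ^+ 2 * l a c ^+ 2.
  by move=> s s'; rewrite -cdist_sqr fiso// model_dist.
have pp0 : plane_point a b c (0, 0) = a by rewrite /plane_point /= !mul0r !addr0.
have pp1 : plane_point a b c (1, 0) = b by rewrite /plane_point /= mul1r mul0r addr0 addrC subrK.
have pp2 : plane_point a b c (0, 1) = c by rewrite /plane_point /= mul1r mul0r addr0 addrC subrK.
have s0 : simplex ((0, 0) : R * R) by rewrite /simplex /=; split=> //; rewrite addr0 ler01.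
have s1 : simplex ((1, 0) : R * R) by rewrite /simplex /=; split=> //; rewrite addr0.
have s2 : simplex ((0, 1) : R * R) by rewrite /simplex /=; split=> //; rewrite add0r.
have eab : dot (f a - f b) (f a - f b) = l a b ^+ 2.
  by rewrite -[in f a]pp0 -[in f b]pp1 D//; ring.
have eac : dot (f a - f c) (f a - f c) = l a c ^+ 2.
  by rewrite -[in f a]pp0 -[in f c]pp2 D//; ring.
have ebc : dot (f b - f c) (f b - f c) = l b c ^+ 2.
  by rewrite -[in f b]pp1 -[in f c]pp2 D//; ring.
have ne : area (f a) (f b) (f c) != 0.
  apply: contraTneq isT => e; have := heron_area (f a) (f b) (f c).
  rewrite e eab eac ebc => /eqP.
  have -> : 4 * l a b ^+ 2 * l a c ^+ 2 - (l a b ^+ 2 + l a c ^+ 2 - l b c ^+ 2) ^+ 2 =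
    ((l a b + l a c) ^+ 2 - l b c ^+ 2) * (l b c ^+ 2 - (l a b - l a c) ^+ 2) by ring.
  rewrite expr0n mulr0 eq_sym => /eqP k; exfalso.
  have k1 : 0 < (l a b + l a c) ^+ 2 - l b c ^+ 2.
    by rewrite subr_sqr mulr_gt0//; lra.
  have k2 : 0 < l b c ^+ 2 - (l a b - l a c) ^+ 2.
    by rewrite subr_sqr mulr_gt0//; lra.
  by have := mulr_gt0 k1 k2; rewrite k ltxx.
split=> // x y x0 y0 xy.
have sxy : simplex (x, y) by [].
have := D _ _ _ _ sxy s0; have := D _ _ _ _ sxy s1; have := D _ _ _ _ sxy s2.
rewrite pp0 pp1 pp2 /plane_point /=; set z := f _ => d2 d1 d0.
apply/eqP; rewrite -subr_eq0; apply/eqP; apply: (eq_dot2 ne).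
  have : 2 * dot (z - (f a + x%:C * (f b - f a) + y%:C * (f c - f a))) (f b - f a) =
    dot (z - f a) (z - f a) - dot (z - f b) (z - f b) + dot (f a - f b) (f a - f b)
    - 2 * x * dot (f a - f b) (f a - f b)
    - y * (dot (f a - f b) (f a - f b) + dot (f a - f c) (f a - f c) - dot (f b - f c) (f b - f c)).
    by rewrite /dot; case: (z) (f a) (f b) (f c) => ? ? [? ?] [? ?] [? ?] /=; ring.
  rewrite d0 d1 eab eac ebc => e; apply/eqP.
  rewrite -(mulrI_eq0 _ (mulfI (_ : 2 != 0 :> R))) ?pnatr_eq0// e; apply/eqP; ring.
have : 2 * dot (z - (f a + x%:C * (f b - f a) + y%:C * (f c - f a))) (f c - f a) =
  dot (z - f a) (z - f a) - dot (z - f c) (z - f c) + dot (f a - f c) (f a - f c)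
  - 2 * y * dot (f a - f c) (f a - f c)
  - x * (dot (f a - f b) (f a - f b) + dot (f a - f c) (f a - f c) - dot (f b - f c) (f b - f c)).
  by rewrite /dot; case: (z) (f a) (f b) (f c) => ? ? [? ?] [? ?] [? ?] /=; ring.
rewrite d0 d2 eab eac ebc => e; apply/eqP.
rewrite -(mulrI_eq0 _ (mulfI (_ : 2 != 0 :> R))) ?pnatr_eq0// e; apply/eqP; ring.
Qed.

Variable f : R[i] -> R[i].
Hypothesis fdev : developing f.

Lemma developing_comb a b c (x y z : R) : T [fset a; b; c]%fset -> 0 <= x -> 0 <= y ->
  0 <= z -> x + y + z = 1 ->
  f (x%:C * a + y%:C * b + z%:C * c) = x%:C * f a + y%:C * f b + z%:C * f c.
Proof.
move=> Tt x0 y0 z0 e; have [_ /(_ _ _ _ Tt) [_ _ h]] := fdev.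
have := h y z y0 z0; rewrite -e -addrA lerDr => /(_ x0).
have xE : x = 1 - y - z by lra.
have E a' b' c' : a' + y%:C * (b' - a') + z%:C * (c' - a') = x%:C * a' + y%:C * b' + z%:C * c'.
  rewrite xE; case: (a') (b') (c') => ? ? [? ?] [? ?].
  by apply/eqP; rewrite eq_complex /=; apply/andP; split; apply/eqP; ring.
by rewrite !E.
Qed.

(** Otherwise both images lie on the same side of the common edge and share a point close to its
    midpoint, against injectivity. *)
Lemma developing_coherent a b c d : T [fset a; b; c]%fset -> T [fset b; c; d]%fset ->
  area b c d * area a b c < 0 ->
  area (f b) (f c) (f d) * area (f a) (f b) (f c) < 0.
Proof.
move=> Ta Td neg; have [finj fT] := fdev.
have [_ nea _] := fT _ _ _ Ta; have [_ ned _] := fT _ _ _ Td.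
have nz : area (f b) (f c) (f d) * area (f a) (f b) (f c) != 0 by rewrite mulf_neq0.
rewrite lt_neqAle nz leNgt /=; apply/negP => pos.
pose rho := area (f b) (f c) (f a) / area (f b) (f c) (f d).
have rho0 : 0 < rho.
  rewrite /rho (areaC (f b)) (areaC (f c)) ; move: pos; rewrite mulrC => pos.
  rewrite -(pmulr_lgt0 _ (_ : 0 < area (f b) (f c) (f d) ^+ 2)); last first.
    by rewrite lt_neqAle eq_sym sqrf_eq0 ned sqr_ge0.
  by rewrite expr2 mulrA mulfVK.
pose be := area (f a) (f c) (f d) / area (f b) (f c) (f d).
pose ga := area (f b) (f a) (f d) / area (f b) (f c) (f d).
have faE : f a = be%:C * f b + ga%:C * f c + rho%:C * f d by exact: area_bary.
have e1 : be + ga + rho = 1 by rewrite /be /ga /rho -!mulrDl area_sum divff.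
(* Small enough for the coordinates in [p1] and [p2], close to 1/2, to be nonnegative. *)
pose e := (2 * (1 + `|be| + `|ga|))^-1.
have n1 : 0 <= `|be| by []. have n2 : 0 <= `|ga| by [].
have D0 : 0 < 2 * (1 + `|be| + `|ga|) by rewrite mulr_gt0// -addrA ltr_wpDr// addr_ge0.
have e0 : 0 < e by rewrite invr_gt0.
have ele : 2 * (e + e * `|be| + e * `|ga|) = 1.
  by rewrite /e; field; rewrite gt_eqF// -addrA ltr_wpDr// addr_ge0.
have m1 : 0 <= e * `|be| by rewrite mulr_ge0// ltW.
have m2 : 0 <= e * `|ga| by rewrite mulr_ge0// ltW.
have p1 : 0 <= (1 - e) / 2 + e * be.
  have := ler_norm (- be); rewrite normrN => k.
  have : e * (- be) <= e * `|be| by rewrite ler_pM2l.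
  by clear -e0 ele m1 m2; lra.
have p2 : 0 <= (1 - e) / 2 + e * ga.
  have := ler_norm (- ga); rewrite normrN => k.
  have : e * (- ga) <= e * `|ga| by rewrite ler_pM2l.
  by clear -e0 ele m1 m2; lra.
have p3 : 0 <= (1 - e) / 2 by clear -e0 ele m1 m2; lra.
have p4 : 0 <= e * rho by rewrite mulr_ge0// ltW.
have q1 : e + (1 - e) / 2 + (1 - e) / 2 = 1 by field.
have q2 : (1 - e) / 2 + e * be + ((1 - e) / 2 + e * ga) + e * rho = 1.
  by transitivity (1 - e + e * (be + ga + rho)); [field|rewrite e1; ring].
have c1 := developing_comb Ta (ltW e0) p3 p3 q1.
have c2 := developing_comb Td p1 p2 p4 q2.
have : f (e%:C * a + ((1 - e) / 2)%:C * b + ((1 - e) / 2)%:C * c) =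
    f (((1 - e) / 2 + e * be)%:C * b + ((1 - e) / 2 + e * ga)%:C * c + (e * rho)%:C * d).
  rewrite c1 c2 faE !rmorphD !rmorphM /=; ring.
move=> /finj E.
have k1 : area b c (e%:C * a + ((1 - e) / 2)%:C * b + ((1 - e) / 2)%:C * c) = e * area a b c.
  have [] := bary_coord (a := a) (b := b) (c := c) q1 erefl.
  by move=> + _ _; rewrite areaC.
have k2 : area b c (e%:C * a + ((1 - e) / 2)%:C * b + ((1 - e) / 2)%:C * c) = e * rho * area b c d.
  by rewrite E; have [_ _ ->] := bary_coord (a := b) (b := c) (c := d) q2 erefl.
have : area a b c = rho * area b c d.
  by apply: (mulfI (lt0r_neq0 e0)); rewrite mulrA -k1 -k2.
move=> k; move: neg; rewrite k mulrCA ltNge => /negP; apply.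
by rewrite mulr_ge0 ?(ltW rho0)// -expr2 sqr_ge0.
Qed.

End Developing.

(** * Cells of the lattice *)

Section Cells.
Context {R : realType} (T : set {fset R[i]}) (l : R[i] -> R[i] -> R) (f : R[i] -> R[i]).
Hypotheses (gT : geometric_triangulation T) (latT : lattice (vertices T))
  (delT : Delaunay T cdist) (fdev : developing T l f).
Variables (o u v : R[i]).
Local Notation V := (int * int)%type.
Implicit Types (e g x y z d : V) (k : int).

Definition smul k x : V := (k * x.1, k * x.2).
Definition vec x : R[i] := u *~ x.1 + v *~ x.2.
Definition pos x : R[i] := o + vec x.
Definition bil x y : R := dot (vec x) (vec y).

Lemma vecE x : vec x = (x.1%:~R : R)%:C * u + (x.2%:~R : R)%:C * v.
Proof. by rewrite /vec !intCE. Qed.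

Lemma bilE x y : bil x y = x.1%:~R * y.1%:~R * dot u u +
  (x.1%:~R * y.2%:~R + x.2%:~R * y.1%:~R) * dot u v + x.2%:~R * y.2%:~R * dot v v.
Proof.
by rewrite /bil !vecE /dot; case: (u) (v) => ? ? [? ?] /=; ring.
Qed.

Lemma bilC x y : bil x y = bil y x. Proof. exact: dotC. Qed.

Lemma bilD x y z : bil x (y + z) = bil x y + bil x z.
Proof. by rewrite !bilE /= !rmorphD /=; ring. Qed.

Lemma bilZ k x y : bil x (smul k y) = k%:~R * bil x y.
Proof. by rewrite !bilE /= !rmorphM /=; ring. Qed.

Lemma bilN x y : bil x (- y) = - bil x y.
Proof. by rewrite !bilE /= !rmorphN /=; ring. Qed.

Lemma bilNN x y : bil (- x) (- y) = bil x y.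
Proof. by rewrite bilN bilC bilN opprK bilC. Qed.

Lemma pos_sub x y : pos x - pos y = vec (x - y).
Proof. by rewrite /pos !vecE /=; ring. Qed.

(* Triangles on which the developing map respects the orientations. *)
Definition tri x y z : Prop := T [fset pos x; pos y; pos z]%fset /\
  0 < area (pos x) (pos y) (pos z) * area (f (pos x)) (f (pos y)) (f (pos z)).

Lemma tri_rot x y z : tri x y z -> tri y z x.
Proof. by move=> [h1 h2]; split; [rewrite -fset3_rot|rewrite -(areaC (pos x)) -(areaC (f (pos x)))]. Qed.

Lemma tri_swap x y z : tri x y z -> tri x z y.
Proof. by move=> [h1 h2]; split; [rewrite fset3_swap|rewrite (areaN (pos x)) (areaN (f (pos x))) mulrNN]. Qed.

Lemma tri_neighbor x y z : tri x y z -> exists k,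
  [/\ tri y z (y + z - x + smul k (z - y)),
      - bil (z - y) (z - x) <= k%:~R * bil (z - y) (z - y) &
      k%:~R * bil (z - y) (z - y) <= bil (z - y) (z - y) - bil (z - y) (z - x)].
Proof.
move=> [Tt pos1]; have [k Td ad] := neighbor_lattice gT latT Tt.
set d := y + z - x + smul k (z - y).
have dE : pos y + pos z - pos x + (pos z - pos y) *~ k = pos d.
  by rewrite /d intCE /pos !vecE /smul /=; ring.
rewrite dE in Td ad; exists k.
have e1 : area (pos y) (pos z) (pos d) = - area (pos x) (pos y) (pos z).
  by rewrite -dE intCE /area /cross; case: (pos x) (pos y) (pos z) => ? ? [? ?] [? ?] /=; ring.
have ne := geometric_area gT Tt.
have sq : 0 < area (pos x) (pos y) (pos z) ^+ 2 by rewrite lt_neqAle eq_sym sqrf_eq0 ne sqr_ge0.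
have neg : area (pos y) (pos z) (pos d) * area (pos x) (pos y) (pos z) < 0.
  by rewrite e1 mulNr oppr_lt0 -expr2.
have neg2 := developing_coherent fdev Tt Td neg.
split.
- split=> //; rewrite -/d e1.
  move: sq pos1 neg2; set A := area _ _ _; set B := area _ _ _; set C := area _ _ _.
  move=> *; rewrite mulNr oppr_gt0.
  have [A0|A0|A0] := ltgtP A 0.
  + have B0 : B < 0 by rewrite -(nmulr_rgt0 _ A0).
    have C0 : 0 < C by rewrite -(nmulr_llt0 _ B0).
    by rewrite nmulr_rlt0.
  + have B0 : 0 < B by rewrite -(pmulr_rgt0 _ A0).
    have C0 : C < 0 by rewrite -(pmulr_llt0 _ B0).
    by rewrite pmulr_rlt0.
  + by move: ne; rewrite -/A A0 eqxx.
- have := nonobtuse gT latT delT Td; rewrite !pos_sub -/(bil _ _).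
  have -> : d - y = (z - x) + smul k (z - y).
    by rewrite /d; case: (x) (y) (z) => ? ? [? ?] [? ?]; congr (_, _) => /=; ring.
  by rewrite bilD bilZ; lra.
- have Td' : T [fset pos z; pos y; pos d]%fset.
    by rewrite fset3_swap -fset3_rot.
  have := nonobtuse gT latT delT Td'; rewrite !pos_sub -/(bil _ _).
  have -> : d - z = - (z - y) + (z - x) + smul k (z - y).
    by rewrite /d; case: (x) (y) (z) => ? ? [? ?] [? ?]; congr (_, _) => /=; ring.
  have -> : y - z = - (z - y) by rewrite opprB.
  set p := z - y; set q := z - x.
  have -> : bil (- p) (- p + q + smul k p) = bil p p - bil p q - k%:~R * bil p p.
    by rewrite !bilE /=; ring.
  by lra.
Qed.

(** The triangle spanned by e and g has no obtuse angle at the corner between them, and acute angles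
    at the two others. *)
Definition frame e g : Prop := [/\ 0 <= bil e g, bil e g < bil e e & bil e g < bil g g].

(* The two ways to cut a parallelogram; both occur only for rectangles. *)
Definition cell z e g : Prop :=
  (tri z (z + e) (z + g) /\ tri (z + e + g) (z + e) (z + g)) \/
  [/\ bil e g = 0, tri z (z + e) (z + e + g) & tri z (z + g) (z + e + g)].

Lemma frameC e g : frame e g -> frame g e.
Proof. by rewrite /frame bilC => -[]. Qed.

Lemma frameN e g : frame e g -> frame (- e) (- g).
Proof. by rewrite /frame !bilNN. Qed.

Lemma cellC z e g : cell z e g -> cell z g e.
Proof.
move=> [[h1 h2]|[h0 h1 h2]]; [left|right].
  by split; [exact: tri_swap|rewrite addrAC; exact: tri_swap].
by split; rewrite 1?bilC// addrAC.
Qed.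

Lemma cellN z e g : cell z e g -> cell (z + e + g) (- e) (- g).
Proof.
have e1 : z + e + g - e = z + g by rewrite addrAC addrK.
have e2 : z + e + g - g = z + e by rewrite addrK.
have e3 : z + e + g - e - g = z by rewrite e1 addrK.
rewrite /cell e1 e2 addrK => -[[h1 h2]|[h0 h1 h2]]; [left|right].
  by split; apply: tri_swap.
split; first by rewrite bilNN.
  by apply: tri_rot; apply: tri_rot; apply: tri_swap; apply: tri_rot.
by apply: tri_rot; apply: tri_rot; apply: tri_swap; apply: tri_rot.
Qed.

Lemma int_eq0 k (p n : R) : 0 < p < n -> - p <= k%:~R * n -> k%:~R * n <= n - p -> k = 0.
Proof.
move=> /andP[p0 pn] h1 h2.
have [k1|[->//|k1]] : k <= -1 \/ k = 0 \/ 1 <= k by lia.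
  by exfalso; have : (k%:~R : R) <= (-1)%:~R by [rewrite ler_int]; rewrite rmorphN /=; nra.
by exfalso; have : (1 : R) <= k%:~R by [rewrite ler1z]; nra.
Qed.

Lemma complete_cell z e g : frame e g -> tri z (z + e) (z + g) -> cell z e g.
Proof.
move=> [h0 h1 h2] t; left; split=> //.
have [k [+ k1 k2]] := tri_neighbor t.
have e1 : z + g - (z + e) = g - e.
  by case: (z) (e) (g) => ? ? [? ?] [? ?]; congr (_, _) => /=; ring.
have e2 : z + g - z = g by rewrite addrC addKr.
have kk : k = 0.
  apply: int_eq0 k1 k2; rewrite e1 e2 bilD bilN !(bilC (g - e)) !bilD !bilN (bilC g e).
  by apply/andP; split; lra.
have -> : z + e + (z + g) - z + smul k (z + g - (z + e)) = z + e + g.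
  by rewrite kk; case: (z) (e) (g) => ? ? [? ?] [? ?]; congr (_, _) => /=; ring.
by move/tri_rot/tri_rot.
Qed.

Lemma tri_perm x y z : tri x y z -> tri y x z.
Proof. by move=> t; apply: tri_rot; apply: tri_rot; exact: tri_swap. Qed.

Lemma complete_cell' z e g : frame e g -> bil e g = 0 -> tri z (z + e) (z + e + g) -> cell z e g.
Proof.
move=> [_ h1 h2] h0 t; rewrite h0 in h1 h2; right; split=> //.
have [k [+ k1 k2]] := tri_neighbor (tri_perm t).
have e1 : z + e + g - z = e + g.
  by case: (z) (e) (g) => ? ? [? ?] [? ?]; congr (_, _) => /=; ring.
have e2 : z + e + g - (z + e) = g by rewrite addrC addKr.
have kk : k = 0.
  apply: int_eq0 k1 k2; rewrite e1 e2 bilD !(bilC (e + g)) !bilD (bilC g e) h0.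
  by apply/andP; split; lra.
have -> : z + (z + e + g) - (z + e) + smul k (z + e + g - z) = z + g.
  by rewrite kk; case: (z) (e) (g) => ? ? [? ?] [? ?]; congr (_, _) => /=; ring.
by move/tri_swap.
Qed.

(** Across the common edge in direction g, the interval for k contains 0, and a second integer only
    if e and g are orthogonal. Either value gives one half of the next cell, cut in one way or the
    other, and the other half follows. *)
Lemma cell_step z e g : frame e g -> cell z e g -> cell (z + e) e g.
Proof.
move=> fr; have [h0 h1 h2] := fr => -[[t t']|[hz t t']].
  have [k [+ k1 k2]] := tri_neighbor (tri_rot (tri_rot (tri_perm t'))).
  have e1 : z + e + g - (z + e) = g by rewrite addrC addKr.
  have e2 : z + e + g - (z + g) = e.
    by case: (z) (e) (g) => ? ? [? ?] [? ?]; congr (_, _) => /=; ring.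
  rewrite e1 e2 bilC in k1; rewrite e1 e2 (bilC _ e) in k2.
  have -> : z + e + (z + e + g) - (z + g) + smul k (z + e + g - (z + e)) = z + e + e + smul k g.
    by case: (z) (e) (g) => ? ? [? ?] [? ?]; congr (_, _) => /=; ring.
  have [k0|[k0|[k0|k0]]] : k <= -1 \/ k = 0 \/ k = 1 \/ 2 <= k by lia.
  - have : (k%:~R : R) <= (-1)%:~R by rewrite ler_int.
    by rewrite rmorphN /= => k3; exfalso; nra.
  - rewrite k0 => T'; apply: complete_cell => //; apply: tri_swap.
    by apply: tri_swap; move: (tri_swap T'); rewrite /smul !mul0r addr0.
  - rewrite k0 => T'; rewrite k0 in k2; have hz : bil e g = 0 by lra.
    apply: cellC; apply: complete_cell'; [exact: frameC|by rewrite bilC|].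
    have -> : z + e + g + e = z + e + e + smul 1 g.
      by case: (z) (e) (g) => ? ? [? ?] [? ?]; congr (_, _) => /=; ring.
    exact: T'.
  - have : (2%:~R : R) <= k%:~R by rewrite ler_int.
    by move=> k3; exfalso; nra.
have [k [+ k1 k2]] := tri_neighbor t.
have e1 : z + e + g - (z + e) = g by rewrite addrC addKr.
have e2 : z + e + g - z = e + g.
  by case: (z) (e) (g) => ? ? [? ?] [? ?]; congr (_, _) => /=; ring.
rewrite e1 e2 bilD (bilC g e) hz in k1; rewrite e1 e2 bilD (bilC g e) hz in k2.
rewrite hz in h1 h2.
have -> : z + e + (z + e + g) - z + smul k (z + e + g - (z + e)) = z + e + e + g + smul k g.
  by case: (z) (e) (g) => ? ? [? ?] [? ?]; congr (_, _) => /=; ring.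
have [k0|[k0|[k0|k0]]] : k <= -2 \/ k = -1 \/ k = 0 \/ 1 <= k by lia.
- have : (k%:~R : R) <= (-2)%:~R by rewrite ler_int.
  by rewrite rmorphN /= => k3; exfalso; nra.
- rewrite k0 => T'; apply: complete_cell => //; apply: tri_swap.
  have -> : z + e + e = z + e + e + g + smul (-1) g.
    by case: (z) (e) (g) => ? ? [? ?] [? ?]; congr (_, _) => /=; ring.
  exact: T'.
- rewrite k0 => T'; apply: cellC; apply: complete_cell'; [exact: frameC|by rewrite bilC|].
  have -> : z + e + g + e = z + e + e + g + smul 0 g.
    by case: (z) (e) (g) => ? ? [? ?] [? ?]; congr (_, _) => /=; ring.
  exact: T'.
- have : (1 : R) <= k%:~R by rewrite ler1z.
  by move=> k3; exfalso; nra.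
Qed.

Lemma cell_step_back z e g : frame e g -> cell z e g -> cell (z - e) e g.
Proof.
move=> fr /cellN c; have := cellN (cell_step (frameN fr) c).
rewrite (opprK e) (opprK g).
have -> // : z + e + g - e - e - g = z - e.
by case: (z) (e) (g) => ? ? [? ?] [? ?]; congr (_, _) => /=; ring.
Qed.

Theorem lattice_cells : frame (1, 0) (0, 1) -> tri 0 (1, 0) (0, 1) ->
  forall z, cell z (1, 0) (0, 1).
Proof.
move=> fr t0; apply: int_ind2; first by apply: complete_cell; rewrite // !add0r.
move=> z c; split.
- exact: cell_step.
- exact: cell_step_back.
- by apply: cellC; apply: cell_step; [exact: frameC|exact: cellC].
- by apply: cellC; apply: cell_step_back; [exact: frameC|exact: cellC].
Qed.

End Cells.

(** * Vertex stars *)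

Section AngleSum.
Context {R : realType}.
Implicit Types (a b c : R[i]).

Definition arg2 a b : R := acos (dot a b / Num.sqrt (dot a a * dot b b)).

Lemma dot_cross a b : dot a b ^+ 2 + cross a b ^+ 2 = dot a a * dot b b.
Proof. by rewrite /dot /cross; case: a b => ? ? [? ?] /=; ring. Qed.

Lemma arg2P a b : 0 < cross a b ->
  [/\ 0 < arg2 a b, arg2 a b < pi,
      dot a b = Num.sqrt (dot a a) * Num.sqrt (dot b b) * cos (arg2 a b) &
      cross a b = Num.sqrt (dot a a) * Num.sqrt (dot b b) * sin (arg2 a b)].
Proof.
move=> ab.
have a0 : 0 < dot a a.
  by apply: dot_gt0; apply: contraTneq ab => ->; rewrite /cross /= !mul0r subrr ltxx.
have b0 : 0 < dot b b.
  by apply: dot_gt0; apply: contraTneq ab => ->; rewrite /cross /= !mulr0 subrr ltxx.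
set k := dot a b / Num.sqrt (dot a a * dot b b).
have r0 : 0 < Num.sqrt (dot a a * dot b b) by rewrite sqrtr_gt0 mulr_gt0.
have rr : Num.sqrt (dot a a * dot b b) ^+ 2 = dot a a * dot b b.
  by rewrite sqr_sqrtr// mulr_ge0// ltW.
have kk : 1 - k ^+ 2 = (cross a b / Num.sqrt (dot a a * dot b b)) ^+ 2.
  rewrite /k !exprMn !exprVn rr -{1}(@divff _ (dot a a * dot b b)) ?mulf_neq0 ?gt_eqF//.
  by rewrite -dot_cross; ring.
have c0 : 0 < cross a b / Num.sqrt (dot a a * dot b b) by rewrite divr_gt0.
have k1 : -1 < k < 1.
  by have : 0 < 1 - k ^+ 2 by [rewrite kk exprn_gt0]; move=> h; apply/andP; split; nra.
have [k2 k3] := andP k1.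
have ki : -1 <= k <= 1 by rewrite !ltW.
rewrite /arg2 -/k acos_gt0 ?acos_ltpi ?(ltW k2) ?(ltW k3) ?k2 ?k3//; split=> //.
  by rewrite acosK ?in_itv// -sqrtrM ?ltW// /k mulrCA divff ?mulr1// gt_eqF.
by rewrite sin_acos// kk sqrtr_sqr gtr0_norm// -sqrtrM ?ltW// mulrCA divff ?mulr1// gt_eqF.
Qed.

Lemma cos_lt1 (x : R) : 0 < x -> x < 2 * pi -> cos x < 1.
Proof.
move=> x0 x2; rewrite -cos0.
have [xp|xp] := leP x pi.
  by rewrite ltr_cos// in_itv/= ?lexx ?pi_ge0// (ltW x0).
have -> : cos x = cos (2 * pi - x).
  by rewrite mulr_natl cosB cos2pi sin2pi mul1r mul0r addr0.
by rewrite ltr_cos ?subr_gt0// in_itv/= ?lexx ?pi_ge0//; apply/andP; split; lra.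
Qed.

(** The cosines and sines of the partial sums are, up to positive factors, the dot and cross
    products with [D 0], so the total is a positive multiple of 2 pi. If a partial sum reached 2 pi
    before the end, the first one that does would violate the last hypothesis. *)
Lemma angle_sum_2pi n (D : nat -> R[i]) : (0 < n)%N -> D n = D 0%N ->
  (forall k, (k < n)%N -> 0 < cross (D k) (D k.+1)) ->
  (forall j, (0 < j < n)%N -> 0 <= cross (D 0%N) (D j) ->
     cross (D j.-1) (D 0%N) <= 0) ->
  \sum_(k < n) arg2 (D k) (D k.+1) = 2 * pi.
Proof.
move=> n0 Dn Dpos noret.
pose phi k := \sum_(i < k) arg2 (D i) (D i.+1).
have phiS k : phi k.+1 = phi k + arg2 (D k) (D k.+1) by rewrite /phi big_ord_recr.
pose r k := Num.sqrt (dot (D k) (D k)).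
have Dp k : (k < n)%N -> 0 < dot (D k) (D k).
  move=> /Dpos h; apply: dot_gt0; apply: contraTneq h => ->.
  by rewrite /cross /= !mul0r subrr ltxx.
have E k : (k <= n)%N -> dot (D 0%N) (D k) = r 0%N * r k * cos (phi k) /\
    cross (D 0%N) (D k) = r 0%N * r k * sin (phi k).
  elim: k => [_|k IH kn].
    rewrite /phi big_ord0 cos0 sin0 mulr1 mulr0 -expr2 sqr_sqrtr ?dot_ge0//; split=> //.
    by rewrite /cross; ring.
  have [e1 e2] := IH (ltnW kn).
  have [_ _ e3 e4] := arg2P (Dpos k kn).
  rewrite -/(r k) -/(r k.+1) in e3 e4; have d0 := Dp k kn; have rk : r k ^+ 2 = dot (D k) (D k) by rewrite sqr_sqrtr ?dot_ge0.
  rewrite phiS cosD sinD; split; apply: (mulfI (lt0r_neq0 d0)).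
    transitivity (dot (D 0%N) (D k) * dot (D k) (D k.+1) - cross (D 0%N) (D k) * cross (D k) (D k.+1)).
      by rewrite /dot /cross; case: (D 0%N) (D k) (D k.+1) => ? ? [? ?] [? ?] /=; ring.
    by rewrite e1 e2 e3 e4 -rk; ring.
  transitivity (cross (D 0%N) (D k) * dot (D k) (D k.+1) + dot (D 0%N) (D k) * cross (D k) (D k.+1)).
    by rewrite /dot /cross; case: (D 0%N) (D k) (D k.+1) => ? ? [? ?] [? ?] /=; ring.
  by rewrite e1 e2 e3 e4 -rk; ring.
have rp k : (k < n)%N -> 0 < r k by move=> /Dp h; rewrite sqrtr_gt0.
have th k : (k < n)%N -> 0 < arg2 (D k) (D k.+1) < pi.
  by move=> /Dpos /arg2P [-> -> _ _].
have phi_gt0 k : (0 < k <= n)%N -> 0 < phi k.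
  case: k => // k /= kn; rewrite /phi big_ord_recr /=.
  have [h _] := andP (th k kn); rewrite ltr_wpDl// sumr_ge0// => i _.
  have [h' _] := andP (th i (ltn_trans (ltn_ord i) kn)); exact: ltW.
have cn : cos (phi n) = 1.
  have [e _] := E n (leqnn n); move: e; rewrite /r Dn -/(r 0%N) => e.
  have r0 := rp _ n0; apply: (mulfI (lt0r_neq0 (mulr_gt0 r0 r0))).
  by rewrite -e mulr1 -expr2 sqr_sqrtr ?dot_ge0.
have gn : 2 * pi <= phi n.
  rewrite leNgt; apply/negP => h; have := cos_lt1 (phi_gt0 n _) h.
  by rewrite cn ltxx n0 leqnn => /(_ isT).
have [j gj minj] := @ex_minnP (fun k => 2 * pi <= phi k) (ex_intro _ n gn).
have jn : (j <= n)%N by apply: minj.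
have pi0 := pi_gt0 R.
have j0 : (0 < j)%N.
  rewrite lt0n; apply: contraTneq gj => ->; rewrite /phi big_ord0 -ltNge; lra.
have lj : phi j.-1 < 2 * pi.
  rewrite ltNge; apply/negP => /minj; rewrite leqNgt ltn_predL j0 //.
have jn' : (j.-1 < n)%N by rewrite prednK.
have [t0 t1] := andP (th _ jn'); rewrite prednK// in t0 t1.
have := phiS j.-1; rewrite prednK// => pj.
have -> : \sum_(k < n) arg2 (D k) (D k.+1) = phi n by [].
have [ejn|ltj] := eqVneq j n.
  rewrite -ejn; have : 0 <= phi j - 2 * pi < pi by apply/andP; split; lra.
  move=> /andP[h1 h2]; have : cos (phi j - 2 * pi) = cos 0.
    by rewrite mulr_natl cosB cos2pi sin2pi mulr1 mulr0 addr0 cos0 ejn.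
  move/cos_inj; rewrite !in_itv /= h1 (ltW h2) lexx pi_ge0 => /(_ isT isT); lra.
have {ltj} ltj : (j < n)%N by rewrite ltn_neqAle ltj.
have [_ e1] := E j jn; have [_ e2] := E j.-1 (ltnW jn').
have s1 : 0 <= cross (D 0%N) (D j).
  rewrite e1; apply: mulr_ge0; first by rewrite mulr_ge0// ltW// rp.
  have -> : sin (phi j) = sin (phi j - 2 * pi).
    by rewrite mulr_natl sinB cos2pi sin2pi mulr1 mulr0 subr0.
  by apply: sin_ge0_pi; apply/andP; split; lra.
have := noret j _ s1; rewrite j0 ltj => /(_ isT).
rewrite crossNC e2 oppr_le0 leNgt => /negP; case.
rewrite pmulr_rlt0; last by rewrite mulr_gt0// rp.
have -> : sin (phi j.-1) = - sin (2 * pi - phi j.-1).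
  by rewrite mulr_natl sinB cos2pi sin2pi mul0r mul1r sub0r opprK.
by rewrite oppr_lt0; apply: sin_gt0_pi; apply/andP; split; lra.
Qed.

Lemma arc_arg2 a b (c : R) : 0 < cross a b -> dot (a - b) (a - b) = c ^+ 2 ->
  0 <= heron (dot a a) (dot b b) c /\ arc (dot a a) (dot b b) c = arg2 a b.
Proof.
move=> ab cE.
have h : heron (dot a a) (dot b b) c = 4 * cross a b ^+ 2.
  by rewrite /heron -cE /dot /cross; case: a b {ab cE} => ? ? [? ?] /=; ring.
have h0 : 0 <= heron (dot a a) (dot b b) c by rewrite h mulr_ge0// sqr_ge0.
split=> //; rewrite arcE//; last 2 first.
- by apply: dot_gt0; apply: contraTneq ab => ->; rewrite /cross /= !mul0r subrr ltxx.
- by apply: dot_gt0; apply: contraTneq ab => ->; rewrite /cross /= !mulr0 subrr ltxx.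
rewrite /cosl /arg2; congr (acos _).
have -> : dot a a + dot b b - c ^+ 2 = 2 * dot a b.
  by rewrite -cE /dot; case: (a) (b) => ? ? [? ?] /=; ring.
by rewrite -mulf_div divff ?mul1r// pnatr_eq0.
Qed.

End AngleSum.

(** * The octagon of a vertex: rigidity, bounds and limits *)

Section Star.
Context {R : realType} (a b C : R).
Hypotheses (a0 : 0 < a) (b0 : 0 < b) (C0 : 0 < C).
Local Notation V := (int * int)%type.
Local Notation corner := ('I_4 * bool)%type.
Implicit Types (q : 'I_4) (i : corner) (y : V -> R).

Definition axis q : V := nth (0, -1) [:: (1, 0); (0, 1); (-1, 0)] q.
Definition axis_sqr q : R := if odd q then b else a.
(** The squared length of the diagonal [axis q + axis (q + 1)] when it is an edge; when the other
    diagonal is an edge, the squared length of the latter is (a + b)^2 / kappa. For a rectangle C =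
    a + b, and the two descriptions agree. *)
Definition kappa q : R := if odd q then C else (a + b) ^+ 2 / C.
Definition next_corner i : corner := if i.2 then (i.1 + 1, false) else (i.1, true).
Definition prev_corner i : corner := if i.2 then (i.1, false) else (i.1 - 1, true).

Definition side i : R :=
  if i.2 then Num.sqrt (axis_sqr i.1 / (axis_sqr (i.1 + 1) * kappa i.1))
  else Num.sqrt (axis_sqr (i.1 + 1) / (axis_sqr i.1 * kappa i.1)).

(* The octagon obtained by inverting the neighbours of a vertex in the circle *)
(* around it, for the discrete conformal factor w with y = exp (-2 w) and     *)
(* y 0 = 1: its side lengths do not depend on w. A corner (q, false) comes    *)
(* from the neighbour axis q, a corner (q, true) from the diagonal neighbour  *)
(* axis q + axis (q + 1). When the cell is cut by the other diagonal, the     *)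
(* second argument of the maximum is attained and the corner is flat.         *)
Definition star_sqr y i : R :=
  if i.2 then Num.max (y (axis i.1 + axis (i.1 + 1)))
    (kappa i.1 / (a + b) * (y (axis i.1) + y (axis (i.1 + 1))) - 1) / kappa i.1
  else y (axis i.1) / axis_sqr i.1.

Definition star_ok y : Prop :=
  convex_star next_corner prev_corner side (star_sqr y) /\
  angle_sum next_corner side (star_sqr y) = 2 * pi.

Lemma oddS4 q : odd (q + 1)%R = ~~ odd q.
Proof. by case: q => [[|[|[|[|]]]]]. Qed.

Lemma next_cornerK : cancel next_corner prev_corner.
Proof. by case=> q [] /=; rewrite /next_corner /prev_corner //= addrK. Qed.

Lemma prev_cornerK : cancel prev_corner next_corner.
Proof. by case=> q [] /=; rewrite /next_corner /prev_corner //= subrK. Qed.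

Lemma ab0 : 0 < a + b. Proof. by rewrite addr_gt0. Qed.

Lemma axis_sqr_gt0 q : 0 < axis_sqr q.
Proof. by rewrite /axis_sqr; case: ifP. Qed.

Lemma axis_sqrS q : axis_sqr q + axis_sqr (q + 1) = a + b.
Proof. by rewrite /axis_sqr oddS4; case: ifP => //= _; rewrite addrC. Qed.

Lemma kappa_gt0 q : 0 < kappa q.
Proof. by rewrite /kappa; case: ifP => // _; rewrite divr_gt0// exprn_gt0// ab0. Qed.

Lemma side_gt0 i : 0 < side i.
Proof.
by rewrite /side; case: ifP => _;
  rewrite sqrtr_gt0 divr_gt0 ?mulr_gt0 ?axis_sqr_gt0 ?kappa_gt0.
Qed.

Lemma star_sqr_le y y' : (forall x, y x <= y' x) -> forall i, star_sqr y i <= star_sqr y' i.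
Proof.
move=> le [q []]; rewrite /star_sqr /=; rewrite ler_pM2r ?invr_gt0 ?kappa_gt0 ?axis_sqr_gt0//.
rewrite ge_max !le_max le /= orbC lerB ?orbT// ?ler_pM2l ?divr_gt0 ?kappa_gt0 ?ab0//.
by rewrite lerD.
Qed.

Lemma star_sqr_gt0 y : (forall x, 0 < y x) -> forall i, 0 < star_sqr y i.
Proof.
move=> y0 [q []]; rewrite /star_sqr /= divr_gt0 ?kappa_gt0 ?axis_sqr_gt0//.
by rewrite lt_max y0.
Qed.

(** The maximum principle: comparing the factors at all neighbours compares two octagons with the
    same sides and the same angle sum. *)
Lemma star_ok_rigid y y' : star_ok y -> star_ok y' -> (forall x, y x <= y' x) ->
  forall q, y (axis q) = y' (axis q).
Proof.
move=> [c s] [c' s'] le q.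
have e := star_rigidity next_cornerK prev_cornerK side_gt0 c c' (star_sqr_le le) (etrans s (esym s')).
have := e (q, false); rewrite /star_sqr /=; apply: mulIf.
by rewrite invr_eq0 gt_eqF// axis_sqr_gt0.
Qed.

Lemma iter_corner k q (b1 : bool) : iter k.*2 next_corner (q, b1) = (q + k%:R, b1).
Proof.
elim: k => [|k IH]; first by rewrite addr0.
by rewrite doubleS !iterS IH /next_corner; case: (b1) => /=; rewrite -addrA -mulrSr.
Qed.

Lemma iter_corner_onto i i' : exists k, (k < 9)%N /\ iter k next_corner i = i'.
Proof.
have h (q q' : 'I_4) : q + (val (q' - q))%:R = q'.
  by rewrite (natr_Zp (q' - q)) addrC subrK.
have g (x : 'I_4) : (x.*2.+1 < 9)%N by case: x => [[|[|[|[|]]]]].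
case: i i' => q [] [q' []].
- exists (val (q' - q)).*2; split; last by rewrite iter_corner h.
  exact: ltnW (g _).
- exists (val (q' - (q + 1))).*2.+1; split; last by rewrite iterSr iter_corner /next_corner /= h.
  exact: g.
- exists (val (q' - q)).*2.+1; split; last by rewrite iterSr iter_corner /next_corner /= h.
  exact: g.
- exists (val (q' - q)).*2; split; last by rewrite iter_corner h.
  exact: ltnW (g _).
Qed.

Lemma heron_step (y z c : R) : 0 < y -> 0 <= heron y z c -> z <= 2 * y + 2 * c ^+ 2.
Proof.
rewrite /heron => yp h; rewrite leNgt; apply/negP => lt.
have y2 : 0 <= c ^+ 2 by rewrite sqr_ge0.
have h' : 4 * y * z - (y + z - c ^+ 2) ^+ 2 = z * (2 * (y + c ^+ 2) - z) - (y - c ^+ 2) ^+ 2 by ring.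
have s := sqr_ge0 (y - c ^+ 2).
by rewrite h' in h; nra.
Qed.

(** If all eight corners were far away compared with the sides, each angle would be less than pi /
    4, against the sum 2 pi. So some corner is near, and the triangle inequality bounds the others,
    at most eight steps away. *)
Lemma star_ok_bounded : exists2 M, 0 < M & forall y, (forall x, 0 < y x) -> star_ok y ->
  forall q, y (axis q) <= M.
Proof.
pose c2 := \sum_i side i ^+ 2.
have c2i i : side i ^+ 2 <= c2.
  by rewrite /c2 (bigD1 i)//= lerDl sumr_ge0// => j _; rewrite sqr_ge0.
have c20 : 0 <= c2 by rewrite sumr_ge0// => j _; rewrite sqr_ge0.
(* Beyond [M] each cosine exceeds 7/8 > cos (pi / 4). By [heron_step], the squared distance plus
   [2 * c2] at most doubles along a side, whence the power of 2. *)
pose M := 4 * c2.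
pose M' := (2 ^+ 9) * (M + 2 * c2).
exists ((a + b) * M' + 1).
  by rewrite ltr_wpDl// mulr_ge0 ?(ltW ab0)// /M' mulr_ge0 ?exprn_ge0// /M; lra.
move=> y y0 [[Y0 H _] S] q.
have [i Yi] : exists i, star_sqr y i <= M.
  apply: contrapT => no.
  have no' i : M < star_sqr y i by rewrite ltNge; apply/negP => h; apply: no; exists i.
  have small i : arc (star_sqr y i) (star_sqr y (next_corner i)) (side i) < pi / 4.
    set Y := star_sqr y i; set Z := star_sqr y (next_corner i).
    have Y1 : 0 < Y := Y0 _; have Z1 : 0 < Z := Y0 _.
    have YZ : 0 < Y * Z by rewrite mulr_gt0.
    have ci := cosl_bound Y1 Z1 (H i).
    rewrite arcE; [|exact: Y1|exact: Z1|exact: H].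
    have r0 : 0 < Num.sqrt (Y * Z) by rewrite sqrtr_gt0.
    have rr : Num.sqrt (Y * Z) ^+ 2 = Y * Z by rewrite sqr_sqrtr// ltW.
    have pi0 := pi_gt0 R.
    have cpi4 : cos (pi / 4) < 7 / 8 :> R.
      have : cos (pi / 4 + pi / 4) = 0 :> R by rewrite -cos_pihalf; congr cos; field.
      by rewrite cosD; have := cos2Dsin2 (pi / 4 : R) => k1 k2; nra.
    have hc : 7 / 8 < cosl Y Z (side i).
      rewrite /cosl ltr_pdivlMr ?mulr_gt0//.
      have m1 := no' i; have m2 := no' (next_corner i); have m3 := c2i i.
      rewrite -/Y in m1; rewrite -/Z in m2; rewrite /M in m1 m2.
      have s2 := sqr_ge0 (Y - Z).
      have g4 : 4 * c2 < Num.sqrt (Y * Z).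
        rewrite -(ltr_pXn2r (n := 2)) ?nnegrE ?mulr_ge0 ?sqrtr_ge0// rr.
        by nra.
      have g5 : 2 * Num.sqrt (Y * Z) <= Y + Z.
        rewrite -ler_sqr ?nnegrE ?mulr_ge0 ?sqrtr_ge0 ?addr_ge0 ?(ltW Y1) ?(ltW Z1)//.
        by rewrite exprMn rr; lra.
      by lra.
    rewrite -ltr_cos ?in_itv/= ?acos_ge0 ?acos_lepi//; last by apply/andP; split; lra.
    by rewrite acosK ?in_itv//; apply: lt_trans hc.
  have : \sum_i arc (star_sqr y i) (star_sqr y (next_corner i)) (side i) < \sum_(i : corner) (pi / 4).
    apply: ltr_sum => [|i _]; last exact: small.
    by apply/hasP; exists (0, true); rewrite // mem_index_enum.
  rewrite -/(angle_sum _ _ _) S sumr_const card_prod card_ord card_bool => h.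
  have e : pi / 4 *+ (4 * 2) = 2 * pi :> R by rewrite -mulr_natl natrM; field.
  by rewrite e ltxx in h.
have step k : star_sqr y (iter k next_corner i) <= 2 ^+ k * (M + 2 * c2) - 2 * c2.
  elim: k => [|k IH]; first by rewrite expr0 mul1r /=; lra.
  have := heron_step (Y0 _) (H (iter k next_corner i)); rewrite -iterS.
  by have := c2i (iter k next_corner i); rewrite (exprS _ k); lra.
have [k [k9 ki]] := iter_corner_onto i (q, false).
have := step k; rewrite ki /star_sqr /= ler_pdivrMr ?axis_sqr_gt0// => h.
have h2 : 2 ^+ k * (M + 2 * c2) - 2 * c2 <= M'.
  have : 2 ^+ k * (M + 2 * c2) <= M'.
    rewrite /M' ler_wpM2r ?ler_weXn2l ?ler1n//; last exact: ltnW.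
    by rewrite /M; lra.
  by lra.
have h3 : axis_sqr q <= a + b by rewrite -(axis_sqrS q) lerDl ltW// axis_sqr_gt0.
have M'0 : 0 <= M' by rewrite /M' mulr_ge0 ?exprn_ge0// /M; lra.
apply: (le_trans h); apply: (@le_trans _ _ (M' * axis_sqr q)).
  by rewrite ler_wpM2r// ltW// axis_sqr_gt0.
by rewrite mulrC; have := ler_wpM2r M'0 h3; lra.
Qed.

(** All inequalities in [convex_star] on [heron] and [turn] are weak, and [arc] is continuous up to
    degenerate triangles, so only positivity of the limit has to be assumed. *)
Lemma star_ok_closed (T : Type) (F : set_system T) (FF : ProperFilter F)
    (f : T -> V -> R) y : (forall x, 0 < y x) ->
  (forall x, f z x @[z --> F] --> y x) -> (forall z, star_ok (f z)) -> star_ok y.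
Proof.
move=> y0 fy ok.
have Yc i : star_sqr (f z) i @[z --> F] --> star_sqr y i.
  case: i => q []; rewrite /star_sqr /=; last by apply: cvgMl; exact: fy.
  under eq_fun do rewrite maxr_absE.
  rewrite maxr_absE; apply: cvgMl.
  have c1 := fy (axis q); have c2 := fy (axis (q + 1)); have c3 := fy (axis q + axis (q + 1)).
  have c4 : kappa q / (a + b) * (f z (axis q) + f z (axis (q + 1))) - 1 @[z --> F] -->
      kappa q / (a + b) * (y (axis q) + y (axis (q + 1))) - 1.
    by apply: cvgB; [apply: cvgMr; exact: cvgD|exact: cvg_cst].
  by apply: cvgMl; apply: cvgD; [exact: cvgD|apply: cvg_norm; exact: cvgB].
have ge0 (g : T -> R) (x : R) : g z @[z --> F] --> x -> (forall z, 0 <= g z) -> 0 <= x.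
  move=> gx g0; rewrite leNgt; apply/negP => x0.
  have : \forall z \near F, g z < 0 by exact: (cvgr_lt _ gx).
  by move=> /filter_ex[z]; rewrite ltNge g0.
split; first split.
- exact: star_sqr_gt0.
- move=> i; apply: (ge0 (fun z => heron (star_sqr (f z) i) (star_sqr (f z) (next_corner i)) (side i))).
    apply: cvgB; first by apply: cvgM; [apply: cvgMr|]; exact: Yc.
    have c1 : star_sqr (f z) i + star_sqr (f z) (next_corner i) - side i ^+ 2 @[z --> F] -->
        star_sqr y i + star_sqr y (next_corner i) - side i ^+ 2.
      by apply: cvgB; [apply: cvgD; exact: Yc|exact: cvg_cst].
    by rewrite expr2; under eq_fun do rewrite expr2; exact: cvgM.
  by move=> z; have [[]] := ok z.
- move=> i; apply: (ge0 (fun z => turn next_corner prev_corner side (star_sqr (f z)) i)).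
    by apply: cvgD; apply: cvgMl; apply: cvgD; rewrite ?cvgB//; [apply: cvgB; exact: Yc|exact: cvg_cst|apply: cvgB; exact: Yc|exact: cvg_cst].
  by move=> z; have [[]] := ok z.
have : angle_sum next_corner side (star_sqr (f z)) @[z --> F] --> angle_sum next_corner side (star_sqr y).
  apply: cvg_sumr => i; apply: cvg_arc; [exact: star_sqr_gt0|exact: star_sqr_gt0|exact: Yc|exact: Yc].
have -> : (fun z => angle_sum next_corner side (star_sqr (f z))) = cst (2 * pi).
  by apply/funext => z; have [_ ->] := ok z.
by move/cvg_lim => <- //; rewrite lim_cst.
Qed.

End Star.

(** * Inversion of one quadrant of a star *)

Section Quadrant.
Context {R : realType}.
Implicit Types (p r K yE yG yD s : R) (D E G M : R[i]).

Definition inv2 D : R[i] := (dot D D)^-1%:C * D.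

Lemma dot_inv2 D : dot D D != 0 -> dot (inv2 D) (inv2 D) = (dot D D)^-1.
Proof.
move=> ne; have -> : dot (inv2 D) (inv2 D) = (dot D D)^-1 ^+ 2 * dot D D.
  by rewrite /inv2; set k := (dot D D)^-1; rewrite /dot; case: (D) => ? ? /=; ring.
by rewrite expr2 -mulrA mulVf// mulr1.
Qed.

Lemma dist_inv2 D E : dot D D != 0 -> dot E E != 0 ->
  dot (inv2 D - inv2 E) (inv2 D - inv2 E) = dot (D - E) (D - E) / (dot D D * dot E E).
Proof.
move=> d0 e0; rewrite /inv2; have := mulVf d0; have := mulVf e0.
set k := (dot D D)^-1; set m := (dot E E)^-1; move=> e1 e2; rewrite invfM -/k -/m.
transitivity (k * (k * dot D D) + m * (m * dot E E) - 2 * k * m * dot D E).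
  by rewrite /dot; case: (D) (E) => ? ? [? ?] /=; ring.
rewrite e1 e2.
transitivity (m * (k * dot D D) + k * (m * dot E E) - 2 * k * m * dot D E).
  by rewrite e1 e2; ring.
by rewrite /dot; case: (D) (E) => ? ? [? ?] /=; ring.
Qed.

Lemma cross_inv2 D E : cross (inv2 D) (inv2 E) = cross D E / (dot D D * dot E E).
Proof.
rewrite /inv2 invfM; set k := _^-1; set m := _^-1.
by rewrite /cross; case: (D) (E) => ? ? [? ?] /=; ring.
Qed.

Definition mid_sqr p r K yE yG yD : R :=
  Num.max yD (K / (p + r) * (yE + yG) - 1) / K.

(** The cell is cut by EG, so there is no diagonal spoke: the corner M is put on the inverted edge,
    dividing it in the ratio r : p, and K is such that the two parts have the same lengths as in
    [near_quadrant]. *)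
Lemma far_quadrant p r K yE yG yD E G : 0 < p -> 0 < r -> 0 < K -> 0 < yE -> 0 < yG ->
  dot E E = p / yE -> dot G G = r / yG -> 0 < cross E G ->
  dot (E - G) (E - G) = ((p + r) ^+ 2 / K) / (yE * yG) ->
  yD <= K / (p + r) * (yE + yG) - 1 ->
  let M := (p / (p + r))%:C * inv2 E + (r / (p + r))%:C * inv2 G in
  [/\ dot M M = mid_sqr p r K yE yG yD,
      dot (inv2 E - M) (inv2 E - M) = r / (p * K),
      dot (M - inv2 G) (M - inv2 G) = p / (r * K),
      0 < cross (inv2 E) M & 0 < cross M (inv2 G)].
Proof.
move=> p0 r0 K0 e0 g0 EE GG EG EmG le M.
have pr0 : 0 < p + r by rewrite addr_gt0.
have EE0 : dot E E != 0 by rewrite EE mulf_neq0 ?invr_eq0 ?gt_eqF.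
have GG0 : dot G G != 0 by rewrite GG mulf_neq0 ?invr_eq0 ?gt_eqF.
have d := dist_inv2 EE0 GG0; rewrite EmG EE GG in d.
have nE := dot_inv2 EE0; have nG := dot_inv2 GG0; rewrite EE in nE; rewrite GG in nG.
have c : 0 < cross (inv2 E) (inv2 G).
  by rewrite cross_inv2 divr_gt0// mulr_gt0// ?EE ?GG divr_gt0.
rewrite /M; move: d nE nG c; set A := inv2 E; set B := inv2 G => d nE nG c.
have e1 (x y : R) : x + y = 1 -> dot (x%:C * A + y%:C * B) (x%:C * A + y%:C * B) =
    x * dot A A + y * dot B B - x * y * dot (A - B) (A - B).
  move=> xy; have -> : y = 1 - x by lra.
  by rewrite /dot; case: (A) (B) => ? ? [? ?] /=; ring.
have e2 (x y : R) : x + y = 1 -> dot (A - (x%:C * A + y%:C * B)) (A - (x%:C * A + y%:C * B)) =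
    y ^+ 2 * dot (A - B) (A - B).
  move=> xy; have -> : x = 1 - y by lra.
  by rewrite /dot; case: (A) (B) => ? ? [? ?] /=; ring.
have e3 (x y : R) : x + y = 1 -> dot (x%:C * A + y%:C * B - B) (x%:C * A + y%:C * B - B) =
    x ^+ 2 * dot (A - B) (A - B).
  move=> xy; have -> : y = 1 - x by lra.
  by rewrite /dot; case: (A) (B) => ? ? [? ?] /=; ring.
have e4 (x y : R) : cross A (x%:C * A + y%:C * B) = y * cross A B.
  by rewrite /cross; case: (A) (B) => ? ? [? ?] /=; ring.
have e5 (x y : R) : cross (x%:C * A + y%:C * B) B = x * cross A B.
  by rewrite /cross; case: (A) (B) => ? ? [? ?] /=; ring.
have xy : p / (p + r) + r / (p + r) = 1 by rewrite -mulrDl divff// gt_eqF.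
rewrite e1// e2// e3// e4 e5 nE nG d /mid_sqr (max_idPr le).
split; first by field; rewrite !gt_eqF.
- by field; rewrite !gt_eqF.
- by field; rewrite !gt_eqF.
- by rewrite mulr_gt0// divr_gt0.
- by rewrite mulr_gt0// divr_gt0.
Qed.

Lemma near_quadrant p r K yE yG yD E D G : 0 < p -> 0 < r -> 0 < K ->
  0 < yE -> 0 < yG -> 0 < yD ->
  dot E E = p / yE -> dot G G = r / yG -> dot D D = K / yD ->
  0 < cross E D -> 0 < cross D G ->
  dot (E - D) (E - D) = r / (yE * yD) -> dot (D - G) (D - G) = p / (yG * yD) ->
  K / (p + r) * (yE + yG) - 1 <= yD ->
  [/\ dot (inv2 D) (inv2 D) = mid_sqr p r K yE yG yD,
      dot (inv2 E - inv2 D) (inv2 E - inv2 D) = r / (p * K),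
      dot (inv2 D - inv2 G) (inv2 D - inv2 G) = p / (r * K),
      0 < cross (inv2 E) (inv2 D) & 0 < cross (inv2 D) (inv2 G)].
Proof.
move=> p0 r0 K0 e0 g0 d0 EE GG DD ED DG EmD DmG le.
have EE0 : dot E E != 0 by rewrite EE mulf_neq0 ?invr_eq0 ?gt_eqF.
have GG0 : dot G G != 0 by rewrite GG mulf_neq0 ?invr_eq0 ?gt_eqF.
have DD0 : dot D D != 0 by rewrite DD mulf_neq0 ?invr_eq0 ?gt_eqF.
rewrite dot_inv2// !dist_inv2// !cross_inv2 EmD DmG EE GG DD /mid_sqr (max_idPl le).
split; first by field; rewrite !gt_eqF.
- by field; rewrite !gt_eqF.
- by field; rewrite !gt_eqF.
- by rewrite divr_gt0// mulr_gt0// divr_gt0.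
- by rewrite divr_gt0// mulr_gt0// divr_gt0.
Qed.

Lemma sqrt_side p r K : 0 < p -> 0 < r -> 0 < K ->
  Num.sqrt (r / (p * K)) = Num.sqrt r / (Num.sqrt p * Num.sqrt K).
Proof. by move=> p0 r0 K0; rewrite sqrtrM ?ltW// sqrtrV ?sqrtrM ?mulr_ge0 ?ltW. Qed.

(* Inversion turns the angle of the triangulation facing a spoke into the     *)
(* angle of the octagon at the end of the inverted spoke.                     *)
Lemma far_tang p r K yE yG yD (x y z : R) : 0 < p -> 0 < r -> 0 < K ->
  0 < x -> 0 < y -> 0 < z -> yE = (x / y) ^+ 2 -> yG = (x / z) ^+ 2 ->
  yD <= K / (p + r) * (yE + yG) - 1 ->
  tang (yE / p) (mid_sqr p r K yE yG yD) (Num.sqrt (r / (p * K))) =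
  2 * (x / y) / Num.sqrt p *
   ((r * (x * z) ^+ 2 + (p + r) ^+ 2 / K * (y * z) ^+ 2 - p * (x * y) ^+ 2) /
    (2 * Num.sqrt r * Num.sqrt ((p + r) ^+ 2 / K) * (x * y * z ^+ 2))).
Proof.
move=> p0 r0 K0 x0 y0 z0 -> -> le.
have pr0 : 0 < p + r by rewrite addr_gt0.
rewrite /tang /mid_sqr (max_idPr le) sqrt_side// sqrtrM ?sqr_ge0// sqrtr_sqr gtr0_norm//.
rewrite sqrtrV ?ltW//.
have hp : p = Num.sqrt p ^+ 2 by rewrite sqr_sqrtr// ltW.
have hr : r = Num.sqrt r ^+ 2 by rewrite sqr_sqrtr// ltW.
have hK : K = Num.sqrt K ^+ 2 by rewrite sqr_sqrtr// ltW.
have p1 : 0 < Num.sqrt p by rewrite sqrtr_gt0.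
have r1 : 0 < Num.sqrt r by rewrite sqrtr_gt0.
have K1 : 0 < Num.sqrt K by rewrite sqrtr_gt0.
move: p1 r1 K1 hp hr hK pr0; set sp := Num.sqrt p; set sr := Num.sqrt r; set sK := Num.sqrt K.
move=> p1 r1 K1 -> -> -> pr0.
by field; rewrite !gt_eqF.
Qed.

Lemma near_tang p r K yE yG yD (x y z : R) : 0 < p -> 0 < r -> 0 < K ->
  0 < x -> 0 < y -> 0 < z -> yE = (x / y) ^+ 2 -> yD = (x / z) ^+ 2 ->
  K / (p + r) * (yE + yG) - 1 <= yD ->
  tang (yE / p) (mid_sqr p r K yE yG yD) (Num.sqrt (r / (p * K))) =
  2 * (x / y) / Num.sqrt p *
   ((K * (x * z) ^+ 2 + r * (y * z) ^+ 2 - p * (x * y) ^+ 2) /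
    (2 * Num.sqrt K * Num.sqrt r * (x * y * z ^+ 2))).
Proof.
move=> p0 r0 K0 x0 y0 z0 -> -> le.
rewrite /tang /mid_sqr (max_idPl le) sqrt_side//.
have hp : p = Num.sqrt p ^+ 2 by rewrite sqr_sqrtr// ltW.
have hr : r = Num.sqrt r ^+ 2 by rewrite sqr_sqrtr// ltW.
have hK : K = Num.sqrt K ^+ 2 by rewrite sqr_sqrtr// ltW.
have p1 : 0 < Num.sqrt p by rewrite sqrtr_gt0.
have r1 : 0 < Num.sqrt r by rewrite sqrtr_gt0.
have K1 : 0 < Num.sqrt K by rewrite sqrtr_gt0.
move: p1 r1 K1 hp hr hK; set sp := Num.sqrt p; set sr := Num.sqrt r; set sK := Num.sqrt K.
move=> p1 r1 K1 -> -> ->.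
by field; rewrite !gt_eqF.
Qed.

Lemma mid_sqrC p r K yE yG yD : mid_sqr r p K yG yE yD = mid_sqr p r K yE yG yD.
Proof. by rewrite /mid_sqr (addrC r) (addrC yG). Qed.

(** The hypothesis is the sum of the cosines of the two angles facing the diagonal. It equals the
    difference of the two sides of the conclusion up to a positive factor, and so decides which
    argument of the maximum in [mid_sqr] is attained. *)
Lemma far_Delaunay p r K (x y z t : R) : 0 < p -> 0 < r -> 0 < K ->
  0 < x -> 0 < y -> 0 < z -> 0 < t ->
  0 <= (p * (y * x) ^+ 2 + r * (z * x) ^+ 2 - (p + r) ^+ 2 / K * (y * z) ^+ 2) /
       (2 * Num.sqrt p * Num.sqrt r * (y * z * x ^+ 2)) +
       (r * (y * t) ^+ 2 + p * (z * t) ^+ 2 - (p + r) ^+ 2 / K * (y * z) ^+ 2) /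
       (2 * Num.sqrt r * Num.sqrt p * (y * z * t ^+ 2)) ->
  (x / t) ^+ 2 <= K / (p + r) * ((x / y) ^+ 2 + (x / z) ^+ 2) - 1.
Proof.
move=> p0 r0 K0 x0 y0 z0 t0.
have p1 : 0 < Num.sqrt p by rewrite sqrtr_gt0.
have r1 : 0 < Num.sqrt r by rewrite sqrtr_gt0.
have pr0 : 0 < p + r by rewrite addr_gt0.
rewrite -subr_ge0 => h; rewrite -subr_ge0.
set lhs := (X in 0 <= X - 0) in h; rewrite subr0 in h.
have -> : K / (p + r) * ((x / y) ^+ 2 + (x / z) ^+ 2) - 1 - (x / t) ^+ 2 =
  lhs * (2 * Num.sqrt p * Num.sqrt r * K * x ^+ 2 / (y * z * (p + r) ^+ 2)).
  by rewrite /lhs; field; rewrite !gt_eqF.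
by rewrite mulr_ge0// divr_ge0 ?mulr_ge0 ?sqr_ge0// ltW.
Qed.

Lemma near_Delaunay p r K (x y z t : R) : 0 < p -> 0 < r -> 0 < K ->
  0 < x -> 0 < y -> 0 < z -> 0 < t ->
  0 <= (p * (x * y) ^+ 2 + r * (t * y) ^+ 2 - K * (x * t) ^+ 2) /
       (2 * Num.sqrt p * Num.sqrt r * (x * t * y ^+ 2)) +
       (r * (x * z) ^+ 2 + p * (t * z) ^+ 2 - K * (x * t) ^+ 2) /
       (2 * Num.sqrt r * Num.sqrt p * (x * t * z ^+ 2)) ->
  K / (p + r) * ((x / y) ^+ 2 + (x / z) ^+ 2) - 1 <= (x / t) ^+ 2.
Proof.
move=> p0 r0 K0 x0 y0 z0 t0.
have p1 : 0 < Num.sqrt p by rewrite sqrtr_gt0.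
have r1 : 0 < Num.sqrt r by rewrite sqrtr_gt0.
have pr0 : 0 < p + r by rewrite addr_gt0.
rewrite -subr_ge0 => h; rewrite -subr_ge0.
set lhs := (X in 0 <= X - 0) in h; rewrite subr0 in h.
have -> : (x / t) ^+ 2 - (K / (p + r) * ((x / y) ^+ 2 + (x / z) ^+ 2) - 1) =
  lhs * (2 * Num.sqrt p * Num.sqrt r * x / (t * (p + r))).
  by rewrite /lhs; field; rewrite !gt_eqF.
by rewrite mulr_ge0// divr_ge0 ?mulr_ge0// ltW.
Qed.

End Quadrant.

(** * The octagon of a vertex in an embedded system *)

Section Embedded.
Context {R : realType} (a b h : R).
Local Notation V := (int * int)%type.
Local Notation C := (a + b - 2 * h).
Hypotheses (a0 : 0 < a) (b0 : 0 < b) (C0 : 0 < C).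
Implicit Types (W : V -> R) (P : V -> R[i]) (Tr : V -> V -> V -> Prop) (x y z e g : V).

(* The square of the length of a lattice vector, in a basis with Gram matrix  *)
(* [[a, h], [h, b]].                                                          *)
Definition qform x : R :=
  x.1%:~R ^+ 2 * a + 2 * x.1%:~R * x.2%:~R * h + x.2%:~R ^+ 2 * b.

(* The cosine of the angle at c, facing xy, of the scaled triangle cxy. *)
Definition dcos W c x y : R :=
  (qform (c - x) * (expR (W x) * expR (W c)) ^+ 2 +
   qform (c - y) * (expR (W y) * expR (W c)) ^+ 2 -
   qform (x - y) * (expR (W x) * expR (W y)) ^+ 2) /
  (2 * Num.sqrt (qform (c - x)) * Num.sqrt (qform (c - y)) *
     (expR (W x) * expR (W y) * expR (W c) ^+ 2)).

Definition lens W P Tr : Prop := forall x y z, Tr x y z ->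
  dot (P x - P y) (P x - P y) = qform (x - y) * (expR (W x) * expR (W y)) ^+ 2.

Definition cells Tr : Prop := forall z,
  (Tr z (z + (1, 0)) (z + (0, 1)) /\ Tr (z + (1, 1)) (z + (0, 1)) (z + (1, 0))) \/
  [/\ h = 0, Tr z (z + (1, 0)) (z + (1, 1)) & Tr z (z + (1, 1)) (z + (0, 1))].

Definition star_factor W z x : R := expR (- 2 * (W (z + x) - W z)).

(** W is the factor on Z^2, P the developed vertices and Tr the counterclockwise triangles. The last
    clause is injectivity of the development: equal image points have equal lattice coordinates. *)
Record embedded W P Tr : Prop := Embedded {
  emb_rot : forall x y z, Tr x y z -> Tr y z x;
  emb_lens : lens W P Tr;
  emb_area : forall x y z, Tr x y z -> 0 < area (P x) (P y) (P z);
  emb_Delaunay : forall x y c d, Tr x y c -> Tr y x d ->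
    0 <= dcos W c x y + dcos W d x y;
  emb_cells : cells Tr;
  emb_inj : forall x y z x' y' z' (l m n l' m' n' : R), Tr x y z -> Tr x' y' z' ->
    0 <= l -> 0 <= m -> 0 <= n -> l + m + n = 1 ->
    0 <= l' -> 0 <= m' -> 0 <= n' -> l' + m' + n' = 1 ->
    l%:C * P x + m%:C * P y + n%:C * P z = l'%:C * P x' + m'%:C * P y' + n'%:C * P z' ->
    l * x.1%:~R + m * y.1%:~R + n * z.1%:~R = l' * x'.1%:~R + m' * y'.1%:~R + n' * z'.1%:~R /\
    l * x.2%:~R + m * y.2%:~R + n * z.2%:~R = l' * x'.2%:~R + m' * y'.2%:~R + n' * z'.2%:~R }.

Lemma qformN x : qform (- x) = qform x.
Proof. by rewrite /qform /= !rmorphN /=; ring. Qed.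

Lemma qformB x y : qform (x - y) = qform (y - x).
Proof. by rewrite -opprB qformN. Qed.

Variables (W : V -> R) (P : V -> R[i]) (Tr : V -> V -> V -> Prop).
Hypothesis emb : embedded W P Tr.

Let rot := emb_rot emb.

Lemma tr_eq x y z x' y' z' : Tr x y z -> x = x' -> y = y' -> z = z' -> Tr x' y' z'.
Proof. by move=> t <- <- <-. Qed.

Lemma pair_ext x y : x.1 = y.1 -> x.2 = y.2 -> x = y.
Proof. by case: x y => ? ? [? ?] /= -> ->. Qed.

Local Ltac veq := apply: pair_ext => /=; ring.

(** A diagonal of a cell issues from two of its corners and faces the two others, so even and odd
    quadrants see opposite cases of [cells]. *)
Lemma quadrant_split z (q : 'I_4) :
  [/\ qform (axis q) = axis_sqr a b q, qform (axis (q + 1)) = axis_sqr a b (q + 1) &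
   [/\ Tr z (z + axis q) (z + axis (q + 1)),
       Tr (z + (axis q + axis (q + 1))) (z + axis (q + 1)) (z + axis q) &
       qform (axis q - axis (q + 1)) = (axis_sqr a b q + axis_sqr a b (q + 1)) ^+ 2 / kappa a b C q] \/
   [/\ Tr z (z + axis q) (z + (axis q + axis (q + 1))),
       Tr z (z + (axis q + axis (q + 1))) (z + axis (q + 1)) &
       qform (axis q + axis (q + 1)) = kappa a b C q]].
Proof.
have ab : 0 < a + b by rewrite addr_gt0.
have nab : a + b != 0 by rewrite gt_eqF.
have nC : C != 0 by rewrite gt_eqF.
case: q => [[|[|[|[|//]]]] lt].
- have -> : Ordinal lt + 1 = 1 by apply/val_inj.
  rewrite /axis /axis_sqr /kappa /=; split; [by rewrite /qform /=; ring|by rewrite /qform /=; ring|].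
  have [[t1 t2]|[h0 t1 t2]] := emb_cells emb z; [left|right]; split.
  + by apply: (tr_eq t1) => //; veq.
  + by apply: (tr_eq t2) => //; veq.
  + by rewrite /qform /=; field; rewrite nC.
  + by apply: (tr_eq t1) => //; veq.
  + by apply: (tr_eq t2) => //; veq.
  + by rewrite /qform /= h0; field.
- have -> : Ordinal lt + 1 = 2%:R by apply/val_inj.
  rewrite /axis /axis_sqr /kappa /=; split; [by rewrite /qform /=; ring|by rewrite /qform /=; ring|].
  have [[t1 t2]|[h0 t1 t2]] := emb_cells emb (z + (-1, 0)); [right|left]; split.
  + by apply: (tr_eq (rot (rot t2))) => //; veq.
  + by apply: (tr_eq (rot t1)) => //; veq.
  + by rewrite /qform /=; ring.
  + by apply: (tr_eq (rot t1)) => //; veq.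
  + by apply: (tr_eq (rot (rot t2))) => //; veq.
  + by rewrite /qform /= h0; field; rewrite h0 mulr0 subr0 in nC.
- have -> : Ordinal lt + 1 = 3%:R by apply/val_inj.
  rewrite /axis /axis_sqr /kappa /=; split; [by rewrite /qform /=; ring|by rewrite /qform /=; ring|].
  have [[t1 t2]|[h0 t1 t2]] := emb_cells emb (z + (-1, -1)); [left|right]; split.
  + by apply: (tr_eq t2) => //; veq.
  + by apply: (tr_eq t1) => //; veq.
  + by rewrite /qform /=; field; rewrite nC.
  + by apply: (tr_eq (rot t2)) => //; veq.
  + by apply: (tr_eq (rot (rot t1))) => //; veq.
  + by rewrite /qform /= h0; field.
- have -> : Ordinal lt + 1 = 0 by apply/val_inj.
  rewrite /axis /axis_sqr /kappa /=; split; [by rewrite /qform /=; ring|by rewrite /qform /=; ring|].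
  have [[t1 t2]|[h0 t1 t2]] := emb_cells emb (z + (0, -1)); [right|left]; split.
  + by apply: (tr_eq (rot (rot t1))) => //; veq.
  + by apply: (tr_eq (rot t2)) => //; veq.
  + by rewrite /qform /=; ring.
  + by apply: (tr_eq (rot (rot t2))) => //; veq.
  + by apply: (tr_eq (rot t1)) => //; veq.
  + by rewrite /qform /= h0; field; rewrite h0 mulr0 subr0 in nC.
Qed.

Variable z : V.
Local Notation y := (star_factor W z).
Local Notation rho x := (expR (W x)).
Local Notation star := (star_sqr a b C y).
Local Notation len := (axis_sqr a b).
Local Notation K := (kappa a b C).

(** Scaled so that, for an edge, the squared length of [spoke x] is [qform x / y x]. *)
Definition spoke x : R[i] := (expR (- 2 * W z))%:C * (P (z + x) - P z).

Lemma star_factorE x : y x = (rho z / rho (z + x)) ^+ 2.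
Proof.
rewrite /star_factor -expRN -expRD -expRM_natl; congr expR; ring.
Qed.

Lemma star_factor_gt0 x : 0 < y x. Proof. exact: expR_gt0. Qed.

Lemma lens_spoke x x' : (exists c, Tr (z + x) (z + x') c) ->
  dot (spoke x - spoke x') (spoke x - spoke x') = qform (x - x') / (y x * y x').
Proof.
move=> [c t]; have := emb_lens emb t.
have -> : z + x - (z + x') = x - x' by rewrite opprD addrACA subrr add0r.
move=> e.
have -> : dot (spoke x - spoke x') (spoke x - spoke x') = expR (- 2 * W z) ^+ 2 * dot (P (z + x) - P (z + x')) (P (z + x) - P (z + x')).
  by rewrite /spoke /dot; case: (P z) (P (z + x)) (P (z + x')) => ? ? [? ?] [? ?] /=; ring.
rewrite e !star_factorE mulNr expRN (_ : 2 * W z = W z + W z) ?expRD; last by ring.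
by field; rewrite !gt_eqF ?expR_gt0.
Qed.

Lemma lens_spoke0 x : (exists c, Tr z (z + x) c) -> dot (spoke x) (spoke x) = qform x / y x.
Proof.
move=> [c t]; have := @lens_spoke 0 x.
have -> : spoke 0 = 0 by rewrite /spoke addr0 subrr mulr0.
have -> : y 0 = 1 by rewrite /star_factor addr0 subrr mulr0 expR0.
rewrite !sub0r qformN mul1r addr0 => <-; last by exists c.
by rewrite /dot; case: (spoke x) => ? ? /=; ring.
Qed.

Lemma cross_spoke x x' : Tr z (z + x) (z + x') -> 0 < cross (spoke x) (spoke x').
Proof.
move=> t; have : cross (spoke x) (spoke x') = expR (- 2 * W z) ^+ 2 * area (P z) (P (z + x)) (P (z + x')).
  by rewrite /spoke /area /cross; case: (P z) (P (z + x)) (P (z + x')) => ? ? [? ?] [? ?] /=; ring.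
by move=> ->; rewrite mulr_gt0 ?exprn_gt0 ?expR_gt0// (emb_area emb t).
Qed.

Lemma dcosC c x x' : dcos W c x x' = dcos W c x' x.
Proof.
rewrite /dcos (qformB x x'); congr (_ / _); last by ring.
by rewrite [expR (W x) * expR (W x')]mulrC; ring.
Qed.

(* A sector of the star between two consecutive corners lies in one triangle; *)
(* in it, the combination s A + t B of the inverted corners is the image of   *)
(* the lattice combination m e + n g.                                         *)
Definition sector (A B : R[i]) e g (Q : R -> R -> R -> Prop) : Prop :=
  forall s t : R, 0 <= s -> 0 <= t -> exists x1 x2 (m1 m2 m n : R),
    [/\ Tr z (z + x1) (z + x2), 0 <= m1 /\ 0 <= m2,
      s%:C * A + t%:C * B = m1%:C * spoke x1 + m2%:C * spoke x2,
      m1 * x1.1%:~R + m2 * x2.1%:~R = m * e.1%:~R + n * g.1%:~R /\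
      m1 * x1.2%:~R + m2 * x2.2%:~R = m * e.2%:~R + n * g.2%:~R &
      [/\ 0 <= m, 0 <= n & Q t m n]].

(** M is the corner [(q, true)]: the inverted diagonal spoke if the diagonal is an edge, a point of
    the inverted edge otherwise. The last two clauses turn the cosines of the octagon at the axis
    corners into those of the angles facing the spokes, to which the Delaunay condition applies. *)
Lemma quadrant_star (q : 'I_4) : exists M : R[i],
  [/\ [/\ dot M M = star (q, true),
         dot (inv2 (spoke (axis q)) - M) (inv2 (spoke (axis q)) - M) = side a b C (q, false) ^+ 2 &
         dot (M - inv2 (spoke (axis (q + 1)))) (M - inv2 (spoke (axis (q + 1)))) = side a b C (q, true) ^+ 2],
      0 < cross (inv2 (spoke (axis q))) M /\ 0 < cross M (inv2 (spoke (axis (q + 1)))),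
      sector (inv2 (spoke (axis q))) M (axis q) (axis (q + 1))
        (fun t m n => 0 < t -> 0 < m /\ 0 < n) /\
      sector M (inv2 (spoke (axis (q + 1)))) (axis q) (axis (q + 1))
        (fun t m n => 0 < t -> 0 < n),
      exists2 c, Tr z (z + axis q) c &
        tang (star (q, false)) (star (q, true)) (side a b C (q, false)) =
        2 * (rho z / rho (z + axis q)) / Num.sqrt (len q) * dcos W c z (z + axis q) &
      exists2 c, Tr (z + axis (q + 1)) z c &
        tang (star (q + 1, false)) (star (q, true)) (side a b C (q, true)) =
        2 * (rho z / rho (z + axis (q + 1))) / Num.sqrt (len (q + 1)) * dcos W c (z + axis (q + 1)) z].
Proof.
have [qe qg cases] := quadrant_split z q.
set e := axis q in qe cases *; set g := axis (q + 1) in qg cases *.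
have p0 := axis_sqr_gt0 a0 b0 q; have r0 := axis_sqr_gt0 a0 b0 (q + 1).
have k0 := kappa_gt0 a0 b0 C0 q; have pr := axis_sqrS a b q.
have sE : star (q, true) = mid_sqr (len q) (len (q + 1)) (K q) (y e) (y g) (y (e + g)).
  by rewrite /star_sqr /mid_sqr /= pr.
have sd1 : side a b C (q, false) = Num.sqrt (len (q + 1) / (len q * K q)) by [].
have sd2 : side a b C (q, true) = Num.sqrt (len q / (len (q + 1) * K q)) by [].
have sq1 : side a b C (q, false) ^+ 2 = len (q + 1) / (len q * K q).
  by rewrite sd1 sqr_sqrtr// divr_ge0 ?mulr_ge0 ?ltW.
have sq2 : side a b C (q, true) ^+ 2 = len q / (len (q + 1) * K q).
  by rewrite sd2 sqr_sqrtr// divr_ge0 ?mulr_ge0 ?ltW.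
have x0 : 0 < rho z := expR_gt0 _; have xe : 0 < rho (z + e) := expR_gt0 _.
have xg : 0 < rho (z + g) := expR_gt0 _; have xd : 0 < rho (z + (e + g)) := expR_gt0 _.
have qDE : qform (z + (e + g) - (z + e)) = len (q + 1) by rewrite -qg; congr qform; veq.
have qDG : qform (z + (e + g) - (z + g)) = len q by rewrite -qe; congr qform; veq.
have qED : qform (z + e - (z + (e + g))) = len (q + 1) by rewrite qformB.
have qGD : qform (z + g - (z + (e + g))) = len q by rewrite qformB.
have dz x : z + x - z = x by rewrite addrC addKr.
have qEz : qform (z + e - z) = len q by rewrite dz.
have qGz : qform (z + g - z) = len (q + 1) by rewrite dz.
have qzE : qform (z - (z + e)) = len q by rewrite qformB.
have qzG : qform (z - (z + g)) = len (q + 1) by rewrite qformB.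
have dEG : z + e - (z + g) = e - g by veq.
have yE x : y x = (rho z / rho (z + x)) ^+ 2 := star_factorE x.
have y0 := star_factor_gt0.
have pr0 : 0 < len q + len (q + 1) by rewrite addr_gt0.
have kp x : 0 < dot (spoke x) (spoke x) -> 0 < (dot (spoke x) (spoke x))^-1 by rewrite invr_gt0.
case: cases => [[t1 t2 fd]|[t1 t2 nd]].
  have qEG : qform (z + e - (z + g)) = (len q + len (q + 1)) ^+ 2 / K q by rewrite dEG.
  have qGE : qform (z + g - (z + e)) = (len q + len (q + 1)) ^+ 2 / K q by rewrite qformB.
  have le : y (e + g) <= K q / (len q + len (q + 1)) * (y e + y g) - 1.
    rewrite !yE; apply: far_Delaunay => //.
    by have := emb_Delaunay emb (rot t1) (rot t2); rewrite /dcos qzE qzG qEG qDE qDG.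
  have EE : dot (spoke e) (spoke e) = len q / y e by rewrite lens_spoke0 ?qe//; exists (z + g).
  have GG : dot (spoke g) (spoke g) = len (q + 1) / y g.
    have -> : dot (spoke g) (spoke g) = dot (spoke g - spoke 0) (spoke g - spoke 0).
      by rewrite /spoke addr0 subrr mulr0 subr0.
    rewrite lens_spoke; last by exists (z + e); rewrite addr0; exact: rot (rot t1).
    by rewrite subr0 qg /star_factor addr0 subrr mulr0 expR0 mulr1.
  have EG := cross_spoke t1.
  have EmG := lens_spoke (ex_intro _ z (rot t1)); rewrite fd in EmG.
  have [M1 M2 M3 M4 M5] := far_quadrant p0 r0 k0 (y0 e) (y0 g) EE GG EG EmG le.
  set M := (X in dot X X) in M1 M2 M3 M4 M5.
  have kE : 0 < (dot (spoke e) (spoke e))^-1 by apply: kp; rewrite EE divr_gt0.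
  have kG : 0 < (dot (spoke g) (spoke g))^-1 by apply: kp; rewrite GG divr_gt0.
  have c1 : 0 < len q / (len q + len (q + 1)) by rewrite divr_gt0.
  have c2 : 0 < len (q + 1) / (len q + len (q + 1)) by rewrite divr_gt0.
  exists M; split.
  - by rewrite M1 M2 M3 sq1 sq2 sE.
  - by [].
  - split=> s t s0 t0; exists e, g.
      set m1 := (dot (spoke e) (spoke e))^-1 * (s + t * (len q / (len q + len (q + 1)))).
      set m2 := (dot (spoke g) (spoke g))^-1 * (t * (len (q + 1) / (len q + len (q + 1)))).
      have h1 : 0 <= m1 by rewrite mulr_ge0 ?(ltW kE)// addr_ge0// mulr_ge0// ltW.
      have h2 : 0 <= m2 by rewrite mulr_ge0 ?(ltW kG)// mulr_ge0// ltW.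
      exists m1, m2, m1, m2; split=> //.
        by rewrite /M /m1 /m2 /inv2 !rmorphM !rmorphD !rmorphM /=; ring.
      split=> // tp; split; rewrite /m1 /m2.
        by apply: mulr_gt0 => //; rewrite ltr_wpDl//; exact: mulr_gt0.
      by apply: mulr_gt0 => //; exact: mulr_gt0.
    set m1 := (dot (spoke e) (spoke e))^-1 * (s * (len q / (len q + len (q + 1)))).
    set m2 := (dot (spoke g) (spoke g))^-1 * (s * (len (q + 1) / (len q + len (q + 1))) + t).
    have h1 : 0 <= m1 by rewrite mulr_ge0 ?(ltW kE)// mulr_ge0// ltW.
    have h2 : 0 <= m2 by rewrite mulr_ge0 ?(ltW kG)// addr_ge0// mulr_ge0// ltW.
    exists m1, m2, m1, m2; split=> //.
      by rewrite /M /m1 /m2 /inv2 !rmorphM !rmorphD !rmorphM /=; ring.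
    split=> // tp; rewrite /m2; apply: mulr_gt0 => //.
    by rewrite ltr_wpDl//; apply: mulr_ge0 => //; exact: ltW.
  - exists (z + g) => //; rewrite sE sd1.
    rewrite (far_tang p0 r0 k0 x0 xe xg (yE e) (yE g) le) /dcos.
    by rewrite qGz qGE qzE.
  - exists (z + e); first exact: rot (rot t1).
    rewrite sE sd2 -mid_sqrC dcosC.
    rewrite (addrC (y e)) (addrC (len q)) in le.
    rewrite (far_tang r0 p0 k0 x0 xg xe (yE g) (yE e) le) /dcos.
    by rewrite qEz qEG qzG (addrC (len q)).
have qDz : qform (z + (e + g) - z) = K q by rewrite dz.
have qzD : qform (z - (z + (e + g))) = K q by rewrite qformB.
have le : K q / (len q + len (q + 1)) * (y e + y g) - 1 <= y (e + g).
  rewrite !yE; apply: near_Delaunay => //.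
  have := emb_Delaunay emb t2 (rot (rot t1)); rewrite addrC /dcos.
  by rewrite qEz qED qzD qGz qGD.
have sp0 : spoke 0 = 0 by rewrite /spoke addr0 subrr mulr0.
have y00 : y 0 = 1 by rewrite /star_factor addr0 subrr mulr0 expR0.
have EE : dot (spoke e) (spoke e) = len q / y e by rewrite lens_spoke0 ?qe//; exists (z + (e + g)).
have DD : dot (spoke (e + g)) (spoke (e + g)) = K q / y (e + g).
  by rewrite lens_spoke0 ?nd//; exists (z + g).
have GG : dot (spoke g) (spoke g) = len (q + 1) / y g.
  have -> : dot (spoke g) (spoke g) = dot (spoke g - spoke 0) (spoke g - spoke 0) by rewrite sp0 subr0.
  rewrite lens_spoke; last by exists (z + (e + g)); rewrite addr0; exact: rot (rot t2).
  by rewrite subr0 qg y00 mulr1.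
have ED := cross_spoke t1; have DG := cross_spoke t2.
have EmD := lens_spoke (ex_intro _ z (rot t1)).
have DmG := lens_spoke (ex_intro _ z (rot t2)).
have e1 : qform (e - (e + g)) = len (q + 1) by rewrite -qg -qformN; congr qform; veq.
have e2 : qform (e + g - g) = len q by rewrite -qe; congr qform; veq.
rewrite e1 in EmD; rewrite e2 [y _ * y g]mulrC in DmG.
have [M1 M2 M3 M4 M5] := near_quadrant p0 r0 k0 (y0 e) (y0 g) (y0 (e + g)) EE GG DD ED DG EmD DmG le.
have kE : 0 < (dot (spoke e) (spoke e))^-1 by apply: kp; rewrite EE divr_gt0.
have kG : 0 < (dot (spoke g) (spoke g))^-1 by apply: kp; rewrite GG divr_gt0.
have kD : 0 < (dot (spoke (e + g)) (spoke (e + g)))^-1 by apply: kp; rewrite DD divr_gt0.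
exists (inv2 (spoke (e + g))); split.
- by rewrite M1 M2 M3 sq1 sq2 sE.
- by [].
- split=> s t s0 t0.
    set m1 := (dot (spoke e) (spoke e))^-1 * s.
    set m2 := (dot (spoke (e + g)) (spoke (e + g)))^-1 * t.
    have h1 : 0 <= m1 by rewrite mulr_ge0 ?(ltW kE).
    have h2 : 0 <= m2 by rewrite mulr_ge0 ?(ltW kD).
    exists e, (e + g), m1, m2, (m1 + m2), m2; split=> //.
    + by rewrite /m1 /m2 /inv2 !rmorphM /=; ring.
    + by split=> /=; ring.
    + split; [exact: addr_ge0|by []|move=> tp].
      have k2 : 0 < m2 by rewrite mulr_gt0.
      by rewrite k2 ltr_wpDl.
  set m1 := (dot (spoke (e + g)) (spoke (e + g)))^-1 * s.
  set m2 := (dot (spoke g) (spoke g))^-1 * t.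
  have h1 : 0 <= m1 by rewrite mulr_ge0 ?(ltW kD).
  have h2 : 0 <= m2 by rewrite mulr_ge0 ?(ltW kG).
  exists (e + g), g, m1, m2, m1, (m1 + m2); split=> //.
  + by rewrite /m1 /m2 /inv2 !rmorphM /=; ring.
  + by split=> /=; ring.
  + split; [by []|exact: addr_ge0|move=> tp].
    by rewrite ltr_wpDl// mulr_gt0.
- exists (z + (e + g)) => //; rewrite sE sd1.
  rewrite (near_tang p0 r0 k0 x0 xe xd (yE e) (yE (e + g)) le) /dcos.
  by rewrite qDz qDE qzE.
- exists (z + (e + g)); first exact: rot (rot t2).
  rewrite sE sd2 -mid_sqrC dcosC.
  rewrite (addrC (y e)) (addrC (len q)) in le.
  rewrite (near_tang r0 p0 k0 x0 xg xd (yE g) (yE (e + g)) le) /dcos.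
  by rewrite qDz qDG qzG.
Qed.

Lemma sum_corners (F : 'I_4 * bool -> R) :
  \sum_i F i = \sum_(k < 8) F (iter k next_corner (0, false)).
Proof.
rewrite (eq_bigr (fun i => F (i.1, i.2))); last by case.
rewrite -(pair_bigA _ (fun q c => F (q, c))) /=.
under eq_bigr do rewrite big_bool.
rewrite !big_ord_recl !big_ord0 /= /next_corner /=.
have e1 : lift ord0 ord0 = 0 + 1 :> 'I_4 by apply/val_inj.
have e2 : lift ord0 (lift ord0 ord0) = 0 + 1 + 1 :> 'I_4 by apply/val_inj.
have e3 : lift ord0 (lift ord0 (lift ord0 ord0)) = 0 + 1 + 1 + 1 :> 'I_4 by apply/val_inj.
have e0 : ord0 = 0 :> 'I_4 by apply/val_inj.
by rewrite e3 e2 e1 e0; ring.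
Qed.

(** Injectivity for cones with apex z: after shrinking by [D], both combinations are points of
    triangles at z. *)
Lemma spoke_inj (k m1 m2 : R) x x1 x2 c : 0 <= k -> 0 <= m1 -> 0 <= m2 ->
  Tr z (z + x) c -> Tr z (z + x1) (z + x2) ->
  k%:C * spoke x = m1%:C * spoke x1 + m2%:C * spoke x2 ->
  k * x.1%:~R = m1 * x1.1%:~R + m2 * x2.1%:~R /\
  k * x.2%:~R = m1 * x1.2%:~R + m2 * x2.2%:~R.
Proof.
move=> k0 m10 m20 t t' E.
pose D := 1 + k + m1 + m2.
have D0 : 0 < D by rewrite /D; clear E; lra.
have ne : D != 0 by rewrite gt_eqF.
have E' : k%:C * (P (z + x) - P z) = m1%:C * (P (z + x1) - P z) + m2%:C * (P (z + x2) - P z).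
  have n0 : (expR (- 2 * W z))%:C != 0 :> R[i].
    by apply/eqP => /eqP; rewrite eq_complex /= gt_eqF ?expR_gt0.
  by apply: (mulfI n0); move: E; rewrite /spoke => E; transitivity (k%:C * ((expR (-2 * W z))%:C * (P (z + x) - P z))); [ring|rewrite E; ring].
have [|||||||||e1 e2] := emb_inj emb (l := (D - k) / D) (m := k / D) (n := 0)
    (l' := (D - m1 - m2) / D) (m' := m1 / D) (n' := m2 / D) t t'.
- by rewrite divr_ge0 ?(ltW D0)// /D; clear E E'; lra.
- by rewrite divr_ge0 ?(ltW D0).
- by [].
- by field.
- by rewrite divr_ge0 ?(ltW D0)// /D; clear E E'; lra.
- by rewrite divr_ge0 ?(ltW D0).
- by rewrite divr_ge0 ?(ltW D0).
- by field.
- transitivity ((D / D)%:C * P z + (D^-1)%:C * (k%:C * (P (z + x) - P z))).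
    by rewrite !rmorphM !rmorphB /=; ring.
  by rewrite E' !rmorphM !rmorphB /=; ring.
split; apply: (mulfI (_ : D^-1 != 0)); rewrite ?invr_eq0//.
  transitivity ((D - k) / D * z.1%:~R + k / D * (z + x).1%:~R + 0 * c.1%:~R - D / D * z.1%:~R).
    by rewrite /= rmorphD /=; ring.
  by rewrite e1 /= !rmorphD /=; ring.
transitivity ((D - k) / D * z.2%:~R + k / D * (z + x).2%:~R + 0 * c.2%:~R - D / D * z.2%:~R).
  by rewrite /= rmorphD /=; ring.
by rewrite e2 /= !rmorphD /=; ring.
Qed.

(** Convexity at a diagonal corner comes from the second argument of the maximum in [star_sqr]; at
    an axis corner it is the Delaunay condition for the spoke. The octagon winds only once around
    the origin because the triangles at z do not overlap. *)
Theorem vertex_star : star_ok a b C y.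
Proof.
have /choice[M hM] := quadrant_star.
pose Z (i : 'I_4 * bool) := if i.2 then M i.1 else inv2 (spoke (axis i.1)).
have spk q : [/\ exists c, Tr z (z + axis q) c & dot (spoke (axis q)) (spoke (axis q)) = len q / y (axis q)].
  have [qe _ cs] := quadrant_split z q.
  have ex : exists c, Tr z (z + axis q) c by case: cs => -[t _ _]; eexists; exact: t.
  by split=> //; rewrite lens_spoke0 ?qe.
have dk q : 0 < dot (spoke (axis q)) (spoke (axis q)).
  by have [_ ->] := spk q; rewrite divr_gt0 ?star_factor_gt0 ?axis_sqr_gt0.
have zz i : dot (Z i) (Z i) = star i.
  case: i => q []; rewrite /Z /=; first by have [[]] := hM q.
  rewrite dot_inv2 ?gt_eqF//; have [_ ->] := spk q.
  by rewrite invf_div.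
have dz i : dot (Z i - Z (next_corner i)) (Z i - Z (next_corner i)) = side a b C i ^+ 2.
  by case: i => q []; rewrite /Z /=; have [[]] := hM q.
have cr i : 0 < cross (Z i) (Z (next_corner i)).
  by case: i => q []; rewrite /Z /=; have [_ []] := hM q.
have ha i := arc_arg2 (cr i) (dz i).
split; first split.
- by move=> i; apply: star_sqr_gt0 => // x; exact: star_factor_gt0.
- by move=> i; have [+ _] := ha i; rewrite !zz.
- case=> q [].
    rewrite /turn /next_corner /prev_corner /=.
    have p0 := axis_sqr_gt0 a0 b0 q; have r0 := axis_sqr_gt0 a0 b0 (q + 1).
    have k0 := kappa_gt0 a0 b0 C0 q; have pr := axis_sqrS a b q.
    have s1 : side a b C (q, true) = Num.sqrt (len q) / (Num.sqrt (len (q + 1)) * Num.sqrt (K q)).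
      exact: sqrt_side.
    have s2 : side a b C (q, false) = Num.sqrt (len (q + 1)) / (Num.sqrt (len q) * Num.sqrt (K q)).
      exact: sqrt_side.
    rewrite /star_sqr /= s1 s2 /tang; move: (K q) k0 => k k0 {s1 s2}; rewrite -pr.
    have hp : len q = Num.sqrt (len q) ^+ 2 by rewrite sqr_sqrtr// ltW.
    have hr : len (q + 1) = Num.sqrt (len (q + 1)) ^+ 2 by rewrite sqr_sqrtr// ltW.
    have hK : k = Num.sqrt k ^+ 2 by rewrite sqr_sqrtr// ltW.
    have p1 : 0 < Num.sqrt (len q) by rewrite sqrtr_gt0.
    have r1 : 0 < Num.sqrt (len (q + 1)) by rewrite sqrtr_gt0.
    have K1 : 0 < Num.sqrt k by rewrite sqrtr_gt0.
    have pr0 : 0 < len q + len (q + 1) by rewrite addr_gt0.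
    set m := Num.max _ _.
    have hm : 0 <= m - (k / (len q + len (q + 1)) * (y (axis q) + y (axis (q + 1))) - 1).
      by rewrite subr_ge0 /m le_max lexx orbT.
    move: p1 r1 K1 hp hr hK pr0 hm; clearbody m.
    set sp := Num.sqrt (len q); set sr := Num.sqrt (len (q + 1)); set sK := Num.sqrt k.
    move=> p1 r1 K1 -> -> -> pr0 hm.
    set X := (X in 0 <= X).
    have -> : X = (m - (sK ^+ 2 / (sp ^+ 2 + sr ^+ 2) * (y (axis q) + y (axis (q + 1))) - 1)) *
       ((sp ^+ 2 + sr ^+ 2) / (sp * sr * sK)).
      by rewrite /X; field; rewrite !gt_eqF.
    by rewrite mulr_ge0// divr_ge0 ?(ltW pr0)// !mulr_ge0// ltW.
  rewrite /turn /next_corner /prev_corner /=.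
  have [_ _ _ [c t ->] _] := hM q; have [_ _ _ _ [c']] := hM (q - 1).
  rewrite subrK => t' ->.
  have := emb_Delaunay emb t t'; rewrite (dcosC c' (z + _)) -mulrDr => D.
  by rewrite mulr_ge0// divr_ge0 ?sqrtr_ge0// mulr_ge0// divr_ge0 ?expR_ge0.
have -> : angle_sum next_corner (side a b C) star = \sum_i arg2 (Z i) (Z (next_corner i)).
  by apply: eq_bigr => i _; have [_ <-] := ha i; rewrite !zz.
rewrite sum_corners.
pose D k := Z (iter k next_corner (0, false)).
apply: (@angle_sum_2pi _ 8 D) => // [k _|]; first exact: cr.
case=> // k; rewrite ltnS => /andP[_ k7] s0 /=.
rewrite leNgt; apply/negP => t0.
set i := iter k next_corner (0, false).
have X0 : 0 < cross (D k) (D k.+1) := cr i.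
(* If the octagon passed the direction of [D 0] too early, [D 0] would be a combination of the
   corners k and k + 1 with nonnegative coefficients, the last one positive. By [spoke_inj] the same
   would hold on the lattice, where axis 0 lies in no such sector. *)
have E : (cross (D 0%N) (D k.+1))%:C * D k + (cross (D k) (D 0%N))%:C * D k.+1 = (cross (D k) (D k.+1))%:C * D 0%N.
  rewrite /cross; case: (D 0%N) (D k) (D k.+1) => ? ? [? ?] [? ?].
  by apply/eqP; rewrite eq_complex /=; apply/andP; split; apply/eqP; ring.
have [[c0 tc0] _] := spk 0.
pose ka := cross (D k) (D k.+1) * (dot (spoke (axis 0)) (spoke (axis 0)))^-1.
have ka0 : 0 < ka by rewrite mulr_gt0// invr_gt0.
have E2 : (cross (D k) (D k.+1))%:C * D 0%N = ka%:C * spoke (axis 0).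
  by rewrite /ka /D /Z /= /inv2 rmorphM /=; ring.
(* The last sector does end at [D 0]; it is excluded by k < 7. *)
have i3 : i <> (3%:R, true).
  by rewrite /i; move: k7; case: (k) => [|[|[|[|[|[|[|k']]]]]]] //= _;
    apply/eqP.
rewrite E2 /D iterS -/i in E; move: s0 t0 E => /=; rewrite /D iterS -/i.
case: i i3 => q [] i3 s0 t0 E.
  have [_ _ [_ sec] _ _] := hM q.
  have [x1 [x2 [m1 [m2 [m [n [tx [m10 m20] e1 [e2 e3] [h1 h2 h3]]]]]]]] := sec _ _ s0 (ltW t0).
  have := spoke_inj (ltW ka0) m10 m20 tc0 tx; rewrite -e1 -E => /(_ erefl).
  rewrite e2 e3 => -[f1 f2]; have {}h3 := h3 t0.
  move: f1 f2 i3; case: q {s0 t0 E sec e1 e2 e3} => [[|[|[|[|//]]]] lt] f1 f2 i3.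
  - have e : Ordinal lt + 1 = 1 by apply/val_inj.
    by move: f1 f2; rewrite e /axis /=; clear E2; lra.
  - have e : Ordinal lt + 1 = 2%:R by apply/val_inj.
    by move: f1 f2; rewrite e /axis /=; clear E2; lra.
  - have e : Ordinal lt + 1 = 3%:R by apply/val_inj.
    by move: f1 f2; rewrite e /axis /=; clear E2; lra.
  - by case: i3; congr (_, _); apply/val_inj.
have [_ _ [sec _] _ _] := hM q.
have [x1 [x2 [m1 [m2 [m [n [tx [m10 m20] e1 [e2 e3] [h1 h2 h3]]]]]]]] := sec _ _ s0 (ltW t0).
have := spoke_inj (ltW ka0) m10 m20 tc0 tx; rewrite -e1 -E => /(_ erefl).
rewrite e2 e3 => -[f1 f2]; have [{}h3 h4] := h3 t0.
move: f1 f2; case: q {s0 t0 E sec e1 e2 e3 i3} => [[|[|[|[|//]]]] lt] f1 f2.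
- have e : Ordinal lt + 1 = 1 by apply/val_inj.
  by move: f1 f2; rewrite e /axis /=; clear E2; lra.
- have e : Ordinal lt + 1 = 2%:R by apply/val_inj.
  by move: f1 f2; rewrite e /axis /=; clear E2; lra.
- have e : Ordinal lt + 1 = 3%:R by apply/val_inj.
  by move: f1 f2; rewrite e /axis /=; clear E2; lra.
- have e : Ordinal lt + 1 = 0 by apply/val_inj.
  by move: f1 f2; rewrite e /axis /=; clear E2; lra.
Qed.

End Embedded.

(** * Strips *)

Section Strip.
Context {R : realType} (a b h : R).
Local Notation V := (int * int)%type.
Implicit Types (W : V -> R) (P : V -> R[i]) (Tr : V -> V -> V -> Prop) (x y z e g : V) (k q : R[i]).

Definition cell2 Tr e g z : Prop :=
  (Tr z (z + e) (z + g) /\ Tr (z + e + g) (z + g) (z + e)) \/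
  (Tr z (z + e) (z + e + g) /\ Tr z (z + e + g) (z + g)).

Definition node z e g (m n : nat) : V := z + e *+ m + g *+ n.

(* Four rows of vertices, in directions g, which lie alternately on the two   *)
(* sides of a line and move away from it.                                     *)
Definition strip_config P Tr k q z e g (N : nat) : Prop :=
  let X m n := dot k (P (node z e g m n) - q) in
  [/\ forall m n, (m < 3)%N -> (n < N)%N -> cell2 Tr e g (node z e g m n),
      forall m n, (m < 4)%N -> (n <= N)%N -> 0 < (-1) ^+ m * X m n &
      [/\ X 1%N N < X 1%N 0%N, X 2%N 0%N < X 2%N N, X 2%N 0%N < X 0%N N & X 3%N N < X 1%N 0%N]].

Variables (W : V -> R) (P : V -> R[i]) (Tr : V -> V -> V -> Prop).
Hypothesis emb : embedded a b h W P Tr.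
Variables (q : R[i]).

Let rot := emb_rot emb.

Definition absc k x : R := dot k (P x - q).
Definition ordi k x : R := cross k (P x - q).

(** The ordinate at which the line through the points x and y meets the line [absc = 0]. *)
Definition height k x y : R :=
  (absc k x * ordi k y - absc k y * ordi k x) / (absc k x - absc k y).

Lemma heightC k x y : height k x y = height k y x.
Proof. by rewrite /height -opprB -[_ - absc k y]opprB invrN mulrNN. Qed.

Lemma abscN k x : absc (- k) x = - absc k x.
Proof. by rewrite /absc /dot; case: (k) (P x - q) => ? ? [? ?] /=; ring. Qed.

Lemma ordiN k x : ordi (- k) x = - ordi k x.
Proof. by rewrite /ordi /cross; case: (k) (P x - q) => ? ? [? ?] /=; ring. Qed.

Lemma heightN k x y : height (- k) x y = - height k x y.
Proof.
by rewrite /height !abscN !ordiN !mulrNN -opprD invrN mulrN.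
Qed.

Lemma area_absc k x y z : k != 0 -> Tr x y z ->
  0 < (absc k y - absc k x) * (ordi k z - ordi k x) - (ordi k y - ordi k x) * (absc k z - absc k x).
Proof.
move=> k0 /(emb_area emb) A; have := mulr_gt0 (dot_gt0 k0) A.
congr (0 < _); rewrite /absc /ordi /area /dot /cross.
by case: (k) (P x) (P y) (P z) (q) => ? ? [? ?] [? ?] [? ?] [? ?] /=; ring.
Qed.

Lemma height_right k x y z : k != 0 -> Tr x y z ->
  0 < absc k x -> absc k y < 0 -> 0 < absc k z -> height k z y < height k x y.
Proof.
move=> k0 t; have := area_absc k0 t; rewrite /height.
move: (absc k x) (absc k y) (absc k z) (ordi k x) (ordi k y) (ordi k z) => X1 X2 X3 Y1 Y2 Y3 A h1 h2 h3.
have p1 : 0 < X1 - X2 by lra.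
have p3 : 0 < X3 - X2 by lra.
rewrite -subr_gt0.
have -> : (X1 * Y2 - X2 * Y1) / (X1 - X2) - (X3 * Y2 - X2 * Y3) / (X3 - X2) =
  - X2 * ((X2 - X1) * (Y3 - Y1) - (Y2 - Y1) * (X3 - X1)) / ((X1 - X2) * (X3 - X2)) * -1 * -1.
  by field; rewrite !gt_eqF.
by rewrite !mulrN1 opprK divr_gt0// ?mulr_gt0// oppr_gt0.
Qed.

Lemma height_left k x y z : k != 0 -> Tr x y z ->
  0 < absc k x -> absc k y < 0 -> absc k z < 0 -> height k x z < height k x y.
Proof.
move=> k0 t; have := area_absc k0 t; rewrite /height.
move: (absc k x) (absc k y) (absc k z) (ordi k x) (ordi k y) (ordi k z) => X1 X2 X3 Y1 Y2 Y3 A h1 h2 h3.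
have p1 : 0 < X1 - X2 by lra.
have p3 : 0 < X1 - X3 by lra.
rewrite -subr_gt0.
have -> : (X1 * Y2 - X2 * Y1) / (X1 - X2) - (X1 * Y3 - X3 * Y1) / (X1 - X3) =
  X1 * ((X2 - X1) * (Y3 - Y1) - (Y2 - Y1) * (X3 - X1)) / ((X1 - X2) * (X1 - X3)).
  by field; rewrite !gt_eqF.
by rewrite divr_gt0// mulr_gt0.
Qed.

Definition det2 x y : R := x.1%:~R * y.2%:~R - x.2%:~R * y.1%:~R.

(* The point of height t on the line absc = 0 lies in the triangle x1 x2 x3;  *)
(* det2 (x - z) g is the first coordinate of x - z in a basis (e, g).         *)
Definition crossing k g z (m : nat) (t : R) x1 x2 x3 (l1 l2 l3 : R) : Prop :=
  [/\ [/\ 0 <= l1, 0 <= l2, 0 <= l3 & l1 + l2 + l3 = 1],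
    l1 * absc k x1 + l2 * absc k x2 + l3 * absc k x3 = 0,
    l1 * ordi k x1 + l2 * ordi k x2 + l3 * ordi k x3 = t &
    m%:R < l1 * det2 (x1 - z) g + l2 * det2 (x2 - z) g + l3 * det2 (x3 - z) g < m%:R + 1].

Definition axis_pt k g z m t : Prop := exists x1 x2 x3 l1 l2 l3,
  Tr x1 x2 x3 /\ crossing k g z m t x1 x2 x3 l1 l2 l3.

Lemma convex_itv (u A B c d : R) : 0 <= u -> u <= 1 -> c < A -> A < d -> c < B -> B < d ->
  c < (1 - u) * A + u * B < d.
Proof.
move=> u0 u1 h1 h2 h3 h4; have u2 : 0 <= 1 - u by rewrite subr_ge0.
have [AB|/ltW AB] := leP A B.
  have := mulr_ge0 u0 (_ : 0 <= B - A); have := mulr_ge0 u2 (_ : 0 <= B - A).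
  by rewrite subr_ge0 AB => /(_ isT) k1 /(_ isT) k2; apply/andP; split; lra.
have := mulr_ge0 u0 (_ : 0 <= A - B); have := mulr_ge0 u2 (_ : 0 <= A - B).
by rewrite subr_ge0 AB => /(_ isT) k1 /(_ isT) k2; apply/andP; split; lra.
Qed.

Lemma axis_pt_conv k g z m t t' s x1 x2 x3 l1 l2 l3 l1' l2' l3' : Tr x1 x2 x3 ->
  crossing k g z m t x1 x2 x3 l1 l2 l3 ->
  crossing k g z m t' x1 x2 x3 l1' l2' l3' -> t < t' -> t <= s <= t' ->
  axis_pt k g z m s.
Proof.
move=> T [[p1 p2 p3 p4] p5 p6 /andP[p7 p8]] [[r1 r2 r3 r4] r5 r6 /andP[r7 r8]] tt /andP[s1 s2].
pose u := (s - t) / (t' - t).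
have d0 : 0 < t' - t by rewrite subr_gt0.
have u0 : 0 <= u by rewrite divr_ge0// ?subr_ge0// ltW.
have u1 : u <= 1 by rewrite ler_pdivrMr// mul1r lerD2r.
exists x1, x2, x3, ((1 - u) * l1 + u * l1'), ((1 - u) * l2 + u * l2'), ((1 - u) * l3 + u * l3').
split=> //.
have comb (A B : R) : 0 <= A -> 0 <= B -> 0 <= (1 - u) * A + u * B.
  by move=> *; rewrite addr_ge0// mulr_ge0// subr_ge0.
split; first split; try exact: comb.
- transitivity ((1 - u) * (l1 + l2 + l3) + u * (l1' + l2' + l3')); first by ring.
  by rewrite p4 r4; ring.
- transitivity ((1 - u) * (l1 * absc k x1 + l2 * absc k x2 + l3 * absc k x3) +
    u * (l1' * absc k x1 + l2' * absc k x2 + l3' * absc k x3)); first by ring.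
  by rewrite p5 r5; ring.
- transitivity ((1 - u) * (l1 * ordi k x1 + l2 * ordi k x2 + l3 * ordi k x3) +
    u * (l1' * ordi k x1 + l2' * ordi k x2 + l3' * ordi k x3)); first by ring.
  by rewrite p6 r6 /u; field; rewrite gt_eqF.
have := convex_itv u0 u1 p7 p8 r7 r8; set X := (X in _ < X < _); set Y := (Y in _ -> _ < Y < _).
by have -> : Y = X by rewrite /X /Y; ring.
Qed.

Definition cut k x y : R := absc k x / (absc k x - absc k y).

Lemma edge_crossing k x y : 0 < absc k x -> absc k y < 0 ->
  [/\ 0 < cut k x y < 1, (1 - cut k x y) * absc k x + cut k x y * absc k y = 0 &
   (1 - cut k x y) * ordi k x + cut k x y * ordi k y = height k x y].
Proof.
move=> x0 y0; rewrite /cut /height; have d : 0 < absc k x - absc k y by lra.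
split.
- by rewrite divr_gt0//= ltr_pdivrMr// mul1r; lra.
- by field; rewrite gt_eqF.
- by field; rewrite gt_eqF.
Qed.

Lemma strip_triangle_right k g z m s x1 x2 x3 : k != 0 -> Tr x1 x2 x3 ->
  0 < absc k x1 -> absc k x2 < 0 -> 0 < absc k x3 ->
  det2 (x1 - z) g = m%:R -> det2 (x2 - z) g = m%:R + 1 -> det2 (x3 - z) g = m%:R ->
  height k x3 x2 <= s <= height k x1 x2 -> axis_pt k g z m s.
Proof.
move=> k0 t X1 X2 X3 D1 D2 D3 hs.
have [/andP[c0 c1] cX cY] := edge_crossing X1 X2.
have [/andP[d0 d1] dX dY] := edge_crossing X3 X2.
apply: (@axis_pt_conv k g z m (height k x3 x2) (height k x1 x2) s x1 x2 x3
  0 (cut k x3 x2) (1 - cut k x3 x2) (1 - cut k x1 x2) (cut k x1 x2) 0) => //.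
- split; [split; lra|by rewrite -[RHS]dX; ring|by rewrite -[RHS]dY; ring|].
  by rewrite D1 D2 D3; apply/andP; split; lra.
- split; [split; lra|by rewrite -[RHS]cX; ring|by rewrite -[RHS]cY; ring|].
  by rewrite D1 D2 D3; apply/andP; split; lra.
- exact: height_right.
Qed.

Lemma strip_triangle_left k g z m s x1 x2 x3 : k != 0 -> Tr x1 x2 x3 ->
  0 < absc k x1 -> absc k x2 < 0 -> absc k x3 < 0 ->
  det2 (x1 - z) g = m%:R -> det2 (x2 - z) g = m%:R + 1 -> det2 (x3 - z) g = m%:R + 1 ->
  height k x1 x3 <= s <= height k x1 x2 -> axis_pt k g z m s.
Proof.
move=> k0 t X1 X2 X3 D1 D2 D3 hs.
have [/andP[c0 c1] cX cY] := edge_crossing X1 X2.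
have [/andP[d0 d1] dX dY] := edge_crossing X1 X3.
apply: (@axis_pt_conv k g z m (height k x1 x3) (height k x1 x2) s x1 x2 x3
  (1 - cut k x1 x3) 0 (cut k x1 x3) (1 - cut k x1 x2) (cut k x1 x2) 0) => //.
- split; [split; lra|by rewrite -[RHS]dX; ring|by rewrite -[RHS]dY; ring|].
  by rewrite D1 D2 D3; apply/andP; split; lra.
- split; [split; lra|by rewrite -[RHS]cX; ring|by rewrite -[RHS]cY; ring|].
  by rewrite D1 D2 D3; apply/andP; split; lra.
- exact: height_left.
Qed.

Lemma det2D x y z : det2 (x + y) z = det2 x z + det2 y z.
Proof. by rewrite /det2 /= !rmorphD /=; ring. Qed.

Lemma strip_cell k e g z (z0 : V) m s : k != 0 -> det2 e g = 1 ->
  det2 (z - z0) g = m%:R -> cell2 Tr e g z ->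
  0 < absc k z -> absc k (z + e) < 0 -> 0 < absc k (z + g) -> absc k (z + e + g) < 0 ->
  height k (z + g) (z + e + g) < height k z (z + e) /\
  (height k (z + g) (z + e + g) <= s <= height k z (z + e) -> axis_pt k g z0 m s).
Proof.
move=> k0 eg zm c X1 X2 X3 X4.
have gg : det2 g g = 0 by rewrite /det2; ring.
have D1 : det2 (z + e - z0) g = m%:R + 1 by rewrite addrAC det2D zm eg.
have D2 : det2 (z + g - z0) g = m%:R by rewrite addrAC det2D zm gg addr0.
have D3 : det2 (z + e + g - z0) g = m%:R + 1 by rewrite addrAC det2D D1 gg addr0.
case: c => -[t1 t2].
  have l1 := height_right k0 t1 X1 X2 X3; have t2' := rot t2.
  have l2 := height_left k0 t2' X3 X2 X4.
  split; first exact: lt_trans l1.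
  move=> /andP[s1 s2]; have [ls|ls] := leP s (height k (z + g) (z + e)).
    by apply: (strip_triangle_left k0 t2' X3 X2 X4 D2 D1 D3); rewrite s1 ls.
  by apply: (strip_triangle_right k0 t1 X1 X2 X3 zm D1 D2); rewrite (ltW ls) s2.
have l1 := height_left k0 t1 X1 X2 X4.
have l2 := height_right k0 t2 X1 X4 X3.
split; first exact: lt_trans l1.
move=> /andP[s1 s2]; have [ls|ls] := leP s (height k z (z + e + g)).
  by apply: (strip_triangle_right k0 t2 X1 X4 X3 zm D3 D2); rewrite s1 ls.
by apply: (strip_triangle_left k0 t1 X1 X2 X4 zm D1 D3); rewrite (ltW ls) s2.
Qed.

Lemma eq_point k x1 x2 x3 y1 y2 y3 (l1 l2 l3 r1 r2 r3 : R) : k != 0 ->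
  l1 + l2 + l3 = r1 + r2 + r3 ->
  l1 * absc k x1 + l2 * absc k x2 + l3 * absc k x3 = r1 * absc k y1 + r2 * absc k y2 + r3 * absc k y3 ->
  l1 * ordi k x1 + l2 * ordi k x2 + l3 * ordi k x3 = r1 * ordi k y1 + r2 * ordi k y2 + r3 * ordi k y3 ->
  l1%:C * P x1 + l2%:C * P x2 + l3%:C * P x3 = r1%:C * P y1 + r2%:C * P y2 + r3%:C * P y3.
Proof.
move=> k0 e0 e1 e2; apply/eqP; rewrite -subr_eq0 -dot_eq0; set D := (X in dot X X).
have k1 := dot_gt0 k0.
have f1 : dot k D = 0.
  transitivity ((l1 * absc k x1 + l2 * absc k x2 + l3 * absc k x3) -
    (r1 * absc k y1 + r2 * absc k y2 + r3 * absc k y3) + (l1 + l2 + l3 - (r1 + r2 + r3)) * dot k q).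
    rewrite /D /absc /dot; case: (k) (P x1) (P x2) (P x3) => ? ? [? ?] [? ?] [? ?].
    by case: (P y1) (P y2) (P y3) (q) => ? ? [? ?] [? ?] [? ?] /=; ring.
  by rewrite e0 e1; ring.
have f2 : cross k D = 0.
  transitivity ((l1 * ordi k x1 + l2 * ordi k x2 + l3 * ordi k x3) -
    (r1 * ordi k y1 + r2 * ordi k y2 + r3 * ordi k y3) + (l1 + l2 + l3 - (r1 + r2 + r3)) * cross k q).
    rewrite /D /ordi /cross; case: (k) (P x1) (P x2) (P x3) => ? ? [? ?] [? ?] [? ?].
    by case: (P y1) (P y2) (P y3) (q) => ? ? [? ?] [? ?] [? ?] /=; ring.
  by rewrite e0 e2; ring.
have := dot_cross k D; rewrite f1 f2 expr0n addr0 => /esym /eqP.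
by rewrite mulf_eq0 gt_eqF.
Qed.

(** By injectivity both points have the same lattice coordinates, and the first coordinate in the
    basis (e, g) lies strictly between m and m + 1. *)
Lemma axis_pt_row k g z m m' t : k != 0 -> axis_pt k g z m t ->
  axis_pt k g z m' t -> m = m'.
Proof.
move=> k0 [x1 [x2 [x3 [l1 [l2 [l3 [t1 [[p1 p2 p3 p4] p5 p6 /andP[p7 p8]]]]]]]]].
move=> [y1 [y2 [y3 [r1 [r2 [r3 [t2 [[q1 q2 q3 q4] q5 q6 /andP[q7 q8]]]]]]]]].
have E : l1%:C * P x1 + l2%:C * P x2 + l3%:C * P x3 = r1%:C * P y1 + r2%:C * P y2 + r3%:C * P y3.
  by apply: (eq_point k0) => //; rewrite ?p4 ?p5 ?p6.
have [e1 e2] := emb_inj emb t1 t2 p1 p2 p3 p4 q1 q2 q3 q4 E.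
have : l1 * det2 (x1 - z) g + l2 * det2 (x2 - z) g + l3 * det2 (x3 - z) g =
    r1 * det2 (y1 - z) g + r2 * det2 (y2 - z) g + r3 * det2 (y3 - z) g.
  transitivity ((l1 * x1.1%:~R + l2 * x2.1%:~R + l3 * x3.1%:~R) * g.2%:~R -
     (l1 * x1.2%:~R + l2 * x2.2%:~R + l3 * x3.2%:~R) * g.1%:~R - (l1 + l2 + l3) * det2 z g).
    by rewrite /det2 /= !rmorphB /=; ring.
  by rewrite e1 e2 (etrans p4 (esym q4)) /det2 /= !rmorphB /=; ring.
move=> D; rewrite D in p7 p8; clear E D e1 e2 p5 p6 q5 q6 t1 t2.
move: p7 p8 q7 q8; set S := (_ + _ : R) => p7 p8 q7 q8; clearbody S.
by have [lt|lt|//] := ltngtP m m'; exfalso; move: lt; rewrite -(ler_nat R) -natr1; lra.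
Qed.

Definition edge2 x y : Prop := exists c, Tr x y c \/ Tr y x c.

Lemma edge2C x y : edge2 x y -> edge2 y x.
Proof. by move=> [c [t|t]]; exists c; [right|left]. Qed.

Lemma edge2_inj x y x' y' (l l' : R) : edge2 x y -> edge2 x' y' -> 0 <= l <= 1 -> 0 <= l' <= 1 ->
  (1 - l)%:C * P x + l%:C * P y = (1 - l')%:C * P x' + l'%:C * P y' ->
  (1 - l) * x.1%:~R + l * y.1%:~R = (1 - l') * x'.1%:~R + l' * y'.1%:~R /\
  (1 - l) * x.2%:~R + l * y.2%:~R = (1 - l') * x'.2%:~R + l' * y'.2%:~R.
Proof.
wlog [c t] : x y l / exists c, Tr x y c.
  move=> H [c [t|t]]; first by apply: H; exists c => //; left.
  move=> e' /andP[l0 l1] l01' E; have := H y x (1 - l) (ex_intro _ c t) (ex_intro _ c (or_introl t)) e' _ l01'.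
  rewrite subr_ge0 l1 gerBl l0 (_ : 1 - (1 - l) = l); last by ring.
  move=> /(_ isT) hh; have [|e1 e2] := hh; first by rewrite -E addrC.
  by rewrite -e1 -e2 addrC [X in _ /\ X = _]addrC.
move=> _; wlog [c' t'] : x' y' l' / exists c', Tr x' y' c'.
  move=> H [c' [t'|t']]; first by apply: H; exists c' => //; left.
  move=> l01 /andP[l0 l1] E; have := H y' x' (1 - l') (ex_intro _ c' t') (ex_intro _ c' (or_introl t')) l01.
  rewrite subr_ge0 l1 gerBl l0 (_ : 1 - (1 - l') = l'); last by ring.
  move=> /(_ isT) hh; have [|e1 e2] := hh; first by rewrite E addrC.
  by rewrite e1 e2 addrC [X in _ /\ _ = X]addrC.
move=> _ /andP[l0 l1] /andP[l0' l1'] E.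
have := @emb_inj _ _ _ _ _ _ _ emb x y c x' y' c' (1 - l) l 0 (1 - l') l' 0 t t'.
rewrite !mul0r !addr0 !subr_ge0 !subrK; apply=> //.
Qed.

(** [f] is the ordinate of the edge yy' at the abscissa of x. The difference of the ordinates of the
    two edges does not keep a strict sign between the abscissas of x and 0, so they cross, although
    their second coordinates in the basis are 0 and N. *)
Lemma edges_cross k e z x x1 y y' (N : R) : k != 0 -> edge2 x x1 -> edge2 y y' ->
  det2 e (x - z) = 0 -> det2 e (x1 - z) = 0 ->
  det2 e (y - z) = N -> det2 e (y' - z) = N -> N != 0 ->
  absc k x < 0 -> 0 < absc k x1 -> absc k y < absc k x -> 0 < absc k y' ->
  let f := (ordi k y * (absc k y' - absc k x) + ordi k y' * (absc k x - absc k y)) / (absc k y' - absc k y) in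
  height k y' y - height k x1 x != 0 ->
  (height k y' y - height k x1 x) * (f - ordi k x) <= 0 -> False.
Proof.
move=> k0 E1 E2 G1 G2 G3 G4 N0 X1 X2 X3 X4 f.
have [/andP[_ _] _ cY] := edge_crossing X2 X1.
have Y0 : absc k y < 0 by apply: lt_trans X1.
have [/andP[_ _] _ dY] := edge_crossing X4 Y0.
set d0 := _ - _ => d0n le.
pose d1 := f - ordi k x.
have dd : d0 - d1 != 0.
  apply: contraNN d0n => /eqP e0; have e1 : f - ordi k x = d0 by rewrite -/d1; lra.
  by move: le; rewrite e1 -expr2 le_eqVlt ltNge sqr_ge0 orbF sqrf_eq0.
pose t := d0 / (d0 - d1).
have t01 : 0 <= t <= 1.
  rewrite /t; move: le; rewrite -/d1 => le; clear -le dd.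
  have [lt|gt|/eqP] := ltgtP 0 (d0 - d1); last by rewrite eq_sym (negPf dd).
    by rewrite ler_pdivlMr// ler_pdivrMr// mul0r mul1r; apply/andP; split; nra.
  by rewrite ler_ndivlMr// ler_ndivrMr// mul0r mul1r; apply/andP; split; nra.
have [t0 t1] := andP t01.
pose s := t * absc k x.
have x10 : 0 < absc k x1 - absc k x by lra.
have y10 : 0 < absc k y' - absc k y by lra.
have s0 : s <= 0 by rewrite /s; nra.
have s1 : absc k x <= s by rewrite /s; nra.
pose lx := (s - absc k x) / (absc k x1 - absc k x).
pose ly := (s - absc k y) / (absc k y' - absc k y).
have lx01 : 0 <= lx <= 1.
  by rewrite /lx ler_pdivlMr// ler_pdivrMr// mul0r mul1r; apply/andP; split; lra.
have ly01 : 0 <= ly <= 1.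
  by rewrite /ly ler_pdivlMr// ler_pdivrMr// mul0r mul1r; apply/andP; split; lra.
have E : (1 - lx)%:C * P x + lx%:C * P x1 + 0%:C * P x = (1 - ly)%:C * P y + ly%:C * P y' + 0%:C * P x.
  apply: (eq_point k0); first by rewrite !subrK.
    by rewrite /lx /ly; field; rewrite !gt_eqF.
  rewrite !mul0r !addr0.
  have -> : (1 - lx) * ordi k x + lx * ordi k x1 =
      t * ordi k x + (1 - t) * height k x1 x.
    by rewrite /lx /s /height; field; rewrite gt_eqF.
  have -> : (1 - ly) * ordi k y + ly * ordi k y' = t * f + (1 - t) * height k y' y.
    by rewrite /ly /s /f /height; field; rewrite ?gt_eqF//.
  have : t * (d0 - d1) = d0 by rewrite /t divfK.
  by rewrite /d0 /d1; lra.
have [|e1 e2] := edge2_inj E1 E2 lx01 ly01.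
  by move: E; rewrite !mul0r !addr0.
have : (1 - lx) * det2 e (x - z) + lx * det2 e (x1 - z) = (1 - ly) * det2 e (y - z) + ly * det2 e (y' - z).
  transitivity (e.1%:~R * ((1 - lx) * x.2%:~R + lx * x1.2%:~R) - e.2%:~R * ((1 - lx) * x.1%:~R + lx * x1.1%:~R) - det2 e z).
    by rewrite /det2 /= !rmorphB /=; ring.
  by rewrite e1 e2 /det2 /= !rmorphB /=; ring.
by rewrite G1 G2 G3 G4 => H; apply/negP: N0; rewrite negbK; apply/eqP; lra.
Qed.

(** The edges from x to x1 and x2 form a wedge with apex x. The edge yy' meets the line [absc = 0]
    inside the wedge and starts farther left than x; passing above or below x, it must cross a side
    of the wedge. *)
Lemma wedge_trap k e z x x1 x2 y y' (N : R) : k != 0 ->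
  edge2 x x1 -> edge2 x x2 -> edge2 y y' ->
  [/\ det2 e (x - z) = 0, det2 e (x1 - z) = 0 & det2 e (x2 - z) = 0] ->
  [/\ det2 e (y - z) = N, det2 e (y' - z) = N & N != 0] ->
  [/\ absc k x < 0, 0 < absc k x1, 0 < absc k x2, absc k y < absc k x & 0 < absc k y'] ->
  height k x2 x < height k y' y -> height k y' y < height k x1 x -> False.
Proof.
move=> k0 E1 E2 E3 [d d1 d2] [d3 d4 N0] [X X1 X2 Y Y1] l1 l2.
have [le|le] := leP ((ordi k y * (absc k y' - absc k x) + ordi k y' * (absc k x - absc k y)) / (absc k y' - absc k y)) (ordi k x).
  apply: (edges_cross k0 E2 E3 d d2 d3 d4 N0 X X2 Y Y1).
    by rewrite subr_eq0 gt_eqF.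
  by rewrite mulr_ge0_le0 ?subr_le0// subr_ge0 ltW.
apply: (edges_cross k0 E1 E3 d d1 d3 d4 N0 X X1 Y Y1).
  by rewrite subr_eq0 lt_eqF.
by rewrite mulr_le0_ge0 ?subr_ge0 ?(ltW le)// subr_le0 ltW.
Qed.

Lemma nodeS z e g m n : node z e g m.+1 n = node z e g m n + e.
Proof. by rewrite /node mulrS addrA [z + e]addrC -!addrA addrC -!addrA. Qed.

Lemma nodeSr z e g m n : node z e g m n.+1 = node z e g m n + g.
Proof. by rewrite /node mulrSr !addrA. Qed.

Lemma det2_nodel z e g m n : det2 e g = 1 -> det2 (node z e g m n - z) g = m%:R.
Proof.
move=> eg; have -> : node z e g m n - z = e *+ m + g *+ n by rewrite /node -[z + _ + _]addrA addrAC subrr add0r.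
rewrite det2D; have dn x (k : nat) : det2 (x *+ k) g = k%:R * det2 x g.
  elim: k => [|k IH]; first by rewrite /det2 /= mul0r; ring.
  by rewrite mulrS det2D IH -natr1; ring.
by rewrite !dn eg /det2; ring.
Qed.

Lemma det2_noder z e g m n : det2 e g = 1 -> det2 e (node z e g m n - z) = n%:R.
Proof.
move=> eg; have -> : node z e g m n - z = e *+ m + g *+ n by rewrite /node -[z + _ + _]addrA addrAC subrr add0r.
have anti x y : det2 x y = - det2 y x by rewrite /det2; ring.
rewrite anti det2D; have dn x (k : nat) : det2 (x *+ k) e = k%:R * det2 x e.
  elim: k => [|k IH]; first by rewrite /det2 /= mul0r; ring.
  by rewrite mulrS det2D IH -natr1; ring.
by rewrite !dn [det2 g e]anti eg /det2; ring.
Qed.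

(** Successive cells between the two rows meet the line in adjacent intervals, which go down as n
    grows. *)
Lemma strip_row k e g z m N : k != 0 -> det2 e g = 1 -> (0 < N)%N ->
  (forall n, (n < N)%N -> cell2 Tr e g (node z e g m n)) ->
  (forall n, (n <= N)%N -> 0 < absc k (node z e g m n) /\ absc k (node z e g m.+1 n) < 0) ->
  height k (node z e g m N) (node z e g m.+1 N) < height k (node z e g m 0) (node z e g m.+1 0) /\
  forall s, height k (node z e g m N) (node z e g m.+1 N) <= s <= height k (node z e g m 0) (node z e g m.+1 0) ->
    axis_pt k g z m s.
Proof.
move=> k0 eg; case: N => // N _; elim: N => [|N IH] cl X.
  have [X1 X2] := X 0%N isT; have [X3 X4] := X 1%N isT.
  move: X3 X4; rewrite !nodeSr !nodeS => X3 X4.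
  rewrite nodeS in X2; have S s := strip_cell s k0 eg (det2_nodel z m 0 eg) (cl 0%N isT) X1 X2 X3 X4.
  by split=> [|s]; [have [] := S 0|have [] := S s].
have [n lt|n le|h1 h2] := IH; [exact: cl (ltnW lt)|exact: X (leqW le)|].
have [X1 X2] := X N.+1 (leqnSn _); have [X3 X4] := X N.+2 (leqnn _).
move: X3 X4 X2; rewrite ![node _ _ _ _ N.+2]nodeSr !nodeS => X3 X4 X2.
have S s := strip_cell s k0 eg (det2_nodel z m N.+1 eg) (cl N.+1 (leqnn _)) X1 X2 X3 X4.
move: h1 h2; rewrite !nodeS => h1 h2.
have [h3 _] := S 0; split; first exact: lt_trans h1.
move=> s /andP[s1 s2]; have [ls|ls] := leP s (height k (node z e g m N.+1) (node z e g m N.+1 + e)).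
  by have [_] := S s; apply; rewrite s1 ls.
by apply: h2; rewrite (ltW ls).
Qed.

Lemma axis_ptN k g z m t : axis_pt (- k) g z m t -> axis_pt k g z m (- t).
Proof.
move=> [x1 [x2 [x3 [l1 [l2 [l3 [T [p5 p6 p7 p8]]]]]]]]; exists x1, x2, x3, l1, l2, l3.
split=> //; split=> //.
  by move: p6; rewrite !abscN => E; apply: oppr_inj; rewrite oppr0 -[RHS]E; ring.
by rewrite -p7 !ordiN; ring.
Qed.

(** The three strips between consecutive rows meet the line in pairwise disjoint intervals,
    traversed downwards, upwards and downwards. Each order of these intervals puts the last edge of
    some strip into a wedge of two first edges, and the inequalities of [strip_config] let
    [wedge_trap] apply. *)
Lemma no_strip k e g z N : k != 0 -> det2 e g = 1 -> strip_config P Tr k q z e g N -> False.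
Proof.
move=> k0 eg [cl X [i1 i2 i3 i4]].
have N0 : (0 < N)%N by case: N i1 {cl X i2 i3 i4} => //; rewrite ltxx.
have kN0 : - k != 0 by rewrite oppr_eq0.
have nN : N%:R != 0 :> R by rewrite pnatr_eq0 -lt0n.
pose Z := node z e g.
have X0 n : (n <= N)%N -> 0 < absc k (Z 0%N n) by move=> /(X 0%N n isT); rewrite expr0 mul1r.
have X1 n : (n <= N)%N -> absc k (Z 1%N n) < 0 by move=> /(X 1%N n isT); rewrite expr1 mulN1r oppr_gt0.
have X2 n : (n <= N)%N -> 0 < absc k (Z 2%N n) by move=> /(X 2%N n isT); rewrite sqrrN expr1n mul1r.
have X3 n : (n <= N)%N -> absc k (Z 3%N n) < 0.
  by move=> /(X 3%N n isT); rewrite exprS sqrrN expr1n mulr1 mulN1r oppr_gt0.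
have bot m : (m < 3)%N -> edge2 (Z m 0%N) (Z m.+1 0%N).
  move=> m3; rewrite /Z nodeS; case: (cl m 0%N m3 N0) => -[t _]; eexists; left; exact: t.
have top m : (m < 3)%N -> edge2 (Z m N) (Z m.+1 N).
  move=> m3; have lt : (N.-1 < N)%N by rewrite prednK.
  rewrite /Z -[N]prednK// !nodeSr nodeS.
  case: (cl m _ m3 lt) => -[_ t]; [exists (node z e g m N.-1 + e)|exists (node z e g m N.-1)]; right.
    by rewrite addrAC in t *.
  by rewrite addrAC; apply: rot; rewrite addrAC in t *.
have D0 m : det2 e (Z m 0%N - z) = 0 by rewrite det2_noder.
have DN m : det2 e (Z m N - z) = N%:R by rewrite det2_noder.
pose h0 n := height k (Z 0%N n) (Z 1%N n); pose h1 n := height k (Z 2%N n) (Z 1%N n).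
pose h2 n := height k (Z 2%N n) (Z 3%N n).
have nh0 n : height (- k) (Z 1%N n) (Z 0%N n) = - h0 n by rewrite heightN heightC.
have nh1 n : height (- k) (Z 1%N n) (Z 2%N n) = - h1 n by rewrite heightN heightC.
have nh2 n : height (- k) (Z 3%N n) (Z 2%N n) = - h2 n by rewrite heightN heightC.
have [a0 A0] : h0 N < h0 0%N /\ forall s, h0 N <= s <= h0 0%N -> axis_pt k g z 0 s.
  by apply: strip_row => //; [move=> n; exact: cl|move=> n le; split; [exact: X0|exact: X1]].
have [a2 A2] : h2 N < h2 0%N /\ forall s, h2 N <= s <= h2 0%N -> axis_pt k g z 2 s.
  by apply: strip_row => //; [move=> n; exact: cl|move=> n le; split; [exact: X2|exact: X3]].
have [a1 A1] : h1 0%N < h1 N /\ forall s, h1 0%N <= s <= h1 N -> axis_pt k g z 1 s.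
  have [|n le|] := @strip_row (- k) e g z 1 N kN0 eg N0; first by move=> n; exact: cl.
    by rewrite !abscN oppr_gt0 oppr_lt0; split; [exact: X1|exact: X2].
  rewrite -/(Z 1%N _) -/(Z 2%N _) !nh1 ltrN2 => l A; split=> // s /andP[s1 s2].
  by rewrite -[s]opprK; apply/axis_ptN/A; rewrite !lerN2 s1 s2.
have sep m m' (c d c' d' : R) : m <> m' -> c < d -> c' < d' ->
    (forall s, c <= s <= d -> axis_pt k g z m s) ->
    (forall s, c' <= s <= d' -> axis_pt k g z m' s) -> d < c' \/ d' < c.
  move=> ne cd cd' H H'; have [lt|le1] := ltP d c'; first by left.
  have [lt|le2] := ltP d' c; first by right.
  exfalso; apply: ne; apply: (@axis_pt_row k g z m m' (Num.max c c')) => //.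
    by apply: H; rewrite le_max lexx ge_max le1 (ltW cd).
  by apply: H'; rewrite le_max lexx orbT ge_max le2 (ltW cd').
have L := leq0n N; have LN := leqnn N.
have I01 : h0 0%N < h1 0%N.
  have [//|lt] := sep 0%N 1%N _ _ _ _ (fun E => O_S _ E) a0 a1 A0 A1.
  exfalso; apply: (wedge_trap k0 (edge2C (bot 0%N isT)) (bot 1%N isT) (edge2C (top 0%N isT)) _ _ _ _ _) => //.
  - by split; [exact: X1|exact: X0|exact: X2|exact: i1|exact: X0].
  - exact: lt_trans lt.
have I21 : h2 0%N < h1 0%N.
  have [lt|//] := sep 1%N 2%N _ _ _ _ (fun E => O_S _ (eq_add_S _ _ E)) a1 a2 A1 A2.
  exfalso; apply: (wedge_trap kN0 (edge2C (bot 1%N isT)) (bot 2%N isT) (edge2C (top 1%N isT)) _ _ _ _ _) => //.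
  - rewrite !abscN !oppr_gt0 !oppr_lt0 ltrN2; split; [exact: X2|exact: X1|exact: X3|exact: i2|exact: X1].
  - rewrite nh1 nh2 ltrN2; exact: lt_trans a2.
  - by rewrite !nh1 ltrN2.
(* Both outer strips are now below the middle one; the last edge of the upper of the two is
   trapped. *)
have [lt|lt] := sep 0%N 2%N _ _ _ _ (fun E => O_S _ E) a0 a2 A0 A2.
  apply: (wedge_trap k0 (bot 1%N isT) (edge2C (bot 0%N isT)) (edge2C (top 2%N isT)) _ _ _ _ _) => //.
  - by split; [exact: X1|exact: X2|exact: X0|exact: i4|exact: X2].
  - exact: lt_trans I21.
apply: (wedge_trap kN0 (bot 2%N isT) (edge2C (bot 1%N isT)) (top 0%N isT) _ _ _ _ _) => //.
- rewrite !abscN !oppr_gt0 !oppr_lt0 ltrN2; split; [exact: X2|exact: X3|exact: X1|exact: i3|exact: X1].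
- rewrite nh0 nh1 ltrN2; exact: lt_trans I01.
- by rewrite nh0 nh2 ltrN2.
Qed.

End Strip.

(** * Limits of translates *)

Section Limits.
Context {R : realType} {I : Type} (F : set_system I) {FF : ProperFilter F}.
Implicit Types (f g : I -> R) (c d : I -> R[i]) (u v : R[i]).

Lemma cvg_ge0 f (l : R) : f i @[i --> F] --> l -> (\forall i \near F, 0 <= f i) -> 0 <= l.
Proof.
move=> fl f0; rewrite leNgt; apply/negP => l0.
have [i [] + /= +] := filter_ex (filterI f0 (cvgr_lt _ fl _ l0)).
by move=> /= h1 h2; have := le_lt_trans h1 h2; rewrite ltxx.
Qed.

Lemma near_gt0 f (l : R) : f i @[i --> F] --> l -> 0 < l -> \forall i \near F, 0 < f i.
Proof. by move=> fl l0; exact: (cvgr_gt _ fl). Qed.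

Lemma near_lt f g (l l' : R) : f i @[i --> F] --> l -> g i @[i --> F] --> l' -> l < l' ->
  \forall i \near F, f i < g i.
Proof.
move=> fl gl ll; have lg : 0 < l' - l by rewrite subr_gt0.
by apply: filterS (near_gt0 (cvgB gl fl) lg) => i /=; rewrite subr_gt0.
Qed.

Lemma cvg_eq0 f (l : R) : f i @[i --> F] --> l -> (\forall i \near F, f i = 0) -> l = 0.
Proof.
move=> fl f0; apply/le_anti/andP; split.
  rewrite -oppr_ge0; apply: (cvg_ge0 (f := fun i => - f i)); first exact: cvgN.
  by apply: filterS f0 => i ->; rewrite oppr0.
by apply: (cvg_ge0 fl); apply: filterS f0 => i ->.
Qed.

Definition cvgC c u : Prop :=
  complex.Re (c i) @[i --> F] --> complex.Re u /\ complex.Im (c i) @[i --> F] --> complex.Im u.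

Lemma cvgCB c d u v : cvgC c u -> cvgC d v -> cvgC (fun i => c i - d i) (u - v).
Proof.
move=> [c1 c2] [d1 d2]; split.
  have -> : (fun i => complex.Re (c i - d i)) = (fun i => complex.Re (c i) - complex.Re (d i)).
    by apply/funext => i; case: (c i) (d i) => ? ? [].
  by rewrite (_ : complex.Re (u - v) = complex.Re u - complex.Re v); [exact: cvgB|case: (u) (v) => ? ? []].
have -> : (fun i => complex.Im (c i - d i)) = (fun i => complex.Im (c i) - complex.Im (d i)).
  by apply/funext => i; case: (c i) (d i) => ? ? [].
by rewrite (_ : complex.Im (u - v) = complex.Im u - complex.Im v); [exact: cvgB|case: (u) (v) => ? ? []].
Qed.

Lemma cvg_dot c d u v : cvgC c u -> cvgC d v -> dot (c i) (d i) @[i --> F] --> dot u v.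
Proof. by move=> [c1 c2] [d1 d2]; apply: cvgD; apply: cvgM. Qed.

Lemma cvg_cross c d u v : cvgC c u -> cvgC d v -> cross (c i) (d i) @[i --> F] --> cross u v.
Proof. by move=> [c1 c2] [d1 d2]; apply: cvgB; apply: cvgM. Qed.

Lemma cvgC_cst u : cvgC (fun=> u) u.
Proof. by split; apply: cvg_cst. Qed.

Lemma cvg_area c1 c2 c3 u1 u2 u3 : cvgC c1 u1 -> cvgC c2 u2 -> cvgC c3 u3 ->
  area (c1 i) (c2 i) (c3 i) @[i --> F] --> area u1 u2 u3.
Proof. by move=> h1 h2 h3; apply: cvg_cross; apply: cvgCB. Qed.

Lemma cvg_expR f (l : R) : f i @[i --> F] --> l -> expR (f i) @[i --> F] --> expR l.
Proof. by move=> fl A /(@continuous_expR R l) /fl. Qed.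

Lemma near_ltn (N : nat) (A : nat -> I -> Prop) :
  (forall n, (n < N)%N -> \forall i \near F, A n i) ->
  \forall i \near F, forall n, (n < N)%N -> A n i.
Proof.
elim: N => [|N IH] h; first by apply: filterE => i n; rewrite ltn0.
have h1 := IH (fun n nN => h n (ltnW nN)); have h2 := h N (leqnn _).
apply: filterS2 h1 h2 => i a1 a2 n; rewrite ltnS leq_eqVlt => /predU1P[->//|]; exact: a1.
Qed.

End Limits.

(** Compactness of an interval. No subsequence is extracted, so one ultrafilter serves all
    coordinates at once. *)
Lemma ultra_bounded_cvg {R : realType} (I : Type) (F : set_system I) (f : I -> R) (M : R) :
  UltraFilter F -> (forall i, `|f i| <= M) -> exists l : R, f i @[i --> F] --> l.
Proof.
move=> FU fM.
have K := @segment_compact R (- M) M.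
have FM : F (f @^-1` `[- M, M]%classic).
  by apply: filterE => i; have := fM i; rewrite ler_norml /= in_itv.
have [l [_ cl]] := K (f @ F) (fmap_proper_filter f (ultra_proper (UltraFilter := FU))) FM.
exists l => B nB; have [//|nA] := in_ultra_setVsetC (f @^-1` B) FU.
by have [x [+ Bx]] := cl (~` B) B nA nB.
Qed.

(** * Properties that pass to limits of translates *)

Section Admissible.
Context {R : realType} (a b h : R).
Local Notation V := (int * int)%type.
Local Notation C := (a + b - 2 * h).
Hypotheses (a0 : 0 < a) (b0 : 0 < b) (C0 : 0 < C).
Implicit Types (W : V -> R) (P : V -> R[i]) (Tr : V -> V -> V -> Prop) (x y z e g : V).

(* Six times the area of P x, P y and the centroid of P p, P q, P r. *)
Definition sum_area P x y p q r : R :=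
  area (P x) (P y) (P p) + area (P x) (P y) (P q) + area (P x) (P y) (P r).

(* The properties of an embedded system which survive in the limit of its     *)
(* normalised translates.                                                     *)
Record admissible W P Tr : Prop := Admissible {
  adm_rot : forall x y z, Tr x y z -> Tr y z x;
  adm_lens : lens a b h W P Tr;
  adm_area : forall x y z, Tr x y z -> 0 <= area (P x) (P y) (P z);
  adm_cells : cells h Tr;
  adm_flip : h = 0 -> forall z,
    let y := star_factor W z in
    (Tr z (z + (1, 0)) (z + (0, 1)) -> Tr (z + (1, 1)) (z + (0, 1)) (z + (1, 0)) ->
      1 + y (1, 1) <= y (1, 0) + y (0, 1)) /\
    (Tr z (z + (1, 0)) (z + (1, 1)) -> Tr z (z + (1, 1)) (z + (0, 1)) ->
      y (1, 0) + y (0, 1) <= 1 + y (1, 1));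
  adm_star : forall z, star_ok a b C (star_factor W z);
  adm_overlap : forall x y z (k : V), k != 0 -> det2 (R := R) (y - x) (z - x) = 1 ->
    Tr x y z -> Tr (x + k) (y + k) (z + k) ->
    ~ [/\ 0 < sum_area P x y (x + k) (y + k) (z + k),
          0 < sum_area P y z (x + k) (y + k) (z + k) &
          0 < sum_area P z x (x + k) (y + k) (z + k)];
  adm_strip : forall (k q : R[i]) z e g (N : nat), k != 0 -> det2 (R := R) e g = 1 ->
    ~ strip_config P Tr k q z e g N }.

Lemma embedded_flip W P Tr (emb : embedded a b h W P Tr) : h = 0 -> forall z,
    let y := star_factor W z in
    (Tr z (z + (1, 0)) (z + (0, 1)) -> Tr (z + (1, 1)) (z + (0, 1)) (z + (1, 0)) ->
      1 + y (1, 1) <= y (1, 0) + y (0, 1)) /\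
    (Tr z (z + (1, 0)) (z + (1, 1)) -> Tr z (z + (1, 1)) (z + (0, 1)) ->
      y (1, 0) + y (0, 1) <= 1 + y (1, 1)).
Proof.
move=> h0 z y; have rot := emb_rot emb; have ab : 0 < a + b by rewrite addr_gt0.
have q x x' v r : x' - x = v -> qform a b h v = r -> qform a b h (x - x') = r /\ qform a b h (x' - x) = r.
  by move=> <- <-; rewrite qformB.
have d1 v : z + v - z = v by rewrite addrC addKr.
have d2 : z + (1, 1) - (z + (1, 0)) = (0, 1) by apply: pair_ext => /=; ring.
have d3 : z + (1, 1) - (z + (0, 1)) = (1, 0) by apply: pair_ext => /=; ring.
have d4 : z + (0, 1) - (z + (1, 0)) = (-1, 1) by apply: pair_ext => /=; ring.
have f1 : qform a b h (1, 0) = a by rewrite /qform /=; ring.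
have f2 : qform a b h (0, 1) = b by rewrite /qform /=; ring.
have f3 : qform a b h (1, 1) = a + b by rewrite /qform /= h0; ring.
have f4 : qform a b h (-1, 1) = (a + b) ^+ 2 / (a + b) by rewrite /qform /= h0; field; rewrite gt_eqF.
have [q1 q1'] := q _ _ _ _ (d1 (1, 0)) f1; have [q2 q2'] := q _ _ _ _ (d1 (0, 1)) f2.
have [q3 q3'] := q _ _ _ _ (d1 (1, 1)) f3; have [q4 q4'] := q _ _ _ _ d2 f2.
have [q5 q5'] := q _ _ _ _ d3 f1; have [q6 q6'] := q _ _ _ _ d4 f4.
rewrite /y !star_factorE; split=> t1 t2.
  have D := emb_Delaunay emb (rot _ _ _ t1) (rot _ _ _ t2); move: D.
  rewrite /dcos q1 q2 q6 q5' q4' => D.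
  have := far_Delaunay a0 b0 ab (expR_gt0 _) (expR_gt0 _) (expR_gt0 _) (expR_gt0 _) D.
  by rewrite divff ?gt_eqF// mul1r; lra.
have D := emb_Delaunay emb t2 (rot _ _ _ (rot _ _ _ t1)); move: D.
rewrite addrC /dcos q1' q4 q3 q2' q5 => D.
have := near_Delaunay a0 b0 ab (expR_gt0 _) (expR_gt0 _) (expR_gt0 _) (expR_gt0 _) D.
by rewrite divff ?gt_eqF// mul1r; lra.
Qed.

Lemma int_third (i : int) (r : R) : i%:~R = r - 3^-1 -> 0 < r -> r < 1 -> r = 3^-1.
Proof.
move=> ir r0 r1; suff i0 : i = 0 by move: ir; rewrite i0 mulr0z; lra.
have : ((-1)%:~R : R) < i%:~R /\ (i%:~R : R) < 1%:~R by rewrite ir; split; lra.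
by rewrite !ltr_int => -[]; lia.
Qed.

(** The positive sums put the centroid of the translated triangle inside the triangle xyz. By
    injectivity, k = (m - 1/3)(y - x) + (n - 1/3)(z - x); the unit determinant makes the
    coefficients integers, and they lie in (-1/3, 2/3), so they vanish. *)
Lemma embedded_overlap W P Tr (emb : embedded a b h W P Tr) x y z (k : V) :
  k != 0 -> det2 (R := R) (y - x) (z - x) = 1 ->
  Tr x y z -> Tr (x + k) (y + k) (z + k) ->
  ~ [/\ 0 < sum_area P x y (x + k) (y + k) (z + k),
        0 < sum_area P y z (x + k) (y + k) (z + k) &
        0 < sum_area P z x (x + k) (y + k) (z + k)].
Proof.
move=> k0 D t t' [s1 s2 s3].
have A0 := emb_area emb t.
set G := (3^-1)%:C * P (x + k) + (3^-1)%:C * P (y + k) + (3^-1)%:C * P (z + k).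
have gE p q : area (P p) (P q) G = 3^-1 * sum_area P p q (x + k) (y + k) (z + k).
  rewrite /sum_area /G /area /cross; case: (P p) (P q) (P (x + k)) (P (y + k)) (P (z + k)).
  by move=> ? ? [? ?] [? ?] [? ?] [? ?] /=; field.
have An : area (P x) (P y) (P z) != 0 by rewrite gt_eqF.
have E := area_bary G An.
rewrite [area G _ _]areaC [area _ G _]areaC [area G _ _]areaC !gE in E.
set A := area (P x) (P y) (P z) in A0 An E.
set l := (_ / A) in E; set m := (_ / A) in E; set n := (_ / A) in E.
have l0 : 0 < l by rewrite divr_gt0// mulr_gt0// invr_gt0.
have m0 : 0 < m by rewrite divr_gt0// mulr_gt0// invr_gt0.
have n0 : 0 < n by rewrite divr_gt0// mulr_gt0// invr_gt0.
have s : l + m + n = 1.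
  have := area_sum (P x) (P y) (P z) G; rewrite [area G _ _]areaC [area _ G _]areaC [area G _ _]areaC !gE.
  by move=> e; rewrite /l /m /n -!mulrDl e divff.
have t0 : 0 <= 3^-1 :> R by rewrite invr_ge0.
have [|e1 e2] := emb_inj emb t t' (ltW l0) (ltW m0) (ltW n0) s t0 t0 t0 _ (esym E); first by field.
move: e1 e2; rewrite /= !rmorphD /= => e1 e2; clear E.
have D' : (y.1%:~R - x.1%:~R) * (z.2%:~R - x.2%:~R) - (y.2%:~R - x.2%:~R) * (z.1%:~R - x.1%:~R) = 1 :> R.
  by rewrite -[RHS]D /det2 /= !rmorphB.
have ls : l = 1 - m - n by lra.
have k1 : k.1%:~R = (m - 3^-1) * (y.1%:~R - x.1%:~R) + (n - 3^-1) * (z.1%:~R - x.1%:~R) :> R.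
  by rewrite ls in e1; lra.
have k2 : k.2%:~R = (m - 3^-1) * (y.2%:~R - x.2%:~R) + (n - 3^-1) * (z.2%:~R - x.2%:~R) :> R.
  by rewrite ls in e2; lra.
have mE : m = 3^-1.
  apply: (int_third (i := k.1 * (z.2 - x.2) - k.2 * (z.1 - x.1))) => //; last by lra.
  rewrite !rmorphB /= !rmorphM !rmorphB /= k1 k2.
  transitivity ((m - 3^-1) * ((y.1%:~R - x.1%:~R) * (z.2%:~R - x.2%:~R) - (y.2%:~R - x.2%:~R) * (z.1%:~R - x.1%:~R))); first by ring.
  by rewrite D' mulr1.
have nE : n = 3^-1.
  apply: (int_third (i := (y.1 - x.1) * k.2 - (y.2 - x.2) * k.1)) => //; last by lra.
  rewrite !rmorphB /= !rmorphM !rmorphB /= k1 k2.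
  transitivity ((n - 3^-1) * ((y.1%:~R - x.1%:~R) * (z.2%:~R - x.2%:~R) - (y.2%:~R - x.2%:~R) * (z.1%:~R - x.1%:~R))); first by ring.
  by rewrite D' mulr1.
move: k1 k2; rewrite mE nE subrr !mul0r addr0 => /eqP + /eqP; rewrite !intr_eq0 => /eqP h1 /eqP h2.
by move/eqP: k0; apply; apply: pair_ext.
Qed.

Lemma embedded_admissible W P Tr : embedded a b h W P Tr -> admissible W P Tr.
Proof.
move=> emb; split.
- exact: emb_rot emb.
- exact: emb_lens emb.
- by move=> x y z /(emb_area emb)/ltW.
- exact: emb_cells emb.
- exact: embedded_flip emb.
- move=> z; exact: (vertex_star a0 b0 C0 emb).
- exact: embedded_overlap emb.
- by move=> k q z e g N k0 eg; exact: (no_strip emb k0 eg).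
Qed.

Definition shiftW W x y : R := W (x + y) - W x.
Definition shiftP W P x y : R[i] := (expR (- 2 * W x))%:C * (P (x + y) - P x).
Definition shiftT Tr v x y z : Prop := Tr (v + x) (v + y) (v + z).

Lemma shift_area W P v x y z :
  area (shiftP W P v x) (shiftP W P v y) (shiftP W P v z) =
  expR (- 2 * W v) ^+ 2 * area (P (v + x)) (P (v + y)) (P (v + z)).
Proof.
rewrite /shiftP /area /cross; case: (P v) (P (v + x)) (P (v + y)) (P (v + z)).
by move=> ? ? [? ?] [? ?] [? ?] /=; ring.
Qed.

Lemma star_factor_shift W v z x : star_factor (shiftW W v) z x = star_factor W (v + z) x.
Proof. by rewrite /star_factor /shiftW addrA; congr expR; ring. Qed.

Lemma admissible_shift W P Tr v : admissible W P Tr ->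
  admissible (shiftW W v) (shiftP W P v) (shiftT Tr v).
Proof.
move=> adm; have e0 : 0 < expR (- 2 * W v) ^+ 2 by rewrite exprn_gt0// expR_gt0.
have sA x y p q r : sum_area (shiftP W P v) x y p q r =
    expR (- 2 * W v) ^+ 2 * sum_area P (v + x) (v + y) (v + p) (v + q) (v + r).
  by rewrite /sum_area !shift_area -!mulrDr.
split.
- by move=> x y z t; exact: (adm_rot adm t).
- move=> x y z t; have := adm_lens adm t.
  have -> : v + x - (v + y) = x - y by apply: pair_ext => /=; ring.
  have -> : dot (shiftP W P v x - shiftP W P v y) (shiftP W P v x - shiftP W P v y) =
      expR (- 2 * W v) ^+ 2 * dot (P (v + x) - P (v + y)) (P (v + x) - P (v + y)).
    by rewrite /shiftP /dot; case: (P v) (P (v + x)) (P (v + y)) => ? ? [? ?] [? ?] /=; ring.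
  move=> ->; rewrite /shiftW -!expRD -!expRM_natl.
  by rewrite mulrCA -expRD; congr (_ * expR _); ring.
- by move=> x y z t; rewrite shift_area mulr_ge0 ?(ltW e0)// (adm_area adm t).
- by move=> z; rewrite /shiftT !addrA; exact: adm_cells adm (v + z).
- move=> h0 z; rewrite /= !star_factor_shift /shiftT !addrA; exact: adm_flip adm h0 (v + z).
- move=> z; have -> : star_factor (shiftW W v) z = star_factor W (v + z).
    by apply/funext => x; exact: star_factor_shift.
  exact: adm_star adm (v + z).
- move=> x y z k k0 D t t'; have e1 : 0 < expR (-2 * W v) := expR_gt0 _.
  rewrite !sA !(pmulr_rgt0 _ e0).
rewrite !addrA.
  apply: (adm_overlap adm k0) => //.
    rewrite (_ : v + y - (v + x) = y - x); last by apply: pair_ext => /=; ring.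
    by rewrite (_ : v + z - (v + x) = z - x)//; apply: pair_ext => /=; ring.
  by move: t'; rewrite /shiftT !addrA.
- move=> k q z e g N k0 eg [cl X L].
  apply: (adm_strip adm (k := k) (q := P v + (expR (2 * W v))%:C * q) (z := v + z) (e := e) (g := g) (N := N)) => //.
  have nE m n : node (v + z) e g m n = v + node z e g m n by rewrite /node !addrA.
  have XE m n : dot k (P (node (v + z) e g m n) - (P v + (expR (2 * W v))%:C * q)) =
      expR (2 * W v) * dot k (shiftP W P v (node z e g m n) - q).
    have : expR (2 * W v) * expR (- 2 * W v) = 1 by rewrite -expRD (_ : 2 * W v + -2 * W v = 0) ?expR0//; ring.
    rewrite nE /shiftP; move: (expR _) (expR _) => r' r rr.
    transitivity (r * r' * dot k (P (v + node z e g m n) - P v) - r * dot k q).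
      rewrite rr /dot; case: (P v) (P (v + node z e g m n)) (q) (k) => ? ? [? ?] [? ?] [? ?] /=; ring.
    rewrite /dot; case: (P v) (P (v + node z e g m n)) (q) (k) => ? ? [? ?] [? ?] [? ?] /=; ring.
  have e1 : 0 < expR (2 * W v) := expR_gt0 _.
  split.
  + by move=> m n m3 nN; have := cl m n m3 nN; rewrite /cell2 /shiftT nE !addrA.
  + by move=> m n m4 nN; rewrite XE mulrCA mulr_gt0//; exact: X.
  + by move: L; rewrite !XE !ltr_pM2l.
Qed.

Section Ultralimit.
Variables (I : Type) (F : set_system I).
Hypothesis FU : UltraFilter F.
Variables (Wi : I -> V -> R) (Pi : I -> V -> R[i]) (Ti : I -> V -> V -> V -> Prop).
Hypothesis adm : forall i, admissible (Wi i) (Pi i) (Ti i).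
Variables (W : V -> R) (P : V -> R[i]).
Hypothesis cvgW : forall x, Wi i x @[i --> F] --> W x.
Hypothesis cvgP : forall x, cvgC F (fun i => Pi i x) (P x).

Let FF : ProperFilter F := ultra_proper (UltraFilter := FU).
#[local] Existing Instance FF.

Lemma cvg_star_factor z x : star_factor (Wi i) z x @[i --> F] --> star_factor W z x.
Proof.
apply: cvg_expR; apply: cvgM; first exact: cvg_cst.
exact: cvgB.
Qed.

(** The ultrafilter decides which diagonal each cell keeps. Equalities and weak inequalities pass to
    the limit; the last two clauses exclude open conditions, which would already hold close to the
    limit. *)
Lemma admissible_ultralimit :
  admissible W P (fun x y z => \forall i \near F, Ti i x y z).
Proof.
have ultraU (A B : I -> Prop) : (forall i, A i \/ B i) ->
    (\forall i \near F, A i) \/ (\forall i \near F, B i).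
  move=> AB; have [h1|h1] := in_ultra_setVsetC [set i | A i] FU; first by left.
  by right; apply: filterS h1 => i /=; have [] := AB i.
have cS x y p q r : sum_area (Pi i) x y p q r @[i --> F] --> sum_area P x y p q r.
  by apply: cvgD; [apply: cvgD|]; apply: cvg_area.
split.
- by move=> x y z; apply: filterS => i; exact: (adm_rot (adm i)).
- move=> x y z t; apply/eqP; rewrite -subr_eq0; apply/eqP.
  apply: (cvg_eq0 (F := F) (f := fun i => dot (Pi i x - Pi i y) (Pi i x - Pi i y) -
     qform a b h (x - y) * (expR (Wi i x) * expR (Wi i y)) ^+ 2)); last first.
    by apply: filterS t => i /(adm_lens (adm i)) ->; rewrite subrr.
  apply: cvgB; first by apply: cvg_dot; apply: cvgCB.
  apply: cvgM; first exact: cvg_cst.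
  by apply: cvgM; apply: cvgM; apply: cvg_expR.
- move=> x y z t; apply: (cvg_ge0 (F := F) (f := fun i => area (Pi i x) (Pi i y) (Pi i z))).
    exact: cvg_area.
  by apply: filterS t => i /(adm_area (adm i)).
- move=> z; have [t|t] := ultraU _ _ (fun i => adm_cells (adm i) z); [left|right].
    by split; apply: filterS t => i [].
  by split; [have [i []] := filter_ex t|apply: filterS t => i []|apply: filterS t => i []].
- move=> h0 z; split=> t1 t2.
    rewrite -subr_ge0; apply: (cvg_ge0 (F := F) (f := fun i => star_factor (Wi i) z (1, 0) +
      star_factor (Wi i) z (0, 1) - (1 + star_factor (Wi i) z (1, 1)))).
      by apply: cvgB; apply: cvgD; try exact: cvg_star_factor; exact: cvg_cst.
    by apply: filterS2 t1 t2 => i u1 u2; rewrite subr_ge0; apply: (adm_flip (adm i) h0 z).1.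
  rewrite -subr_ge0; apply: (cvg_ge0 (F := F) (f := fun i => 1 + star_factor (Wi i) z (1, 1) -
      (star_factor (Wi i) z (1, 0) + star_factor (Wi i) z (0, 1)))).
    by apply: cvgB; apply: cvgD; try exact: cvg_star_factor; exact: cvg_cst.
  by apply: filterS2 t1 t2 => i u1 u2; rewrite subr_ge0; apply: (adm_flip (adm i) h0 z).2.
- move=> z.
  apply: (star_ok_closed a0 b0 C0 FF (f := fun i => star_factor (Wi i) z)).
  + by move=> x; exact: expR_gt0.
  + by move=> x; exact: cvg_star_factor.
  + by move=> i; exact: (adm_star (adm i) z).
- move=> x y z k k0 D t t' [s1 s2 s3].
  have n1 := near_gt0 (FF := FF) (cS _ _ _ _ _) s1; have n2 := near_gt0 (FF := FF) (cS _ _ _ _ _) s2.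
  have n3 := near_gt0 (FF := FF) (cS _ _ _ _ _) s3.
  have [i [[u u'] [[v1 v2] v3]]] := filter_ex (filterI (filterI t t') (filterI (filterI n1 n2) n3)).
  exact: (adm_overlap (adm i) k0 D u u').
- move=> k q z e g N k0 eg [cl X [l1 l2 l3 l4]].
  have cX m n : dot k (Pi i (node z e g m n) - q) @[i --> F] --> dot k (P (node z e g m n) - q).
    by apply: cvg_dot; [exact: cvgC_cst|apply: cvgCB => //; exact: cvgC_cst].
  have lt := @near_lt R _ F FF.
  have N1 : \forall i \near F, forall m, (m < 3)%N -> forall n, (n < N)%N -> cell2 (Ti i) e g (node z e g m n).
    apply: near_ltn => m m3; apply: near_ltn => n nN.
    have [[t1 t2]|[t1 t2]] := cl m n m3 nN; apply: filterS2 t1 t2 => i u1 u2; [left|right]; by split.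
  have N2 : \forall i \near F, forall m, (m < 4)%N -> forall n, (n < N.+1)%N ->
      0 < (-1) ^+ m * dot k (Pi i (node z e g m n) - q).
    apply: near_ltn => m m3; apply: near_ltn => n nN.
    apply: (near_gt0 (FF := FF) (cvgM (cvg_cst _) (cX m n))); exact: X.
  have N3 := lt _ _ _ _ (cX _ _) (cX _ _) l1; have N4 := lt _ _ _ _ (cX _ _) (cX _ _) l2.
  have N5 := lt _ _ _ _ (cX _ _) (cX _ _) l3; have N6 := lt _ _ _ _ (cX _ _) (cX _ _) l4.
  have [i [[M1 M2] [[m1 m2] [m3 m4]]]] := filter_ex (filterI (filterI N1 N2) (filterI (filterI N3 N4) (filterI N5 N6))).
  apply: (adm_strip (adm i) (k := k) (q := q) (z := z) (e := e) (g := g) (N := N)) => //.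
  by split=> // m n m3' nN; [exact: M1|exact: M2].
Qed.

End Ultralimit.

End Admissible.

(** * The maximum principle and a linear limit *)

Section Maximum.
Context {R : realType} (a b h : R).
Local Notation V := (int * int)%type.
Local Notation C := (a + b - 2 * h).
Hypotheses (a0 : 0 < a) (b0 : 0 < b) (C0 : 0 < C).
Local Notation admissible := (admissible a b h).
Implicit Types (x y z : V) (q : 'I_4).

Lemma axis_opp q : axis (q + 2%:R) = - axis q.
Proof. by case: q => [[|[|[|[|]]]]]. Qed.

Section System.
Variables (W : V -> R) (P : V -> R[i]) (Tr : V -> V -> V -> Prop).
Hypothesis adm : admissible W P Tr.

Lemma axis_lens q z : dot (P (z + axis q) - P z) (P (z + axis q) - P z) =
  axis_sqr a b q * (expR (W z) * expR (W (z + axis q))) ^+ 2.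
Proof.
have sym x y : dot (P x - P y) (P x - P y) = dot (P y - P x) (P y - P x).
  by rewrite /dot; case: (P x) (P y) => ? ? [? ?] /=; ring.
have edge x y c : Tr x y c -> dot (P y - P x) (P y - P x) = qform a b h (y - x) * (expR (W x) * expR (W y)) ^+ 2.
  by move=> t; rewrite qformB -(adm_lens adm t) /dot; case: (P x) (P y) => ? ? [? ?] /=; ring.
have qu : qform a b h (1, 0) = a by rewrite /qform /=; ring.
have qv : qform a b h (0, 1) = b by rewrite /qform /=; ring.
have dz x y : x + y - x = y :> V by rewrite addrC addKr.
have eu x : dot (P (x + (1, 0)) - P x) (P (x + (1, 0)) - P x) = a * (expR (W x) * expR (W (x + (1, 0)))) ^+ 2.
  by have [[t _]|[_ t _]] := adm_cells adm x; rewrite (edge _ _ _ t) dz qu.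
have ev x : dot (P (x + (0, 1)) - P x) (P (x + (0, 1)) - P x) = b * (expR (W x) * expR (W (x + (0, 1)))) ^+ 2.
  have [[t _]|[_ _ t]] := adm_cells adm x; have t' := adm_rot adm (adm_rot adm t);
    by rewrite sym (edge _ _ _ t') qformB dz qv [expR _ * _]mulrC.
case: q => [[|[|[|[|//]]]]] lt; rewrite /axis /axis_sqr /=.
- exact: eu.
- exact: ev.
- have := eu (z + (-1, 0)); have -> : z + (-1, 0) + (1, 0) = z by apply: pair_ext => /=; ring.
  by rewrite sym => ->; rewrite [expR _ * _]mulrC.
- have := ev (z + (0, -1)); have -> : z + (0, -1) + (0, 1) = z by apply: pair_ext => /=; ring.
  by rewrite sym => ->; rewrite [expR _ * _]mulrC.
Qed.

(** [star_ok_bounded] bounds increments from below; applied at the neighbour in the opposite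
    direction, it bounds them from above. *)
Lemma axis_bounded : exists m, forall q z, `|shiftW W z (axis q)| <= m.
Proof.
have [M M0 hM] := star_ok_bounded C a0 b0.
have lo q z : - (ln M / 2) <= shiftW W z (axis q).
  have := hM _ (fun x => expR_gt0 _) (adm_star adm z) q; rewrite /star_factor -/(shiftW W z (axis q)).
  by rewrite -ler_ln ?posrE ?expR_gt0// expRK; lra.
exists (ln M / 2) => q z; rewrite ler_norml lo /=.
have := lo (q + 2%:R) (z + axis q); rewrite axis_opp /shiftW addrK; lra.
Qed.

(** A normalised translate at x + y is one at x plus a rescaled one at y, so unit steps suffice. *)
Lemma shift_bounded : forall x, exists M, forall z,
  [/\ `|shiftW W z x| <= M, `|complex.Re (shiftP W P z x)| <= M & `|complex.Im (shiftP W P z x)| <= M].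
Proof.
pose B x := exists M, forall z,
  [/\ `|shiftW W z x| <= M, `|complex.Re (shiftP W P z x)| <= M & `|complex.Im (shiftP W P z x)| <= M].
have [m hm] := axis_bounded.
have Bax q : B (axis q).
  exists (`|m| + (1 + (a + b) * expR (2 * m))) => z.
  have p0 : 0 <= 1 + (a + b) * expR (2 * m) by rewrite addr_ge0// mulr_ge0 ?expR_ge0// addr_ge0 ?ltW.
  have D : dot (shiftP W P z (axis q)) (shiftP W P z (axis q)) <= (a + b) * expR (2 * m).
    have -> : dot (shiftP W P z (axis q)) (shiftP W P z (axis q)) =
        expR (- 2 * W z) ^+ 2 * dot (P (z + axis q) - P z) (P (z + axis q) - P z).
      by rewrite /shiftP /dot; case: (P _) (P _) => ? ? [? ?] /=; ring.
    rewrite axis_lens mulrCA.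
    have -> : expR (- 2 * W z) ^+ 2 * (expR (W z) * expR (W (z + axis q))) ^+ 2 = expR (2 * shiftW W z (axis q)).
      by rewrite -exprMn -!expRD -expRM_natl /shiftW; congr expR; ring.
    apply: ler_pM; rewrite ?expR_ge0 ?(ltW (axis_sqr_gt0 _ _ _))//.
      by rewrite -(axis_sqrS a b q) lerDl ltW// axis_sqr_gt0.
    by rewrite ler_expR ler_pM2l//; exact: le_trans (ler_norm _) (hm q z).
  have sq (r s : R) : r ^+ 2 <= s -> `|r| <= 1 + s.
    by move=> rs; have := sqr_ge0 (`|r| - 1); have := normr_ge0 r; rewrite sqrrB1 (real_normK (num_real r)); lra.
  move: D; rewrite /dot -!expr2 => D; split.
  - by rewrite (le_trans (hm q z))// (le_trans (ler_norm _))// lerDl.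
  - rewrite (le_trans (sq _ _ (le_trans _ D)))// ?lerDl ?sqr_ge0 ?lerDr//.
  - rewrite (le_trans (sq _ _ (le_trans _ D)))// ?lerDr ?sqr_ge0//.
have BD x y : B x -> B y -> B (x + y).
  move=> [M hM] [N hN]; exists (`|M| + `|N| + `|M| + expR (2 * M) * `|N|) => z.
  have [h1 h2 h3] := hM z; have [k1 k2 k3] := hN (z + x).
  have eW : shiftW W z (x + y) = shiftW W z x + shiftW W (z + x) y by rewrite /shiftW addrA; ring.
  have eP : shiftP W P z (x + y) = shiftP W P z x + (expR (2 * shiftW W z x))%:C * shiftP W P (z + x) y.
    rewrite /shiftP mulrA -rmorphM /= -expRD /shiftW addrA.
    rewrite (_ : _ + _ * W (z + x) = - 2 * W z); first by ring.
    by ring.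
  have e0 := expR_ge0 (2 * shiftW W z x).
  have eM : expR (2 * shiftW W z x) <= expR (2 * M).
    by rewrite ler_expR ler_pM2l//; exact: le_trans (ler_norm _) h1.
  have n1 := normr_ge0 M; have n2 := normr_ge0 N; have n3 := ler_norm M; have n4 := ler_norm N.
  have n5 : 0 <= expR (2 * M) * `|N| by rewrite mulr_ge0// expR_ge0.
  have tri (r s : R) : `|r| <= M -> `|s| <= N -> `|r + expR (2 * shiftW W z x) * s| <= `|M| + `|N| + `|M| + expR (2 * M) * `|N|.
    move=> rM sN; rewrite (le_trans (ler_normD _ _))// normrM (ger0_norm e0).
    have : expR (2 * shiftW W z x) * `|s| <= expR (2 * M) * `|N| by apply: ler_pM => //; lra.
    by lra.
  split.
  - by rewrite eW (le_trans (ler_normD _ _))//; lra.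
  - have -> : complex.Re (shiftP W P z (x + y)) = complex.Re (shiftP W P z x) + expR (2 * shiftW W z x) * complex.Re (shiftP W P (z + x) y).
      by rewrite eP; case: (shiftP _ _ _ _) (shiftP _ _ _ _) => ? ? [? ?] /=; ring.
    exact: tri.
  - have -> : complex.Im (shiftP W P z (x + y)) = complex.Im (shiftP W P z x) + expR (2 * shiftW W z x) * complex.Im (shiftP W P (z + x) y).
      by rewrite eP; case: (shiftP _ _ _ _) (shiftP _ _ _ _) => ? ? [? ?] /=; ring.
    exact: tri.
move=> x; suff : B x by [].
elim/int_ind2: x => [|x Bx].
  exists 0 => z; rewrite /shiftW /shiftP addr0 !subrr mulr0.
  by rewrite normr0; split.
by split; [have := Bax 0|have := Bax 2%:R|have := Bax 1|have := Bax 3%:R] => /(BD _ _ Bx).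
Qed.

Lemma ultralimit (F : set_system V) : UltraFilter F -> exists W' P' Tr',
  admissible W' P' Tr' /\ forall x, shiftW W z x @[z --> F] --> W' x.
Proof.
move=> FU.
have /choice[W' hW] x : exists l : R, shiftW W z x @[z --> F] --> l.
  have [M hM] := shift_bounded x; apply: (ultra_bounded_cvg (M := M)) => z; by have [] := hM z.
have /choice[P' hP] x : exists l : R[i], cvgC F (fun z => shiftP W P z x) l.
  have [M hM] := shift_bounded x.
  have [|l1 h1] := @ultra_bounded_cvg R V F (fun z => complex.Re (shiftP W P z x)) M FU.
    by move=> z; have [] := hM z.
  have [|l2 h2] := @ultra_bounded_cvg R V F (fun z => complex.Im (shiftP W P z x)) M FU.
    by move=> z; have [] := hM z.
  by exists (l1 +i* l2).
exists W', P', (fun x y z => \forall v \near F, shiftT Tr v x y z); split=> //.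
apply: (admissible_ultralimit a0 b0 C0 FU (Wi := shiftW W) (Pi := shiftP W P)) => // v.
exact: admissible_shift.
Qed.

(** Where the increment is maximal, the factors at z are at most those at z + axis q; rigidity makes
    them equal at the neighbours, so the maximum is attained there too. *)
Lemma attained_everywhere q c : (forall z, shiftW W z (axis q) <= c) ->
  shiftW W 0 (axis q) = c -> forall z, shiftW W z (axis q) = c.
Proof.
move=> le e0; have step z r : shiftW W z (axis q) = c -> shiftW W (z + axis r) (axis q) = c.
  move=> ez.
  have cmp x : star_factor W z x <= star_factor W (z + axis q) x.
    rewrite /star_factor ler_expR !mulNr lerN2 ler_pM2l//.
    have := le (z + x); rewrite -ez /shiftW addrAC; lra.
  have := star_ok_rigid a0 b0 C0 (adm_star adm z) (adm_star adm (z + axis q)) cmp r.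
  rewrite /star_factor => /expR_inj; rewrite !mulNr => /oppr_inj /mulfI.
  by rewrite pnatr_eq0 => /(_ isT); rewrite -ez /shiftW [z + axis q + _]addrAC; lra.
apply: int_ind2 => // z ez.
by split; [exact: (step z 0)|exact: (step z 2%:R)|exact: (step z 1)|exact: (step z 3%:R)].
Qed.

End System.

(* In a limit of translates along a maximising sequence of the increment in   *)
(* direction q, the maximum is attained, and then it is attained everywhere.  *)
Lemma maximal_increment W P Tr q : admissible W P Tr -> exists W' P' Tr' (c : R),
  [/\ admissible W' P' Tr', forall z, shiftW W' z (axis q) = c,
      forall z, shiftW W z (axis q) <= c &
      forall x d, (forall z, shiftW W z x = d) -> forall z, shiftW W' z x = d].
Proof.
move=> adm; have [m hm] := axis_bounded adm.
pose D z := shiftW W z (axis q); pose S := range D; pose c := sup S.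
have hS : has_sup S.
  split; first by exists (D 0), 0.
  by exists m => _ [z _ <-]; exact: le_trans (ler_norm _) (hm q z).
have Dc z : D z <= c by apply: sup_upper_bound => //; exists z.
(* An ultrafilter finer than the sets where the increment is close to its supremum plays the part of
   a maximising sequence. *)
pose G := filter_from [set e : R | 0 < e] (fun e => [set z | c - e < D z]).
have GP : ProperFilter G.
  apply: filter_from_proper; last first.
    by move=> e /= e0; have [_ [z _ <-] lt] := sup_adherent e0 hS; exists z.
  apply: filter_from_filter; first by exists 1 => /=.
  move=> e e' /= p p'; exists (Num.min e e') => /=; first by rewrite lt_min p p'.
  move=> z /= lt; have := ge_min e e e'; have := ge_min e' e e'; rewrite !lexx orbT /= => l1 l2.
  by split; lra.
have [F [FU GF]] := ultraFilterLemma GP.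
have [W' [P' [Tr' [adm' cv]]]] := ultralimit adm FU.
have FF : ProperFilter F := ultra_proper (UltraFilter := FU).
have cvz x z : shiftW W (v + z) x @[v --> F] --> shiftW W' z x.
  rewrite (_ : (fun v => _) = (fun v => shiftW W v (z + x) - shiftW W v z)).
    by apply: cvgB.
  by apply/funext => v; rewrite /shiftW addrA; ring.
have keep x d : (forall z, shiftW W z x = d) -> forall z, shiftW W' z x = d.
  move=> e z; apply/eqP; rewrite -subr_eq0; apply/eqP.
  apply: (cvg_eq0 (FF := FF) (f := fun v => shiftW W (v + z) x - d)).
    by apply: cvgB => //; exact: cvg_cst.
  by apply: filterE => v; rewrite e subrr.
have le z : shiftW W' z (axis q) <= c.
  rewrite -subr_ge0; apply: (cvg_ge0 (FF := FF) (f := fun v => c - shiftW W (v + z) (axis q))).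
    by apply: cvgB => //; exact: cvg_cst.
  by apply: filterE => v; rewrite subr_ge0; exact: Dc.
exists W', P', Tr', c; split=> //.
have z0 : shiftW W' 0 (axis q) = W' (axis q).
  have -> : W' (axis q) = W' (axis q) - 0 by rewrite subr0.
  rewrite /shiftW add0r; congr (_ - _).
  apply: (cvg_eq0 (FF := FF) (f := fun v => shiftW W v 0)) => //.
  by apply: filterE => v; rewrite /shiftW addr0 subrr.
apply: (attained_everywhere adm') => //; apply/eqP; rewrite eq_le le /= z0 leNgt; apply/negP => lt.
have e0 : 0 < (c - W' (axis q)) / 2 by rewrite divr_gt0// subr_gt0.
have n1 : F [set z | c - (c - W' (axis q)) / 2 < D z] by apply: GF; exists ((c - W' (axis q)) / 2).
have l1 : W' (axis q) < W' (axis q) + (c - W' (axis q)) / 2 by rewrite ltrDl.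
have n2 : F [set v | shiftW W v (axis q) < W' (axis q) + (c - W' (axis q)) / 2].
  exact: (near_lt (FF := FF) (cv (axis q)) (cvg_cst _) l1).
have [v [v1 v2]] := filter_ex (filterI n1 n2).
move: v1 v2; rewrite /= /D; lra.
Qed.

(** Maximise in a direction q with a positive increment, then in direction q + 1; the first constant
    increment survives the second limit. *)
Lemma linear_limit W P Tr : admissible W P Tr -> (exists z, W z != W 0) ->
  exists W' P' Tr' (al be : R), [/\ admissible W' P' Tr', (al != 0) || (be != 0),
    forall z, W' (z + (1, 0)) = W' z + al & forall z, W' (z + (0, 1)) = W' z + be].
Proof.
move=> adm [z1 ne].
have [q [z pos]] : exists q z, 0 < shiftW W z (axis q).
  apply: contrapT => no; have le q z : shiftW W z (axis q) <= 0.
    by rewrite leNgt; apply/negP => lt; apply: no; exists q, z.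
  have e q z : W (z + axis q) = W z.
    apply/le_anti; rewrite -subr_le0 [_ - _](_ : _ = shiftW W z (axis q))// le /=.
    by have := le (q + 2%:R) (z + axis q); rewrite axis_opp /shiftW addrK subr_le0.
  move/eqP: ne; apply; elim/int_ind2: z1 => // z ez.
  by split; [rewrite (e 0)|rewrite (e 2%:R)|rewrite (e 1)|rewrite (e 3%:R)].
have [W1 [P1 [Tr1 [c [adm1 e1 le1 _]]]]] := maximal_increment q adm.
have [W2 [P2 [Tr2 [d [adm2 e2 _ keep]]]]] := maximal_increment (q + 1) adm1.
have c0 : 0 < c by exact: lt_le_trans (le1 z).
have {}e1 := keep _ _ e1; exists W2, P2, Tr2.
have inc x r : (forall z, shiftW W2 z x = r) -> (forall z, W2 (z + x) = W2 z + r) /\ (forall z, W2 (z - x) = W2 z - r).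
  move=> er; split=> y; first by rewrite -(er y) /shiftW; ring.
  by rewrite -(er (y - x)) /shiftW subrK; ring.
have [i1 i1'] := inc _ _ e1; have [i2 i2'] := inc _ _ e2.
move: i1 i1' i2 i2' {keep e1 e2 le1 pos inc}; case: q => [[|[|[|[|//]]]]] lt; rewrite /axis /= => i1 i1' i2 i2'.
- by exists c, d; split=> //; rewrite gt_eqF.
- by exists (- d), c; split=> //; rewrite [c == 0]gt_eqF// orbT.
- by exists (- c), (- d); split=> //; rewrite oppr_eq0 gt_eqF.
- by exists d, (- c); split=> //; rewrite oppr_eq0 [c == 0]gt_eqF// orbT.
Qed.

End Maximum.

(** * Spirals *)

Section Similar.
Context {R : realType}.
Implicit Types (x y z d e w X Y : R[i]) (p q k m s t om : R).

Lemma dotM w x : dot (w * x) (w * x) = dot w w * dot x x.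
Proof. by rewrite /dot; case: w x => ? ? [? ?] /=; ring. Qed.

Lemma cross_mulr w e x : cross (w * x) (e * x) = cross w e * dot x x.
Proof. by rewrite /cross /dot; case: w e x => ? ? [? ?] [? ?] /=; ring. Qed.

Lemma dot_conj x : dot (conjc x) (conjc x) = dot x x.
Proof. by rewrite /dot; case: x => ? ? /=; ring. Qed.

Lemma cross_conj x y : cross (conjc x) (conjc y) = cross y x.
Proof. by rewrite /cross; case: x y => ? ? [? ?] /=; ring. Qed.

Lemma conj_scale (r : R) x y : conjc x = r%:C * conjc y -> x = r%:C * y.
Proof.
by case: x y => [x1 x2] [y1 y2] [h1 h2]; apply/eqP; rewrite eq_complex /=; apply/andP; split; apply/eqP; lra.
Qed.

Lemma dot_sub x y : dot (x - y) (x - y) = dot x x - 2 * dot x y + dot y y.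
Proof. by rewrite /dot; case: x y => ? ? [? ?] /=; ring. Qed.

Lemma dot_subC x y : dot (x - y) (x - y) = dot (y - x) (y - x).
Proof. by rewrite !dot_sub [dot x y]dotC; ring. Qed.

(** The lengths determine the real part of y / x and the square of its imaginary part, and the
    orientation determines the sign. *)
Lemma ratio_unique k m x y x' y' : x != 0 -> x' != 0 ->
  dot y y = k * dot x x -> dot (y - x) (y - x) = m * dot x x -> 0 <= cross x y ->
  dot y' y' = k * dot x' x' -> dot (y' - x') (y' - x') = m * dot x' x' -> 0 <= cross x' y' ->
  y / x = y' / x'.
Proof.
have H x1 y1 : x1 != 0 -> dot y1 y1 = k * dot x1 x1 -> dot (y1 - x1) (y1 - x1) = m * dot x1 x1 ->
    0 <= cross x1 y1 -> [/\ complex.Re (y1 / x1) = (1 + k - m) / 2, 0 <= complex.Im (y1 / x1) &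
      complex.Im (y1 / x1) ^+ 2 = k - ((1 + k - m) / 2) ^+ 2].
  move=> x0 h1 h2 h3; have d0 := dot_gt0 x0; have dn : dot x1 x1 != 0 by rewrite gt_eqF.
  have e : y1 = (y1 / x1) * x1 by rewrite divfK.
  move: h1 h2 h3; rewrite {1 2}e dotM => /(mulIf dn) h1.
  have -> : y1 - x1 = (y1 / x1 - 1) * x1 by rewrite mulrBl mul1r divfK.
  rewrite dotM => /(mulIf dn) h2.
  have -> : cross x1 y1 = cross 1 (y1 / x1) * dot x1 x1 by rewrite -cross_mulr mul1r divfK.
  rewrite pmulr_lge0// => h3; move: h1 h2 h3 {e}; case: (y1 / x1) => r i; rewrite /dot /cross /= => h1 h2 h3.
  have er : r = (1 + k - m) / 2 by lra.
  by split=> //; [lra|rewrite -er; lra].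
move=> x0 x0' h1 h2 h3 h1' h2' h3'.
have [r1 i1 s1] := H _ _ x0 h1 h2 h3; have [r2 i2 s2] := H _ _ x0' h1' h2' h3'.
apply/eqP; rewrite eq_complex r1 r2 eqxx /=.
by rewrite -(eqrXn2 (n := 2))// s1 s2.
Qed.

Lemma third_vertex x y y' : x != 0 -> dot y y = dot y' y' ->
  dot (y - x) (y - x) = dot (y' - x) (y' - x) -> 0 <= cross x y -> 0 <= cross x y' -> y = y'.
Proof.
move=> x0 e1 e2 c1 c2; have dn : dot x x != 0 by rewrite gt_eqF// dot_gt0.
have := @ratio_unique (dot y y / dot x x) (dot (y - x) (y - x) / dot x x) x y x y' x0 x0.
by rewrite -e1 -e2 !divfK// => /(_ erefl erefl c1 erefl erefl c2) /(divIf x0).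
Qed.

(* The quadrilateral 0, x, y, y + X is an isosceles trapezoid.                *)
Lemma isosceles_A p q t om x y X : 0 < p -> 0 < q -> 0 < t -> 0 < om ->
  dot x x = p * om -> dot y y = q * t * om -> dot (x - y) (x - y) = (p + q) * t * om ->
  dot X X = p * t ^+ 2 * om -> dot (X - (x - y)) (X - (x - y)) = q * t * om ->
  0 <= cross x y -> 0 <= cross (x - y) X -> X = t%:C * x.
Proof.
move=> p0 q0 t0 om0 h1 h2 h3 h4 h5 c1 c2.
have e0 : x - y != 0 by rewrite -dot_eq0 h3 gt_eqF// !mulr_gt0// addr_gt0.
have tx : dot (t%:C * x) (t%:C * x) = t ^+ 2 * dot x x by rewrite /dot; case: (x) => ? ? /=; ring.
apply: (third_vertex e0) => //.
- by rewrite h4 tx h1; ring.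
- rewrite h5; have : dot (t%:C * x - (x - y)) (t%:C * x - (x - y)) =
     (t ^+ 2 - t) * dot x x + t * dot y y + (1 - t) * dot (x - y) (x - y).
    by rewrite /dot; case: (x) (y) => ? ? [? ?] /=; ring.
  by move=> ->; rewrite h1 h2 h3; ring.
- have -> : cross (x - y) (t%:C * x) = t * cross x y.
    by rewrite /cross; case: (x) (y) => ? ? [? ?] /=; ring.
  by rewrite mulr_ge0// ltW.
Qed.

Lemma isosceles_B p q t om x y d : 0 < p -> 0 < q -> 0 < t -> 0 < om ->
  dot x x = p * om -> dot d d = (p + q) * t * om -> dot (d - x) (d - x) = q * t * om ->
  dot y y = q * t * om -> dot (d - y) (d - y) = p * t ^+ 2 * om ->
  0 <= cross x d -> 0 <= cross d y -> d - y = t%:C * x.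
Proof.
move=> p0 q0 t0 om0 h1 h2 h3 h4 h5 c1 c2.
have e0 : d != 0 by rewrite -dot_eq0 h2 gt_eqF// !mulr_gt0// addr_gt0.
have -> : y = d - t%:C * x; last by ring.
apply: (third_vertex e0) => //.
- have -> : dot (d - t%:C * x) (d - t%:C * x) =
     (1 - t) * dot d d + t * dot (d - x) (d - x) + (t ^+ 2 - t) * dot x x.
    by rewrite /dot; case: (x) (d) => ? ? [? ?] /=; ring.
  by rewrite h1 h2 h3 h4; ring.
- rewrite dot_subC h5; have -> : dot (d - t%:C * x - d) (d - t%:C * x - d) = t ^+ 2 * dot x x.
    by rewrite /dot; case: (x) (d) => ? ? [? ?] /=; ring.
  by rewrite h1; ring.
- have -> : cross d (d - t%:C * x) = t * cross x d.
    by rewrite /cross; case: (x) (d) => ? ? [? ?] /=; ring.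
  by rewrite mulr_ge0// ltW.
Qed.

End Similar.

(** * Shapes of the cells for a linear factor *)

Section Cell.
Context {R : realType} (a b C s t : R).
Hypotheses (a0 : 0 < a) (b0 : 0 < b) (C0 : 0 < C) (s0 : 0 < s) (t0 : 0 < t).
Implicit Types (om : R) (x y X : R[i]).

(* The two ways to cut the quadrilateral 0, x, y, y + X.                      *)
Definition cellA om x y X : Prop :=
  [/\ 0 < om,
      [/\ dot x x = a * s * om, dot y y = b * t * om & dot (x - y) (x - y) = C * (s * t) * om],
      dot X X = a * s * t ^+ 2 * om /\ dot (X - (x - y)) (X - (x - y)) = b * s ^+ 2 * t * om &
      0 <= cross x y /\ 0 <= cross (x - y) X].

Definition cellB om x y X : Prop :=
  [/\ 0 < om,
      [/\ dot x x = a * s * om, dot y y = b * t * om & dot (y + X) (y + X) = (a + b) * (s * t) * om],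
      dot X X = a * s * t ^+ 2 * om /\ dot (y + X - x) (y + X - x) = b * s ^+ 2 * t * om &
      0 <= cross x (y + X) /\ 0 <= cross (y + X) y].

Lemma divr_sub (u v : R[i]) : v != 0 -> (v - u) / v = 1 - u / v.
Proof. by move=> v0; rewrite mulrBl divff. Qed.

Lemma cellA_similar om om' x y X x' y' X' :
  cellA om x y X -> cellA om' x' y' X' -> y / x = y' / x' /\ X / x = X' / x'.
Proof.
move=> [pos [h1 h2 h3] [h4 h5] [c1 c2]] [pos' [h1' h2' h3'] [h4' h5'] [c1' c2']].
have x0 : x != 0 by rewrite -dot_eq0 h1 gt_eqF// !mulr_gt0.
have x0' : x' != 0 by rewrite -dot_eq0 h1' gt_eqF// !mulr_gt0.
have e0 : x - y != 0 by rewrite -dot_eq0 h3 gt_eqF// !mulr_gt0.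
have e0' : x' - y' != 0 by rewrite -dot_eq0 h3' gt_eqF// !mulr_gt0.
have E : y / x = y' / x'.
  apply: (@ratio_unique _ (b * t / (a * s)) (C * t / a)) => //.
  - by rewrite h1 h2; field; rewrite !gt_eqF.
  - by rewrite dot_subC h1 h3; field; rewrite gt_eqF.
  - by rewrite h1' h2'; field; rewrite !gt_eqF.
  - by rewrite dot_subC h1' h3'; field; rewrite gt_eqF.
split=> //.
have E2 : X / (x - y) = X' / (x' - y').
  apply: (@ratio_unique _ (a * t / C) (b * s / C)) => //.
  - by rewrite h3 h4; field; rewrite !gt_eqF.
  - by rewrite h3 h5; field; rewrite gt_eqF.
  - by rewrite h3' h4'; field; rewrite !gt_eqF.
  - by rewrite h3' h5'; field; rewrite gt_eqF.
have e1 : X / x = X / (x - y) * (1 - y / x) by rewrite -divr_sub// mulrA divfK.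
have e2 : X' / x' = X' / (x' - y') * (1 - y' / x') by rewrite -divr_sub// mulrA divfK.
by rewrite e1 e2 E E2.
Qed.

Lemma cellB_similar om om' x y X x' y' X' :
  cellB om x y X -> cellB om' x' y' X' -> y / x = y' / x' /\ X / x = X' / x'.
Proof.
move=> [pos [h1 h2 h3] [h4 h5] [c1 c2]] [pos' [h1' h2' h3'] [h4' h5'] [c1' c2']].
have ab : 0 < a + b by rewrite addr_gt0.
have x0 : x != 0 by rewrite -dot_eq0 h1 gt_eqF// !mulr_gt0.
have x0' : x' != 0 by rewrite -dot_eq0 h1' gt_eqF// !mulr_gt0.
have e0 : y + X != 0 by rewrite -dot_eq0 h3 gt_eqF// !mulr_gt0.
have e0' : y' + X' != 0 by rewrite -dot_eq0 h3' gt_eqF// !mulr_gt0.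
have E : (y + X) / x = (y' + X') / x'.
  apply: (@ratio_unique _ ((a + b) * t / a) (b * s * t / a)) => //.
  - by rewrite h1 h3; field; rewrite !gt_eqF.
  - by rewrite h1 h5; field; rewrite gt_eqF.
  - by rewrite h1' h3'; field; rewrite !gt_eqF.
  - by rewrite h1' h5'; field; rewrite gt_eqF.
have yX u v : dot (u - (u + v)) (u - (u + v)) = dot v v :> R.
  by rewrite /dot; case: u v => ? ? [? ?] /=; ring.
have E2 : y / (y + X) = y' / (y' + X').
  apply: (@ratio_unique _ (b / ((a + b) * s)) (a * t / (a + b))) => //.
  - by rewrite h3 h2; field; rewrite !gt_eqF.
  - by rewrite yX h3 h4; field; rewrite gt_eqF.
  - by rewrite h3' h2'; field; rewrite !gt_eqF.
  - by rewrite yX h3' h4'; field; rewrite gt_eqF.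
have e1 : y / x = y / (y + X) * ((y + X) / x) by rewrite mulrA divfK.
have e2 : y' / x' = y' / (y' + X') * ((y' + X') / x') by rewrite mulrA divfK.
have f1 : X / x = (y + X) / x - y / x by rewrite -mulrBl addrC addKr.
have f2 : X' / x' = (y' + X') / x' - y' / x' by rewrite -mulrBl addrC addKr.
by rewrite f1 f2 e1 e2 E E2.
Qed.

Hypothesis Cab : C = a + b.

Lemma cellA_s1 om x y X : s = 1 -> cellA om x y X -> X = t%:C * x.
Proof.
move=> s1 [pos [h1 h2 h3] [h4 h5] [c1 c2]]; rewrite s1 in h1 h3 h4 h5.
apply: (isosceles_A a0 b0 t0 pos _ _ _ _ _ c1 c2).
- by rewrite h1; ring.
- by rewrite h2.
- by rewrite h3 Cab; ring.
- by rewrite h4; ring.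
- by rewrite h5; ring.
Qed.

Lemma cellB_s1 om x y X : s = 1 -> cellB om x y X -> X = t%:C * x.
Proof.
move=> s1 [pos [h1 h2 h3] [h4 h5] [c1 c2]]; rewrite s1 in h1 h3 h4 h5.
have <- : y + X - y = X by ring.
apply: (isosceles_B a0 b0 t0 pos _ _ _ _ _ c1 c2).
- by rewrite h1; ring.
- by rewrite h3; ring.
- by rewrite h5; ring.
- by rewrite h2.
- have -> : y + X - y = X by ring.
  by rewrite h4; ring.
Qed.

Lemma cellA_t1 om x y X : t = 1 -> cellA om x y X -> y + X - x = s%:C * y.
Proof.
move=> t1 [pos [h1 h2 h3] [h4 h5] [c1 c2]]; rewrite t1 in h2 h3 h4 h5.
have e : conjc (y + X - x) = s%:C * conjc y.
  apply: (isosceles_A b0 a0 s0 pos (y := conjc x)).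
  - by rewrite dot_conj h2; ring.
  - by rewrite dot_conj h1.
  - by rewrite -rmorphB /= dot_conj dot_subC h3 Cab; ring.
  - rewrite dot_conj (_ : y + X - x = X - (x - y)); last by ring.
    by rewrite h5; ring.
  - rewrite -!rmorphB /= dot_conj (_ : y + X - x - (y - x) = X); last by ring.
    by rewrite h4; ring.
  - by rewrite cross_conj.
  - rewrite -rmorphB /= cross_conj.
    have -> : cross (y + X - x) (y - x) = cross (x - y) X; last by [].
    by rewrite /cross; case: (x) (y) (X) => ? ? [? ?] [? ?] /=; ring.
exact: conj_scale.
Qed.

Lemma cellB_t1 om x y X : t = 1 -> cellB om x y X -> y + X - x = s%:C * y.
Proof.
move=> t1 [pos [h1 h2 h3] [h4 h5] [c1 c2]]; rewrite t1 in h2 h3 h4 h5.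
have e : conjc (y + X) - conjc x = s%:C * conjc y.
  apply: (isosceles_B b0 a0 s0 pos).
  - by rewrite dot_conj h2; ring.
  - by rewrite dot_conj h3; ring.
  - rewrite -rmorphB /= dot_conj (_ : y + X - y = X); last by ring.
    by rewrite h4; ring.
  - by rewrite dot_conj h1.
  - by rewrite -rmorphB /= dot_conj h5; ring.
  - by rewrite cross_conj.
  - by rewrite cross_conj.
by apply: conj_scale; rewrite -e; case: (y) (X) (x) => ? ? [? ?] [? ?] /=; congr (_ +i* _); ring.
Qed.

(** For C = a + b and s or t equal to 1, the quadrilateral is an isosceles trapezoid. Its diagonals
    are equal, so a cell cut one way has the lengths required by the other cut. *)
Lemma cellB_diag om x y X : s = 1 \/ t = 1 -> cellB om x y X ->
  dot (x - y) (x - y) = C * (s * t) * om /\ 0 <= cross x y.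
Proof.
move=> st cB; have := cB; move=> [pos [h1 h2 h3] _ [c1 _]].
case: st => [s1|t1].
  have e := cellB_s1 s1 cB; rewrite s1 in h1 h3.
  have tn : t != 0 by rewrite gt_eqF.
  have f : dot (y + X) (y + X) = (1 + t) * dot y y + (t ^+ 2 + t) * dot x x - t * dot (x - y) (x - y).
    by rewrite e /dot; case: (x) (y) => ? ? [? ?] /=; ring.
  split; last first.
    have <- : cross x (y + X) = cross x y by rewrite e /cross; case: (x) (y) => ? ? [? ?] /=; ring.
    by [].
  by apply: (mulfI tn); move: f; rewrite h1 h2 h3 s1 Cab; lra.
have e := cellB_t1 t1 cB; rewrite t1 in h2 h3.
have sn : s != 0 by rewrite gt_eqF.
have {}e : y + X = x + s%:C * y by rewrite -e; ring.
have f : dot (y + X) (y + X) = (1 + s) * dot x x + (s ^+ 2 + s) * dot y y - s * dot (x - y) (x - y).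
  by rewrite e /dot; case: (x) (y) => ? ? [? ?] /=; ring.
split; last first.
  have E : cross x (y + X) = s * cross x y by rewrite e /cross; case: (x) (y) => ? ? [? ?] /=; ring.
  by rewrite E pmulr_rge0 in c1.
by apply: (mulfI sn); move: f; rewrite h1 h2 h3 t1 Cab; lra.
Qed.

Lemma cell_similar om om' x y X x' y' X' : s = 1 \/ t = 1 ->
  cellA om x y X \/ cellB om x y X -> cellA om' x' y' X' \/ cellB om' x' y' X' ->
  y / x = y' / x' /\ X / x = X' / x'.
Proof.
move=> st c c'.
have D om1 x1 y1 X1 : cellA om1 x1 y1 X1 \/ cellB om1 x1 y1 X1 ->
    [/\ 0 < om1, dot x1 x1 = a * s * om1, dot y1 y1 = b * t * om1,
      dot (x1 - y1) (x1 - y1) = C * (s * t) * om1 & 0 <= cross x1 y1].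
  case=> [[pos [h1 h2 h3] _ [c1 _]]//|cB].
  by have [d1 d2] := cellB_diag st cB; have [pos [h1 h2 _] _ _] := cB; split.
have [pos h1 h2 h3 c1] := D _ _ _ _ c; have [pos' h1' h2' h3' c1'] := D _ _ _ _ c'.
have x0 : x != 0 by rewrite -dot_eq0 h1 gt_eqF// !mulr_gt0.
have x0' : x' != 0 by rewrite -dot_eq0 h1' gt_eqF// !mulr_gt0.
have E : y / x = y' / x'.
  apply: (@ratio_unique _ (b * t / (a * s)) (C * t / a)) => //.
  - by rewrite h1 h2; field; rewrite !gt_eqF.
  - by rewrite dot_subC h1 h3; field; rewrite gt_eqF.
  - by rewrite h1' h2'; field; rewrite !gt_eqF.
  - by rewrite dot_subC h1' h3'; field; rewrite gt_eqF.
split=> //; case: st => [s1|t1].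
  have S om1 x1 y1 X1 : cellA om1 x1 y1 X1 \/ cellB om1 x1 y1 X1 -> X1 = t%:C * x1.
    by case=> [/(cellA_s1 s1)|/(cellB_s1 s1)].
  by rewrite (S _ _ _ _ c) (S _ _ _ _ c') !mulfK.
have S om1 x1 y1 X1 : x1 != 0 -> cellA om1 x1 y1 X1 \/ cellB om1 x1 y1 X1 ->
    X1 / x1 = 1 + (s%:C - 1) * (y1 / x1).
  move=> n0 cc; have e : y1 + X1 - x1 = s%:C * y1.
    by case: cc => [/(cellA_t1 t1)|/(cellB_t1 t1)].
  have -> : X1 = x1 + (s%:C - 1) * y1 by rewrite mulrBl mul1r -e; ring.
  by rewrite mulrDl divff// mulrA.
by rewrite (S _ _ _ _ x0 c) (S _ _ _ _ x0' c') E.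
Qed.

End Cell.

(** * Admissible systems with a linear factor *)

Section Linear.
Context {R : realType} (a b h : R).
Local Notation V := (int * int)%type.
Local Notation C := (a + b - 2 * h).
Hypotheses (a0 : 0 < a) (b0 : 0 < b) (C0 : 0 < C).
Variables (W : V -> R) (P : V -> R[i]) (Tr : V -> V -> V -> Prop).
Hypothesis adm : admissible a b h W P Tr.
Variables (al be : R).
Hypothesis W_u : forall z, W (z + (1, 0)) = W z + al.
Hypothesis W_v : forall z, W (z + (0, 1)) = W z + be.
Implicit Types (x y z : V).

Definition increment x : R := x.1%:~R * al + x.2%:~R * be.

Lemma incrementD x y : increment (x + y) = increment x + increment y.
Proof. by rewrite /increment /= !rmorphD /=; ring. Qed.

Lemma linear_W z x : W (z + x) = W z + increment x.
Proof.
elim/int_ind2: x z => [z|x IH]; first by rewrite /increment addr0 !mul0r !addr0.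
have h1 y : W (y - (1, 0)) = W y - al by rewrite -[in RHS](subrK (1, 0) y) W_u addrK.
have h2 y : W (y - (0, 1)) = W y - be by rewrite -[in RHS](subrK (0, 1) y) W_v addrK.
by split=> z'; rewrite addrA ?W_u ?h1 ?W_v ?h2 IH incrementD /increment /=; ring.
Qed.

Local Notation s := (expR (2 * al)).
Local Notation t := (expR (2 * be)).

Lemma edge_linear z p q x y r : Tr x y r -> x = z + p -> y = z + q ->
  dot (P x - P y) (P x - P y) =
  qform a b h (p - q) * (expR (2 * increment p) * expR (2 * increment q)) * expR (4 * W z).
Proof.
move=> tr ex ey; rewrite (adm_lens adm tr) ex ey (_ : z + p - (z + q) = p - q); last first.
  by apply: pair_ext => /=; ring.
rewrite !linear_W -mulrA; congr (_ * _); rewrite -!expRD -expRM_natl; congr expR; ring.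
Qed.

Definition east z : R[i] := P (z + (1, 0)) - P z.
Definition north z : R[i] := P (z + (0, 1)) - P z.

Definition typeA z := Tr z (z + (1, 0)) (z + (0, 1)) /\ Tr (z + (1, 1)) (z + (0, 1)) (z + (1, 0)).
Definition typeB z := Tr z (z + (1, 0)) (z + (1, 1)) /\ Tr z (z + (1, 1)) (z + (0, 1)).

Lemma zuv z : z + (0, 1) + (1, 0) = z + (1, 1).
Proof. by apply: pair_ext => /=; ring. Qed.

Lemma zvu z : z + (1, 0) + (0, 1) = z + (1, 1).
Proof. by apply: pair_ext => /=; ring. Qed.

Lemma increment_u : increment (1, 0) = al. Proof. by rewrite /increment /=; ring. Qed.
Lemma increment_v : increment (0, 1) = be. Proof. by rewrite /increment /=; ring. Qed.
Lemma increment_uv : increment (1, 1) = al + be. Proof. by rewrite /increment /=; ring. Qed.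
Lemma increment0 : increment 0 = 0. Proof. by rewrite /increment /=; ring. Qed.

Lemma cellA_at z : typeA z ->
  cellA a b C s t (expR (4 * W z)) (east z) (north z) (east (z + (0, 1))).
Proof.
move=> [t1 t2]; have z0 : z = z + 0 by rewrite addr0.
have rot := adm_rot adm.
have i1 := increment_u; have i2 := increment_v; have i3 := increment_uv; have i0 := increment0.
rewrite /cellA /east /north zuv; split; first exact: expR_gt0.
- split.
  + rewrite dot_subC [RHS]mulrC; rewrite (edge_linear t1 z0 erefl) i0 i1 mulr0 expR0 /qform /=; ring.
  + rewrite (edge_linear (rot _ _ _ (rot _ _ _ t1)) erefl z0) i0 i2 mulr0 expR0 /qform /=; ring.
  + rewrite (_ : _ - _ - _ = P (z + (1, 0)) - P (z + (0, 1))); last by ring.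
    rewrite (edge_linear (rot _ _ _ t1) erefl erefl) i1 i2 /qform /=; ring.
- split.
  + rewrite (edge_linear t2 erefl erefl) i3 i2 mulrDr expRD /qform /=; ring.
  + rewrite (_ : _ - _ - _ = P (z + (1, 1)) - P (z + (1, 0))); last by ring.
    rewrite dot_subC (edge_linear (rot _ _ _ (rot _ _ _ t2)) erefl erefl) i3 i1 mulrDr expRD /qform /=; ring.
- split; first exact: (adm_area adm t1).
  have := adm_area adm (rot _ _ _ t2); congr (_ <= _); rewrite /area /cross.
  by case: (P z) (P (z + (1, 1))) (P (z + (0, 1))) (P (z + (1, 0))) => ? ? [? ?] [? ?] [? ?] /=; ring.
Qed.

Lemma cellB_at z : h = 0 -> typeB z ->
  cellB a b s t (expR (4 * W z)) (east z) (north z) (east (z + (0, 1))).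
Proof.
move=> h0 [t1 t2]; have z0 : z = z + 0 by rewrite addr0.
have rot := adm_rot adm.
have i1 := increment_u; have i2 := increment_v; have i3 := increment_uv; have i0 := increment0.
rewrite /cellB /east /north zuv; split; first exact: expR_gt0.
- split.
  + rewrite dot_subC (edge_linear t1 z0 erefl) i0 i1 mulr0 expR0 /qform /=; ring.
  + rewrite (edge_linear (rot _ _ _ (rot _ _ _ t2)) erefl z0) i0 i2 mulr0 expR0 /qform /=; ring.
  + rewrite (_ : _ - _ + _ = P (z + (1, 1)) - P z); last by ring.
    rewrite dot_subC (edge_linear t2 z0 erefl) i0 i3 mulr0 expR0 mulrDr expRD /qform /= h0; ring.
- split.
  + rewrite (edge_linear (rot _ _ _ t2) erefl erefl) i3 i2 mulrDr expRD /qform /=; ring.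
  + rewrite (_ : _ - _ + _ - _ = P (z + (1, 1)) - P (z + (1, 0))); last by ring.
    rewrite dot_subC (edge_linear (rot _ _ _ t1) erefl erefl) i3 i1 mulrDr expRD /qform /=; ring.
- rewrite (_ : P (z + (0, 1)) - P z + _ = P (z + (1, 1)) - P z); last by ring.
  by split; [exact: (adm_area adm t1)|exact: (adm_area adm t2)].
Qed.

Lemma types z : typeA z \/ h = 0 /\ typeB z.
Proof. by have [?|[h0 ? ?]] := adm_cells adm z; [left|right]. Qed.

(** For linear W the opposite inequalities of the two cuts do not depend on the vertex, so equality
    holds; it reads (1 - 1/s)(1 - 1/t) = 0. *)
Lemma mixed_types z z' : typeA z -> h = 0 -> typeB z' -> s = 1 \/ t = 1.
Proof.
move=> tA h0 tB; have [fA _] := adm_flip adm h0 z; have [_ fB] := adm_flip adm h0 z'.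
have := fA tA.1 tA.2; have := fB tB.1 tB.2.
have f x y : star_factor W x y = expR (- 2 * increment y).
  by rewrite /star_factor linear_W addrAC subrr add0r.
rewrite !f increment_u increment_v increment_uv mulrDr expRD !mulNr !expRN.
have s0 : 0 < s := expR_gt0 _; have t0 : 0 < t := expR_gt0 _.
move=> l1 l2; have : (1 - s^-1) * (1 - t^-1) = 0 by lra.
by move/eqP; rewrite mulf_eq0 !subr_eq0 ![1 == _]eq_sym !invr_eq1 => /orP[] /eqP; [left|right].
Qed.

Lemma similar_cells z z' : north z / east z = north z' / east z' /\
  east (z + (0, 1)) / east z = east (z' + (0, 1)) / east z'.
Proof.
have s0 : 0 < s := expR_gt0 _; have t0 : 0 < t := expR_gt0 _.
have Cab : h = 0 -> C = a + b by move=> ->; ring.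
have [tA|[h0 tB]] := types z; have [tA'|[h0' tB']] := types z'.
- exact: (cellA_similar a0 C0 s0 t0 (cellA_at tA) (cellA_at tA')).
- apply: (cell_similar a0 b0 s0 t0 (Cab h0') (mixed_types tA h0' tB')).
    by left; exact: cellA_at.
  by right; exact: cellB_at.
- apply: (cell_similar a0 b0 s0 t0 (Cab h0) (mixed_types tA' h0 tB)).
    by right; exact: cellB_at.
  by left; exact: cellA_at.
- exact: (cellB_similar a0 b0 s0 t0 (cellB_at h0 tB) (cellB_at h0' tB')).
Qed.

Lemma east_sqr z : dot (east z) (east z) = a * s * expR (4 * W z).
Proof. by have [/cellA_at[_ [-> _ _]]|[h0 /(cellB_at h0)[_ [-> _ _]]]] := types z. Qed.

Lemma north_sqr z : dot (north z) (north z) = b * t * expR (4 * W z).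
Proof. by have [/cellA_at[_ [_ -> _]]|[h0 /(cellB_at h0)[_ [_ -> _]]]] := types z. Qed.

Lemma east_neq0 z : east z != 0.
Proof. by rewrite -dot_eq0 east_sqr gt_eqF// !mulr_gt0 ?expR_gt0. Qed.

Lemma north_neq0 z : north z != 0.
Proof. by rewrite -dot_eq0 north_sqr gt_eqF// !mulr_gt0 ?expR_gt0. Qed.

Lemma dot_ratio (x y w : R[i]) (r : R) : x != 0 -> y = w * x -> dot y y = r * dot x x -> dot w w = r.
Proof. by move=> x0 ->; rewrite dotM => /mulIf -> //; rewrite gt_eqF// dot_gt0. Qed.

Hypothesis nz : (al != 0) || (be != 0).

(** By similarity, [east] is multiplied by fixed A and B along the two axes, and [north] is rho
    times [east], with rho (A - 1) = B - 1. As in a geometric progression, P z - east z / (A - 1) is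
    a constant p. A = 1 would force B = 1 and, comparing moduli, al = be = 0. *)
Lemma spiral : exists p (E : V -> R[i]), [/\ forall z, P z - p != 0,
  forall z x, P (z + x) - p = E x * (P z - p) &
  forall x, dot (E x) (E x) = expR (4 * increment x)].
Proof.
pose rho := north 0 / east 0; pose B := east (0 + (0, 1)) / east 0.
have rho0 : rho != 0 by rewrite mulf_neq0 ?invr_eq0 ?north_neq0 ?east_neq0.
have north_east z : north z = rho * east z.
  by have [e _] := similar_cells z 0; rewrite /rho -e divfK// east_neq0.
have east_v z : east (z + (0, 1)) = B * east z.
  by have [_ e] := similar_cells z 0; rewrite /B -e divfK// east_neq0.
pose A := (rho + B - 1) / rho.
have east_u z : east (z + (1, 0)) = A * east z.
  apply: (mulfI rho0); rewrite -north_east /A mulrA [rho * _]mulrC divfK//.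
  have -> : north (z + (1, 0)) = north z + east (z + (0, 1)) - east z.
    by rewrite /north /east zuv zvu; ring.
  by rewrite north_east east_v; ring.
have AB : rho * (A - 1) = B - 1 by rewrite /A mulrBr mulrC divfK// mulr1; ring.
have e0 z := east_neq0 z.
have dA : dot A A = s ^+ 2.
  apply: (dot_ratio (e0 0) (east_u 0)); rewrite !east_sqr W_u mulrDr expRD.
  by rewrite -expRM_natl (_ : 2%:R * (2 * al) = 4 * al); ring.
have dB : dot B B = t ^+ 2.
  apply: (dot_ratio (e0 0) (east_v 0)); rewrite !east_sqr W_v mulrDr expRD.
  by rewrite -expRM_natl (_ : 2%:R * (2 * be) = 4 * be); ring.
have A1 : A - 1 != 0.
  apply/negP => /eqP A1; have B1 : B - 1 = 0 by rewrite -AB A1 mulr0.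
  move/subr0_eq : A1 => A1; move/subr0_eq : B1 => B1.
  have d1 : dot 1 1 = 1 :> R by rewrite /dot /=; ring.
  have x0 (x : R) : 1 = expR (2 * x) ^+ 2 -> x = 0.
    rewrite -expRM_natl -{1}expR0 => /expR_inj; lra.
  move: dA dB nz; rewrite A1 B1 d1 => /x0 -> /x0 ->; rewrite eqxx //.
pose F z := east z / (A - 1).
have F0 z : F z != 0 by rewrite mulf_neq0 ?invr_eq0.
pose p := P 0 - F 0.
have Fp z : P z - p = F z.
  suff : P z - F z = p by move=> <-; ring.
  have st z' x : F (z' + x) - F z' = P (z' + x) - P z' -> P (z' + x) - F (z' + x) = P z' - F z'.
    move=> e; have -> : P (z' + x) = F (z' + x) - F z' + P z' by rewrite e subrK.
    by ring.
  have su z' : P (z' + (1, 0)) - F (z' + (1, 0)) = P z' - F z'.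
    apply: st; rewrite /F east_u -/(east z').
    have -> : A * east z' / (A - 1) - east z' / (A - 1) = (A - 1) * east z' / (A - 1) by ring.
    by rewrite mulrAC divff// mul1r.
  have sv z' : P (z' + (0, 1)) - F (z' + (0, 1)) = P z' - F z'.
    apply: st; rewrite /F east_v -/(north z') north_east.
    have -> : B * east z' / (A - 1) - east z' / (A - 1) = (B - 1) * east z' / (A - 1) by ring.
    by rewrite -AB mulrAC mulfK.
  elim/int_ind2: z => // z ez; split; rewrite ?su ?sv//.
    by rewrite -su subrK.
  by rewrite -sv subrK.
exists p, (fun x => F x / F 0).
have Fu z : F (z + (1, 0)) = A * F z by rewrite /F east_u mulrA.
have Fv z : F (z + (0, 1)) = B * F z by rewrite /F east_v mulrA.
have A0 : A != 0.
  by apply/negP => /eqP e; have := F0 (0 + (1, 0)); rewrite Fu e mul0r eqxx.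
have B0 : B != 0.
  by apply/negP => /eqP e; have := F0 (0 + (0, 1)); rewrite Fv e mul0r eqxx.
split=> [z|z x|x]; first by rewrite Fp.
  rewrite !Fp; apply: (mulIf (F0 0)); rewrite [RHS]mulrAC divfK//.
  elim/int_ind2: x => [|x IH]; first by rewrite addr0 mulrC.
  have mu z' : F (z' - (1, 0)) = A^-1 * F z' by rewrite -[in RHS](subrK (1, 0) z') Fu mulKf.
  have mv z' : F (z' - (0, 1)) = B^-1 * F z' by rewrite -[in RHS](subrK (0, 1) z') Fv mulKf.
  have st c y : (forall z', F (z' + y) = c * F z') -> F (z + (x + y)) * F 0 = F (x + y) * F z.
    by move=> e; rewrite addrA !e -(mulrA c (F (z + x))) -(mulrA c (F x)) IH.
  by split; apply: st; [exact: Fu|exact: mu|exact: Fv|exact: mv].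
apply: (dot_ratio (F0 0) (y := F x)); first by rewrite divfK.
have dF z : dot (F z) (F z) = dot (A - 1)^-1 (A - 1)^-1 * dot (east z) (east z) by rewrite /F mulrC dotM.
rewrite !dF !east_sqr -[x in LHS]add0r linear_W mulrDr expRD; ring.
Qed.

Lemma cross0_real (x y : R[i]) : x != 0 -> cross x y = 0 -> exists r : R, y = r%:C * x.
Proof.
move=> x0 c; have d0 : dot x x != 0 by rewrite gt_eqF// dot_gt0.
exists (dot x y / dot x x); apply: (mulfI (_ : (dot x x)%:C != 0)).
  by rewrite eq_complex /= negb_and d0.
rewrite mulrA -rmorphM /= mulrCA divff// mulr1.
have e : cross x y * complex.Im x = 0 /\ cross x y * complex.Re x = 0 by rewrite c !mul0r.
case: e; rewrite /dot /cross; case: (x) (y) => x1 x2 [y1 y2] /= e1 e2.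
by apply/eqP; rewrite eq_complex /=; apply/andP; split; apply/eqP; lra.
Qed.

Section Spiral.
Variables (p : R[i]) (E : V -> R[i]).
Hypothesis P_neq : forall z, P z - p != 0.
Hypothesis P_mul : forall z x, P (z + x) - p = E x * (P z - p).
Hypothesis E_sqr : forall x, dot (E x) (E x) = expR (4 * increment x).

Lemma spiralD x y : E (x + y) = E x * E y.
Proof.
apply: (mulIf (P_neq 0)); rewrite -P_mul addrA [E x * E y]mulrC -mulrA -!P_mul//.
Qed.

Lemma spiral0 : E 0 = 1.
Proof. by apply: (mulIf (P_neq 0)); rewrite -P_mul add0r mul1r. Qed.

Lemma bounded_increments : exists (v : nat -> V) (K : R),
  (forall n m, (n < m)%N -> v n != v m) /\ forall n, `|increment (v n)| <= K.
Proof.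
have [a1|a1] := eqVneq al 0.
  exists (fun n => (n%:Z, 0)), 0; split=> [n m lt|n].
    by apply/negP => /eqP [e]; rewrite e ltnn in lt.
  by rewrite /increment a1 /= mulr0 mul0r addr0 normr0.
exists (fun n => (Num.floor (- n%:R * be / al), n%:Z)), `|al|; split=> [n m lt|n].
  by apply/negP => /eqP [_ e]; rewrite e ltnn in lt.
rewrite /increment /= -[n%:~R]/(n%:R); set r := - _ * _ / _.
have -> : n%:R * be = - r * al by rewrite /r; field.
have -> : (Num.floor r)%:~R * al + - r * al = - ((r - (Num.floor r)%:~R) * al) by ring.
rewrite normrN normrM ler_piMl// ger0_norm ?subr_ge0 ?floor_le//.
by have := floorD1_gt r; rewrite rmorphD /=; lra.
Qed.

(** On infinitely many lattice points with bounded increment, E stays in a compact annulus. Two of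
    its values are close to each other, and their quotient is E of the difference. *)
Lemma near_return (e : R) : 0 < e -> exists k : V,
  [/\ k != 0, `|complex.Re (E k) - 1| < e & `|complex.Im (E k)| < e].
Proof.
move=> e0; have [v [K [vn vK]]] := bounded_increments.
pose w n := E (v n); pose M := 1 + expR (4 * K).
have M0 : 0 < M by rewrite /M addr_gt0 ?expR_gt0.
have wl n : expR (- (4 * K)) <= dot (w n) (w n).
  by rewrite E_sqr ler_expR; have := vK n; rewrite ler_norml => /andP[]; lra.
have wu n : dot (w n) (w n) <= expR (4 * K).
  by rewrite E_sqr ler_expR; have := vK n; rewrite ler_norml => /andP[]; lra.
have sq (r s' : R) : r ^+ 2 <= s' -> `|r| <= 1 + s'.
  by move=> rs; have := sqr_ge0 (`|r| - 1); have := normr_ge0 r; rewrite sqrrB1 (real_normK (num_real r)); lra.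
have reM n : `|complex.Re (w n)| <= M.
  by apply: sq; apply: le_trans (wu n); rewrite /dot -!expr2 lerDl sqr_ge0.
have imM n : `|complex.Im (w n)| <= M.
  by apply: sq; apply: le_trans (wu n); rewrite /dot -!expr2 lerDr sqr_ge0.
have [U [UU oU]] := @ultraFilterLemma nat \oo _.
have UF : ProperFilter U := ultra_proper (UltraFilter := UU).
have [lr hr] := ultra_bounded_cvg UU reM; have [li hi] := ultra_bounded_cvg UU imM.
pose e' := e * expR (- (4 * K)) / (8 * M).
have e'0 : 0 < e' by rewrite divr_gt0 ?mulr_gt0 ?expR_gt0.
have S1 : U [set n | `|lr - complex.Re (w n)| < e'] by move/cvgrPdist_lt: hr => /(_ _ e'0).
have S2 : U [set n | `|li - complex.Im (w n)| < e'] by move/cvgrPdist_lt: hi => /(_ _ e'0).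
have [n [n1 n2]] := filter_ex (filterI S1 S2).
have S3 : U [set m | (n < m)%N] by apply: oU; exact: nbhs_infty_gt.
have [m [[m1 m2] /= m3]] := filter_ex (filterI (filterI S1 S2) S3).
exists (v m - v n); set k := v m - v n.
have ek : E k * w n = w m by rewrite /w -spiralD subrK.
have d0 : 0 < dot (w n) (w n) by exact: lt_le_trans (expR_gt0 _) (wl n).
have small : forall r : R, `|dot (w n) (w n) * r| <= 4 * M * e' -> `|r| < e.
  move=> r; rewrite normrM (ger0_norm (ltW d0)) => le.
  have l1 : expR (- (4 * K)) * `|r| <= 4 * M * e'.
    by apply: le_trans le; rewrite ler_wpM2r.
  have q0 : 0 < expR (- (4 * K)) := expR_gt0 _.
  rewrite -(ltr_pM2l q0); apply: le_lt_trans l1 _; rewrite /e'.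
  have -> : 4 * M * (e * expR (- (4 * K)) / (8 * M)) = expR (- (4 * K)) * e / 2.
    by field; rewrite gt_eqF.
  by rewrite ltr_pdivrMr// ltr_pMr ?mulr_gt0// ltr1n.
have dRe : `|complex.Re (w m) - complex.Re (w n)| <= 2 * e'.
  rewrite (_ : _ - _ = (lr - complex.Re (w n)) - (lr - complex.Re (w m))); last by ring.
  by rewrite (le_trans (ler_normB _ _))//; move: n1 m1 => /=; lra.
have dIm : `|complex.Im (w m) - complex.Im (w n)| <= 2 * e'.
  rewrite (_ : _ - _ = (li - complex.Im (w n)) - (li - complex.Im (w m))); last by ring.
  by rewrite (le_trans (ler_normB _ _))//; move: n2 m2 => /=; lra.
have p1 := ler_pM (normr_ge0 _) (normr_ge0 _) (reM n) dRe.
have p2 := ler_pM (normr_ge0 _) (normr_ge0 _) (imM n) dIm.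
have p3 := ler_pM (normr_ge0 _) (normr_ge0 _) (reM n) dIm.
have p4 := ler_pM (normr_ge0 _) (normr_ge0 _) (imM n) dRe.
split; first by rewrite subr_eq0 eq_sym vn.
  apply: small; rewrite -!normrM in p1 p2.
  have -> : dot (w n) (w n) * (complex.Re (E k) - 1) =
      complex.Re (w n) * (complex.Re (w m) - complex.Re (w n)) +
      complex.Im (w n) * (complex.Im (w m) - complex.Im (w n)).
    by rewrite -ek /dot; case: (E k) (w n) => ? ? [? ?] /=; ring.
  by rewrite (le_trans (ler_normD _ _))//; lra.
apply: small; rewrite -!normrM in p3 p4.
have -> : dot (w n) (w n) * complex.Im (E k) =
    complex.Re (w n) * (complex.Im (w m) - complex.Im (w n)) -
    complex.Im (w n) * (complex.Re (w m) - complex.Re (w n)).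
  by rewrite -ek /dot; case: (E k) (w n) => ? ? [? ?] /=; ring.
by rewrite (le_trans (ler_normB _ _))//; lra.
Qed.

Definition returns : set_system V := filter_from [set e : R | 0 < e]
  (fun e => [set k | [/\ k != 0, `|complex.Re (E k) - 1| < e & `|complex.Im (E k)| < e]]).

Lemma returns_filter : ProperFilter returns.
Proof.
apply: filter_from_proper; last by move=> e /= /near_return.
apply: filter_from_filter; first by exists 1 => /=.
move=> e e' /= e0 e0'; exists (Num.min e e') => /=; first by rewrite lt_min e0 e0'.
by move=> k [k0]; rewrite !lt_min => /andP[h1 h2] /andP[h3 h4].
Qed.
#[local] Existing Instance returns_filter.

Lemma cvg_returns : cvgC returns E 1.
Proof.
split; apply/cvgrPdist_lt => e e0; exists e => // k [k0 h1 h2] /=; first by rewrite distrC.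
by rewrite distrC subr0.
Qed.

Lemma returns_neq0 : \forall k \near returns, k != 0.
Proof. by exists 1 => //= k []. Qed.

Lemma cvgC_mulr (I : Type) (F : set_system I) (c : I -> R[i]) (u w : R[i]) : Filter F ->
  cvgC F c u -> cvgC F (fun i => c i * w) (u * w).
Proof.
move=> FF [h1 h2]; split.
  have -> : (fun i => complex.Re (c i * w)) = (fun i => complex.Re (c i) * complex.Re w - complex.Im (c i) * complex.Im w).
    by apply/funext => i; case: (c i) (w) => ? ? [].
  rewrite (_ : complex.Re (u * w) = complex.Re u * complex.Re w - complex.Im u * complex.Im w); last by case: (u) (w) => ? ? [].
  by apply: cvgB; apply: cvgMl.
have -> : (fun i => complex.Im (c i * w)) = (fun i => complex.Re (c i) * complex.Im w + complex.Im (c i) * complex.Re w).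
  by apply/funext => i; case: (c i) (w) => ? ? [].
rewrite (_ : complex.Im (u * w) = complex.Re u * complex.Im w + complex.Im u * complex.Re w); last by case: (u) (w) => ? ? [].
by apply: cvgD; apply: cvgMl.
Qed.

Lemma cvg_returns2 : cvgC returns (fun k => E (k + k)) 1.
Proof.
have -> : (fun k => E (k + k)) = (fun k => E k * E k) by apply/funext => k; exact: spiralD.
have [h1 h2] := cvg_returns; split.
  have -> : (fun i => complex.Re (E i * E i)) = (fun i => complex.Re (E i) * complex.Re (E i) - complex.Im (E i) * complex.Im (E i)).
    by apply/funext => i; case: (E i).
  rewrite (_ : complex.Re 1 = complex.Re (1 : R[i]) * complex.Re (1 : R[i]) - complex.Im (1 : R[i]) * complex.Im (1 : R[i])); last by rewrite /=; ring.
  by apply: cvgB; apply: cvgM.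
have -> : (fun i => complex.Im (E i * E i)) = (fun i => complex.Re (E i) * complex.Im (E i) + complex.Im (E i) * complex.Re (E i)).
  by apply/funext => i; case: (E i).
rewrite (_ : complex.Im 1 = complex.Re (1 : R[i]) * complex.Im (1 : R[i]) + complex.Im (1 : R[i]) * complex.Re (1 : R[i])); last by rewrite /=; ring.
by apply: cvgD; apply: cvgM.
Qed.

Lemma area_spiral z (w1 w2 w3 : R[i]) x1 x2 x3 :
  P x1 - p = w1 * (P z - p) -> P x2 - p = w2 * (P z - p) -> P x3 - p = w3 * (P z - p) ->
  area (P x1) (P x2) (P x3) = dot (P z - p) (P z - p) * area w1 w2 w3.
Proof.
have e u d : u - p = d -> u = d + p by move=> <-; rewrite subrK.
move=> /e -> /e -> /e ->; rewrite /area /cross /dot; move: (P z - p) => f.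
by case: w1 w2 w3 (f) (p) => ? ? [? ?] [? ?] [? ?] [? ?] /=; ring.
Qed.

(** As E (f k) tends to 1, the translate by f k approaches the triangle itself, uniformly in z up to
    a similarity, and [adm_overlap] forbids this. *)
Lemma overlap_near (f : V -> V) x1 x2 x3 :
  cvgC returns (fun k => E (f k)) 1 -> (forall k, k != 0 -> f k != 0) ->
  det2 (R := R) (x2 - x1) (x3 - x1) = 1 -> 0 < area (E x1) (E x2) (E x3) ->
  \forall k \near returns, forall z, Tr (z + x1) (z + x2) (z + x3) ->
    ~ Tr (z + f k + x1) (z + f k + x2) (z + f k + x3).
Proof.
move=> cf f0 D A0.
pose S u v k := area (E u) (E v) (E (f k) * E x1) + area (E u) (E v) (E (f k) * E x2) +
  area (E u) (E v) (E (f k) * E x3).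
have cS u v : S u v k @[k --> returns] --> area (E u) (E v) (1 * E x1) +
    area (E u) (E v) (1 * E x2) + area (E u) (E v) (1 * E x3).
  by apply: cvgD; [apply: cvgD|]; apply: cvg_area; try exact: cvgC_cst; exact: cvgC_mulr.
have a1 (u v w : R[i]) : area u v u = 0 /\ area u v v = 0.
  by rewrite /area /cross; case: u v => ? ? [? ?] /=; split; ring.
have [z1 z2] := a1 (E x1) (E x2) 0; have [z3 z4] := a1 (E x2) (E x3) 0; have [z5 z6] := a1 (E x3) (E x1) 0.
have S1 : \forall k \near returns, 0 < S x1 x2 k.
  by apply: (near_gt0 (cS _ _)); rewrite !mul1r z1 z2 !add0r.
have S2 : \forall k \near returns, 0 < S x2 x3 k.
  by apply: (near_gt0 (cS _ _)); rewrite !mul1r z3 z4 !addr0 -areaC.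
have S3 : \forall k \near returns, 0 < S x3 x1 k.
  by apply: (near_gt0 (cS _ _)); rewrite !mul1r z5 z6 addr0 add0r areaC.
apply: filterS (filterI (filterI S1 S2) (filterI S3 returns_neq0)).
move=> k [[s1 s2] [s3 k0]] z tr tr'.
have d0 := dot_gt0 (P_neq z).
have sE u v : sum_area P (z + u) (z + v) (z + x1 + f k) (z + x2 + f k) (z + x3 + f k) =
    dot (P z - p) (P z - p) * S u v k.
  have e1 w : area (P (z + u)) (P (z + v)) (P (z + w + f k)) =
      dot (P z - p) (P z - p) * area (E u) (E v) (E (f k) * E w).
    by apply: area_spiral; rewrite !P_mul// mulrA.
  by rewrite /sum_area !e1 /S !mulrDr.
apply: (adm_overlap adm (f0 k k0)) tr _ _.
- rewrite -[RHS]D; congr (det2 _ _); apply: pair_ext => /=; ring.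
- by rewrite ![_ + _ + f k]addrAC.
- by rewrite !sE !mulr_gt0.
Qed.

Lemma spiral_sub z x y : P (z + x) - P (z + y) = (E x - E y) * (P z - p).
Proof. by rewrite mulrBl -!P_mul; ring. Qed.

Lemma area_typeA z : typeA z ->
  [/\ 0 <= area (E 0) (E (1, 0)) (E (0, 1)), 0 <= area (E (1, 1)) (E (0, 1)) (E (1, 0)) &
   E (1, 0) != E (0, 1)].
Proof.
move=> tA; have d0 := dot_gt0 (P_neq z); split.
- have := adm_area adm tA.1; rewrite (area_spiral (z := z) (w1 := E 0) (w2 := E (1, 0)) (w3 := E (0, 1))) ?P_mul//.
    by rewrite pmulr_rge0.
  by rewrite spiral0 mul1r.
- have := adm_area adm tA.2; rewrite (area_spiral (z := z) (w1 := E (1, 1)) (w2 := E (0, 1)) (w3 := E (1, 0))) ?P_mul//.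
  by rewrite pmulr_rge0.
- have [_ [_ _ e] _ _] := cellA_at tA; rewrite -subr_eq0.
  have e1 : east z - north z = (E (1, 0) - E (0, 1)) * (P z - p).
    by rewrite -spiral_sub /east /north; ring.
  apply/negP => /eqP E0; move: e; rewrite e1 E0 mul0r /dot /= !mul0r addr0 => /esym/eqP.
  by rewrite gt_eqF// !mulr_gt0 ?expR_gt0.
Qed.

Lemma area_typeB z : h = 0 -> typeB z ->
  [/\ 0 <= area (E 0) (E (1, 0)) (E (1, 1)), 0 <= area (E 0) (E (1, 1)) (E (0, 1)) &
   E (1, 1) != 1].
Proof.
move=> h0 tB; have d0 := dot_gt0 (P_neq z); split.
- have := adm_area adm tB.1; rewrite (area_spiral (z := z) (w1 := E 0) (w2 := E (1, 0)) (w3 := E (1, 1))) ?P_mul//.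
    by rewrite pmulr_rge0.
  by rewrite spiral0 mul1r.
- have := adm_area adm tB.2; rewrite (area_spiral (z := z) (w1 := E 0) (w2 := E (1, 1)) (w3 := E (0, 1))) ?P_mul//.
    by rewrite pmulr_rge0.
  by rewrite spiral0 mul1r.
- have [_ [_ _ e] _ _] := cellB_at h0 tB; rewrite -subr_eq0.
  have e1 : north z + east (z + (0, 1)) = (E (1, 1) - 1) * (P z - p).
    by rewrite -spiral0 -spiral_sub addr0 /east /north zuv; ring.
  apply/negP => /eqP E0; move: e; rewrite e1 E0 mul0r /dot /= !mul0r addr0 => /esym/eqP.
  by rewrite gt_eqF// !mulr_gt0 ?expR_gt0 ?addr_gt0.
Qed.

Lemma spiral_u_neq1 : E (1, 0) != 1.
Proof.
rewrite -subr_eq0; apply/negP => /eqP e; have := east_neq0 0.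
rewrite /east -{2}[0 : V]addr0 spiral_sub spiral0 e mul0r eqxx//.
Qed.

Lemma spiral_v_neq1 : E (0, 1) != 1.
Proof.
rewrite -subr_eq0; apply/negP => /eqP e; have := north_neq0 0.
rewrite /north -{2}[0 : V]addr0 spiral_sub spiral0 e mul0r eqxx//.
Qed.

Lemma spiral_uv : E (1, 1) = E (1, 0) * E (0, 1).
Proof. by rewrite -spiralD; congr E; apply: pair_ext. Qed.

Definition spiral_real := complex.Im (E (1, 0)) = 0 /\ complex.Im (E (0, 1)) = 0.

(** If both triangles are flat, then 1, A, B and AB are collinear, where A and B are the values of E
    on the axes. With B = 1 + r (A - 1) this makes A real. *)
Lemma flat_typeA z : typeA z -> area (E 0) (E (1, 0)) (E (0, 1)) = 0 ->
  area (E (1, 1)) (E (0, 1)) (E (1, 0)) = 0 -> spiral_real.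
Proof.
move=> tA; have [_ _ ne] := area_typeA tA.
have A1 : E (1, 0) - 1 != 0 by rewrite subr_eq0 spiral_u_neq1.
rewrite /area spiral0 => /(cross0_real A1)[r B1] c.
have {}B1 : E (0, 1) = 1 + r%:C * (E (1, 0) - 1) by rewrite -B1; ring.
have r0 : r != 0.
  by apply/eqP => r0; move: spiral_v_neq1; rewrite B1 r0 mul0r addr0 eqxx.
have r1 : 1 - r != 0.
  rewrite subr_eq0; apply/eqP => r1; move: ne; rewrite B1 -r1 mul1r.
  by rewrite addrC subrK eqxx.
have d0 : dot (E (1, 0) - 1) (E (1, 0) - 1) != 0 by rewrite gt_eqF// dot_gt0.
have : r * dot (E (1, 0) - 1) (E (1, 0) - 1) * (1 - r) * complex.Im (E (1, 0)) = 0.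
  move: c; rewrite spiral_uv B1; case: (E (1, 0)) => x y; rewrite /cross /dot /= => c.
  by rewrite -[RHS]c; ring.
move=> /eqP; rewrite !mulf_eq0 (negPf r0) (negPf r1) (negPf d0) /= => /eqP i0.
by split=> //; rewrite B1; move: i0; case: (E (1, 0)) => x y /= ->; ring.
Qed.

Lemma flat_typeB z : h = 0 -> typeB z -> area (E 0) (E (1, 0)) (E (1, 1)) = 0 ->
  area (E 0) (E (1, 1)) (E (0, 1)) = 0 -> spiral_real.
Proof.
move=> h0 tB; have [_ _ ne] := area_typeB h0 tB.
have D0 : E (1, 1) - 1 != 0 by rewrite subr_eq0.
rewrite /area spiral0 => c1 /(cross0_real D0)[r' B1].
have [r A1] : exists r : R, E (1, 0) - 1 = r%:C * (E (1, 1) - 1).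
  by apply: (cross0_real D0); rewrite crossNC c1 oppr0.
set d := E (1, 1) - 1 in D0 A1 B1.
have r0 : r != 0.
  by apply/eqP => r0; move: spiral_u_neq1; rewrite -subr_eq0 A1 r0 mul0r eqxx.
have r0' : r' != 0.
  by apply/eqP => r0'; move: spiral_v_neq1; rewrite -subr_eq0 B1 r0' mul0r eqxx.
have {}A1 : E (1, 0) = 1 + r%:C * d by rewrite -A1; ring.
have {}B1 : E (0, 1) = 1 + r'%:C * d by rewrite -B1; ring.
have e : 1 = (r + r')%:C + (r * r')%:C * d.
  apply: (mulIf D0); rewrite mul1r {1}/d spiral_uv A1 B1 !rmorphD !rmorphM /=; ring.
have i0 : complex.Im d = 0.
  have := congr1 (@complex.Im R) e; case: (d) => x y /=; rewrite mul0r addr0 add0r => /esym/eqP.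
  by rewrite !mulf_eq0 (negPf r0) (negPf r0') /= => /eqP.
by split; rewrite ?A1 ?B1; move: i0; case: (d) => x y /= ->; ring.
Qed.

Lemma same_type_near (f : V -> V) : ~ spiral_real ->
  cvgC returns (fun k => E (f k)) 1 -> (forall k, k != 0 -> f k != 0) ->
  \forall k \near returns, forall z, (typeA z -> ~ typeA (z + f k)) /\
    (h = 0 -> typeB z -> ~ typeB (z + f k)).
Proof.
move=> nr cf f0.
have tri x1 x2 x3 : det2 (R := R) (x2 - x1) (x3 - x1) = 1 ->
    \forall k \near returns, 0 < area (E x1) (E x2) (E x3) -> forall z,
      Tr (z + x1) (z + x2) (z + x3) -> ~ Tr (z + f k + x1) (z + f k + x2) (z + f k + x3).
  move=> D; have [A0|A0] := boolP (0 < area (E x1) (E x2) (E x3)).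
    by apply: filterS (overlap_near cf f0 D A0) => k.
  by apply: filterE.
have d1 : det2 ((1, 0) - 0) ((0, 1) - 0) = 1 :> R by rewrite /det2 /=; ring.
have d2 : det2 ((0, 1) - (1, 1)) ((1, 0) - (1, 1)) = 1 :> R by rewrite /det2 /=; ring.
have d3 : det2 ((1, 0) - 0) ((1, 1) - 0) = 1 :> R by rewrite /det2 /=; ring.
have d4 : det2 ((1, 1) - 0) ((0, 1) - 0) = 1 :> R by rewrite /det2 /=; ring.
apply: filterS (filterI (filterI (tri _ _ _ d1) (tri _ _ _ d2)) (filterI (tri _ _ _ d3) (tri _ _ _ d4))).
move=> k [[k1 k2] [k3 k4]] z; split=> [tA tA'|h0 tB tB'].
  have [p1 p2 _] := area_typeA tA.
  have [q1|q1] := ltP 0 (area (E 0) (E (1, 0)) (E (0, 1))).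
    by apply: (k1 q1 z); rewrite addr0; [exact: tA.1|exact: tA'.1].
  have [q2|q2] := ltP 0 (area (E (1, 1)) (E (0, 1)) (E (1, 0))).
    by apply: (k2 q2 z); [exact: tA.2|exact: tA'.2].
  by apply: nr; apply: (flat_typeA tA); apply/le_anti; rewrite ?p1 ?p2 andbT.
have [p1 p2 _] := area_typeB h0 tB.
have [q1|q1] := ltP 0 (area (E 0) (E (1, 0)) (E (1, 1))).
  by apply: (k3 q1 z); rewrite addr0; [exact: tB.1|exact: tB'.1].
have [q2|q2] := ltP 0 (area (E 0) (E (1, 1)) (E (0, 1))).
  by apply: (k4 q2 z); rewrite addr0; [exact: tB.2|exact: tB'.2].
by apply: nr; apply: (flat_typeB h0 tB); apply/le_anti; rewrite ?p1 ?p2 andbT.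
Qed.

(* Of three cells, two are cut in the same way; so an almost periodic spiral  *)
(* with a nondegenerate triangle overlaps itself.                             *)
Lemma spiral_is_real : spiral_real.
Proof.
apply: contrapT => nr.
have n1 := same_type_near nr cvg_returns (fun k k0 => k0).
have dbl (k : V) : k != 0 -> k + k != 0.
  apply: contraNN => /eqP e; apply/eqP; apply: pair_ext => /=.
    by have := congr1 fst e => /=; lia.
  by have := congr1 snd e => /=; lia.
have n2 := same_type_near nr cvg_returns2 dbl.
have [k [k1 k2]] := filter_ex (filterI n1 n2).
have [A0 B0] := k1 0; have [A1 B1] := k1 k; have [A2 B2] := k2 0.
rewrite add0r in A0 B0; rewrite add0r in A2 B2.
have [t0|[h0 t0]] := types 0; have [t1|[h1 t1]] := types k; have [t2|[h2 t2]] := types (k + k).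
- exact: A0 t0 t1.
- exact: A0 t0 t1.
- exact: A2 t0 t2.
- exact: B1 h1 t1 t2.
- exact: A1 t1 t2.
- exact: B2 h0 t0 t2.
- exact: B0 h0 t0 t1.
- exact: B0 h0 t0 t1.
Qed.

Lemma spiralN x (r : R) : E x = r%:C -> r != 0 -> E (- x) = (r^-1)%:C.
Proof.
move=> e r0; have r0' : r%:C != 0 by rewrite eq_complex /= negb_and r0.
apply: (mulIf r0'); rewrite -rmorphM /= mulVf// -e -spiralD addNr spiral0//.
Qed.

Lemma spiral_node e g (r q : R) m n : E e = r%:C -> E g = q%:C ->
  P (node 0 e g m n) - p = (r ^+ m * q ^+ n)%:C * (P 0 - p).
Proof.
move=> er gq; have pow x (c : R) k : E x = c%:C -> E (x *+ k) = (c ^+ k)%:C.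
  by move=> xc; elim: k => [|k IH]; [exact: spiral0|rewrite mulrS spiralD xc IH -rmorphM /= -exprS].
by rewrite /node -addrA P_mul spiralD (pow _ _ _ er) (pow _ _ _ gq) -rmorphM.
Qed.

Lemma cell2_turn e g : (forall z, cell2 Tr e g z) -> forall z, cell2 Tr g (- e) z.
Proof.
move=> c z; have rot := adm_rot adm.
have e1 : z - e + e = z by rewrite subrK.
have e2 : z + g - e = z - e + g by rewrite addrAC.
have := c (z - e); rewrite /cell2 e1 e2 => -[[t1 t2]|[t1 t2]]; [right|left]; split.
- exact: rot (rot _ _ _ t2).
- exact: rot.
- exact: rot.
- exact: rot (rot _ _ _ t2).
Qed.

Lemma power_unbounded (r M : R) : 1 < r -> exists N, M < r ^+ N.
Proof.
move=> r1; have d0 : 0 < r - 1 by rewrite subr_gt0.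
have bern N : 1 + N%:R * (r - 1) <= r ^+ N.
  elim: N => [|N IH]; first by rewrite mul0r addr0 expr0.
  have := ler_wpM2l (ltW (lt_trans ltr01 r1)) IH; rewrite -exprS; apply: le_trans.
  have n0 : 0 <= N%:R * (r - 1) * (r - 1) by rewrite !mulr_ge0 ?(ltW d0).
  by rewrite -natr1; lra.
have M0 : 0 <= `|M| / (r - 1) by rewrite divr_ge0// ltW.
exists (Num.bound (`|M| / (r - 1))); apply: lt_le_trans (bern _).
have := archi_boundP M0; rewrite ltr_pdivrMr//; have := ler_norm M; lra.
Qed.

(** The vertex m e + n g has abscissa r^m q^n from p, up to a positive factor: row m lies on the
    side (-1)^m and moves away from p when q > 1. For q < 1 both directions are reversed. *)
Lemma spiral_strip e g (r q : R) : det2 (R := R) e g = 1 -> (forall z, cell2 Tr e g z) ->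
  E e = r%:C -> E g = q%:C -> r < 0 -> 0 < q -> q != 1 -> False.
Proof.
wlog q1 : e g r q / 1 < q.
  move=> H D c er gq r0 q0 qn; have [lt|] := ltP 1 q; first exact: (H e g r q).
  rewrite le_eqVlt (negPf qn) /= => lt.
  apply: (H (- e) (- g) r^-1 q^-1) => //.
  - by rewrite invf_gt1.
  - by rewrite -[RHS]D /det2 /= !rmorphN /=; ring.
  - by apply: cell2_turn; exact: cell2_turn.
  - by apply: spiralN => //; rewrite lt_eqF.
  - by apply: spiralN => //; rewrite gt_eqF.
  - by rewrite invr_lt0.
  - by rewrite invr_gt0.
  - by rewrite invr_eq1.
move=> D c er gq r0 q0 _.
(* A power of q above 1, r^2 and r^-2 gives the four inequalities that close [strip_config]. *)
have [N hN] := power_unbounded (1 + r ^+ 2 + r ^- 2) q1.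
have f0 := dot_gt0 (P_neq 0).
have r2 : 0 < r ^+ 2 by rewrite exprn_even_gt0//= lt_eqF.
have r2' : 0 < r ^- 2 by rewrite invr_gt0.
have XE m n : dot (P 0 - p) (P (node 0 e g m n) - p) = r ^+ m * q ^+ n * dot (P 0 - p) (P 0 - p).
  by rewrite (spiral_node m n er gq) /dot; case: (P 0 - p) => ? ? /=; ring.
apply: (adm_strip adm (k := P 0 - p) (q := p) (z := 0) (e := e) (g := g) (N := N)) => //.
split=> [m n _ _|m n _ _|]; first exact: c.
  by rewrite XE !mulrA -exprMn mulN1r !mulr_gt0// exprn_gt0// oppr_gt0.
rewrite !XE !(ltr_pM2r f0) !expr0 !expr1 !mul1r !mulr1.
have qN : 1 < q ^+ N by lra.
split.
- by rewrite gtr_nMr.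
- by rewrite ltr_pMr.
- by lra.
- rewrite exprS -mulrA gtr_nMr//.
  have := ltr_pM2l r2 (r ^- 2) (q ^+ N); rewrite divff ?gt_eqF// => ->; lra.
Qed.

End Spiral.

Hypotheses (h_ge0 : 0 <= h) (h_a : h <= a) (h_b : h <= b).

(** The triangle has become the three points 1, r, q of a line. The conditions h >= 0, h <= a and h
    <= b each say that one of the points is not strictly between the two others. *)
Lemma collinear_A (r q k : R) : 0 < r -> 0 < q -> 0 < k -> r != 1 -> q != 1 ->
  (r - 1) ^+ 2 = a * r * k -> (q - 1) ^+ 2 = b * q * k ->
  (r - q) ^+ 2 = C * (r * q) * k -> False.
Proof.
move=> r0 q0 k0 r1 q1 e1 e2 e3.
have rq0 : 0 < r * q by rewrite mulr_gt0.
have c0 : 0 < r * q * k by rewrite mulr_gt0.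
have c1 : 0 <= (r - 1) * (q - 1) * (r + q).
  have -> : (r - 1) * (q - 1) * (r + q) = q * (r - 1) ^+ 2 + r * (q - 1) ^+ 2 - (r - q) ^+ 2 by ring.
  rewrite e1 e2 e3 (_ : _ - _ = 2 * h * (r * q * k)); last by ring.
  by rewrite mulr_ge0 ?mulr_ge0// ltW.
have c2 : 0 <= (r - q) * (r - 1) * (q + 1).
  have -> : (r - q) * (r - 1) * (q + 1) = q * (r - 1) ^+ 2 + (r - q) ^+ 2 - r * (q - 1) ^+ 2 by ring.
  rewrite e1 e2 e3 (_ : _ - _ = 2 * (a - h) * (r * q * k)); last by ring.
  by rewrite mulr_ge0 ?mulr_ge0 ?subr_ge0// ltW.
have c3 : 0 <= (q - r) * (q - 1) * (r + 1).
  have -> : (q - r) * (q - 1) * (r + 1) = r * (q - 1) ^+ 2 + (r - q) ^+ 2 - q * (r - 1) ^+ 2 by ring.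
  rewrite e1 e2 e3 (_ : _ - _ = 2 * (b - h) * (r * q * k)); last by ring.
  by rewrite mulr_ge0 ?mulr_ge0 ?subr_ge0// ltW.
have rq : r != q.
  rewrite -subr_eq0 -sqrf_eq0 e3 gt_eqF// -mulrA mulr_gt0//.
rewrite pmulr_lge0 ?addr_gt0// in c1; rewrite pmulr_lge0 ?addr_gt0// in c2.
rewrite pmulr_lge0 ?addr_gt0// in c3.
move: r1; rewrite neq_lt => /orP[r1|r1].
  have q1' : q <= 1 by move: c1; rewrite nmulr_rge0 ?subr_lt0// subr_le0.
  have {}q1 : q < 1 by rewrite lt_neqAle q1.
  move: c2; rewrite nmulr_lge0 ?subr_lt0// subr_le0 => l1.
  move: c3; rewrite nmulr_lge0 ?subr_lt0// subr_le0 => l2.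
  by move: rq; rewrite eq_le l1 l2.
have q1' : 1 <= q by move: c1; rewrite pmulr_rge0 ?subr_gt0// subr_ge0.
have {}q1 : 1 < q by rewrite lt_neqAle eq_sym q1.
move: c2; rewrite pmulr_lge0 ?subr_gt0// subr_ge0 => l1.
move: c3; rewrite pmulr_lge0 ?subr_gt0// subr_ge0 => l2.
by move: rq; rewrite eq_le l1 l2.
Qed.

Lemma collinear_B (r q k : R) : 0 < r -> 0 < q -> r != 1 -> q != 1 ->
  (r - 1) ^+ 2 = a * r * k -> (q - 1) ^+ 2 = b * q * k ->
  (r * q - 1) ^+ 2 = (a + b) * (r * q) * k -> False.
Proof.
move=> r0 q0 r1 q1 e1 e2 e3.
have : (r - 1) * (q - 1) * (r * q + 1) = 0.
  have -> : (r - 1) * (q - 1) * (r * q + 1) = (r * q - 1) ^+ 2 - q * (r - 1) ^+ 2 - r * (q - 1) ^+ 2 by ring.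
  by rewrite e1 e2 e3; ring.
move/eqP; rewrite !mulf_eq0 !subr_eq0 (negPf r1) (negPf q1) /= gt_eqF//.
by rewrite addr_gt0// mulr_gt0.
Qed.

(** Meant for the moduli of two negative multipliers, whence r + 1 and q + 1: a cell cut by the
    first diagonal cannot coexist with one cut by the second. *)
Lemma collinear_mixed (r q k : R) : 0 < r -> 0 < q -> r = 1 \/ q = 1 ->
  (r + 1) ^+ 2 = a * r * k -> (q + 1) ^+ 2 = b * q * k ->
  (r - q) ^+ 2 = (a + b) * (r * q) * k -> False.
Proof.
move=> r0 q0 rq e1 e2 e3.
have : (r - q) ^+ 2 = q * (r + 1) ^+ 2 + r * (q + 1) ^+ 2 by rewrite e1 e2 e3; ring.
case: rq => ->; [have -> : (1 - q) ^+ 2 = q * (1 + 1) ^+ 2 + 1 * (q + 1) ^+ 2 - 8 * q by ring|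
  have -> : (r - 1) ^+ 2 = 1 * (r + 1) ^+ 2 + r * (1 + 1) ^+ 2 - 8 * r by ring]; lra.
Qed.

(** Positive multipliers are excluded by collinearity, multipliers of different signs by a strip
    along the axes. If both are negative, all cells are cut in the same way, and the diagonal, an
    edge direction with positive multiplier, takes the place of an axis. *)
Theorem linear_contradiction : False.
Proof.
have [p [E [P_neq P_mul E_sqr]]] := spiral.
have E0 := spiral0 P_neq P_mul; have ED := spiralD P_neq P_mul.
have [iu iv] := spiral_is_real P_neq P_mul E_sqr.
have su := spiral_u_neq1 P_neq P_mul; have sv := spiral_v_neq1 P_neq P_mul.
have qu := E_sqr (1, 0); have qv := E_sqr (0, 1).
rewrite increment_u in qu; rewrite increment_v in qv.
have [r Er] : exists r : R, E (1, 0) = r%:C.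
  by exists (complex.Re (E (1, 0))); move: iu; case: (E (1, 0)) => x y /= ->.
have [q Eq] : exists q : R, E (0, 1) = q%:C.
  by exists (complex.Re (E (0, 1))); move: iv; case: (E (0, 1)) => x y /= ->.
have r1 : r != 1 by apply: contraNneq su => r1; rewrite Er r1.
have q1 : q != 1 by apply: contraNneq sv => q1; rewrite Eq q1.
have s0 : 0 < s := expR_gt0 _; have t0 : 0 < t := expR_gt0 _.
have absr : `|r| = s.
  apply/eqP; rewrite -(eqrXn2 (n := 2)) ?normr_ge0 ?expR_ge0// (real_normK (num_real r)).
  move: qu; rewrite Er /dot /= mulr0 addr0 -expr2 => ->; rewrite -expRM_natl; apply/eqP; congr expR; ring.
have absq : `|q| = t.
  apply/eqP; rewrite -(eqrXn2 (n := 2)) ?normr_ge0 ?expR_ge0// (real_normK (num_real q)).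
  move: qv; rewrite Eq /dot /= mulr0 addr0 -expr2 => ->; rewrite -expRM_natl; apply/eqP; congr expR; ring.
have r0 : r != 0 by rewrite -normr_eq0 absr gt_eqF.
have q0 : q != 0 by rewrite -normr_eq0 absq gt_eqF.
have F0 z := dot_gt0 (P_neq z).
pose k := (r - 1) ^+ 2 / (a * s).
have scale (c : R) z : dot (c%:C * (P z - p)) (c%:C * (P z - p)) = c ^+ 2 * dot (P z - p) (P z - p).
  by rewrite dotM /dot /=; ring.
have sub1 x (c : R) : E x = c%:C -> forall z, P (z + x) - P z = (c - 1)%:C * (P z - p).
  by move=> e z; rewrite rmorphB /= mulrBl mul1r -e -P_mul; ring.
have om z : expR (4 * W z) = k * dot (P z - p) (P z - p).
  have := east_sqr z; rewrite /east (sub1 _ _ Er) scale => e.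
  have n0 : a * s != 0 by rewrite mulf_neq0// gt_eqF.
  by apply: (mulfI n0); rewrite -e /k mulrA [a * s * _]mulrC divfK.
have k0 : 0 < k by have := expR_gt0 (4 * W 0); rewrite om pmulr_lgt0.
have ek1 : (r - 1) ^+ 2 = a * s * k by rewrite /k mulrC divfK// mulf_neq0// gt_eqF.
have ek2 : (q - 1) ^+ 2 = b * t * k.
  have := north_sqr 0; rewrite /north (sub1 _ _ Eq) scale om mulrA => /mulIf -> //.
  by rewrite gt_eqF.
have ekA z : typeA z -> (r - q) ^+ 2 = C * (s * t) * k.
  move=> /cellA_at[_ [_ _ +] _ _].
  have -> : east z - north z = (r - q)%:C * (P z - p).
    by rewrite /east /north (sub1 _ _ Er) (sub1 _ _ Eq) !rmorphB /=; ring.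
  by rewrite scale om mulrA => /mulIf -> //; rewrite gt_eqF.
have Euv : E (1, 1) = (r * q)%:C by rewrite (spiral_uv P_neq P_mul) Er Eq -rmorphM.
have ekB z : h = 0 -> typeB z -> (r * q - 1) ^+ 2 = (a + b) * (s * t) * k.
  move=> h0 /(cellB_at h0)[_ [_ _ +] _ _].
  have -> : north z + east (z + (0, 1)) = (r * q - 1)%:C * (P z - p).
    by rewrite -(sub1 _ _ Euv) /north /east zuv; ring.
  by rewrite scale om mulrA => /mulIf -> //; rewrite gt_eqF.
have cuv z : cell2 Tr (1, 0) (0, 1) z.
  by rewrite /cell2 zvu; have [[]|[_ []]] := types z; [left|right].
have D : det2 (1, 0) (0, 1) = 1 :> R by rewrite /det2 /=; ring.
move: r0; rewrite neq_lt => /orP[r0|r0]; move: q0; rewrite neq_lt => /orP[q0|q0].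
- rewrite ltr0_norm// in absr; rewrite ltr0_norm// in absq.
  have [allA|/existsNP[z1 nA]] := pselect (forall z, typeA z).
    apply: (spiral_strip P_neq P_mul (e := (1, 0)) (g := (-1, 1)) (r := r) (q := q / r)) => //.
    + by rewrite /det2 /=; ring.
    + move=> z; right.
      have e1 : z + (1, 0) + (-1, 1) = z + (0, 1) by apply: pair_ext => /=; ring.
      rewrite e1; split; first exact: (allA z).1.
      have := (allA (z + (-1, 0))).2.
      have -> : z + (-1, 0) + (1, 1) = z + (0, 1) by apply: pair_ext => /=; ring.
      have -> : z + (-1, 0) + (0, 1) = z + (-1, 1) by apply: pair_ext => /=; ring.
      have -> : z + (-1, 0) + (1, 0) = z by apply: pair_ext => /=; ring.
      by move=> tr; exact: (adm_rot adm (adm_rot adm tr)).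
    + have -> : (-1, 1) = - (1, 0) + (0, 1) :> V by [].
      by rewrite ED (spiralN P_neq P_mul Er) ?lt_eqF// Eq -rmorphM /= mulrC.
    + by rewrite nmulr_lgt0// invr_lt0.
    + apply/eqP => e; have := ekA 0 (allA 0).
      have -> : q = r by rewrite -[q](divfK (_ : r != 0)) ?lt_eqF// e mul1r.
      by rewrite subrr expr0n /= => /esym/eqP; rewrite gt_eqF// (mulr_gt0 (mulr_gt0 C0 (mulr_gt0 s0 t0)) k0).
  have [//|[h0 tB1]] := types z1.
  have Cab : C = a + b by rewrite h0; ring.
  have allB z : typeB z.
    have [tA|[_ //]] := types z; exfalso.
    apply: (@collinear_mixed s t k) => //; first exact: mixed_types tA h0 tB1.
    + by rewrite -ek1 -absr; ring.
    + by rewrite -ek2 -absq; ring.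
    + by rewrite -Cab -(ekA z tA) -absr -absq; ring.
  apply: (spiral_strip P_neq P_mul (e := (1, 0)) (g := (1, 1)) (r := r) (q := r * q)) => //.
  + by rewrite /det2 /=; ring.
  + move=> z; left; split; first exact: (allB z).1.
    have := (allB (z + (1, 0))).2; rewrite zvu => tr.
    exact: (adm_rot adm tr).
  + by rewrite nmulr_lgt0.
  + apply/eqP => e; have := ekB 0 h0 (allB 0); rewrite e subrr expr0n /= => /esym/eqP.
    by rewrite gt_eqF// (mulr_gt0 (mulr_gt0 (addr_gt0 a0 b0) (mulr_gt0 s0 t0)) k0).
- by apply: (spiral_strip P_neq P_mul D cuv Er Eq).
- apply: (spiral_strip P_neq P_mul (e := (0, 1)) (g := - (1, 0)) (r := q) (q := r^-1)) => //.
  + by rewrite /det2 /=; ring.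
  + exact: cell2_turn.
  + by apply: (spiralN P_neq P_mul) => //; rewrite gt_eqF.
  + by rewrite invr_gt0.
  + by rewrite invr_eq1.
- rewrite gtr0_norm// in absr; rewrite gtr0_norm// in absq.
  rewrite -absr in ek1 ekA ekB; rewrite -absq in ek2 ekA ekB.
  have [tA|[h0 tB]] := types 0.
    exact: (collinear_A r0 q0 k0 r1 q1 ek1 ek2 (ekA 0 tA)).
  exact: (collinear_B r0 q0 r1 q1 ek1 ek2 (ekB 0 h0 tB)).
Qed.

End Linear.

(* A maximising sequence of translates would produce a nonconstant linear     *)
(* limit.                                                                     *)
Theorem admissible_constant {R : realType} (a b h : R) (W : int * int -> R) P Tr :
  0 < a -> 0 < b -> 0 < a + b - 2 * h -> 0 <= h -> h <= a -> h <= b ->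
  admissible a b h W P Tr -> forall z, W z = W 0.
Proof.
move=> a0 b0 C0 h0 ha hb adm z; apply/eqP; apply: contrapT => /negP ne.
have [W' [P' [Tr' [al [be [adm' nz Wu Wv]]]]]] := linear_limit a0 b0 C0 adm (ex_intro _ z ne).
exact: (linear_contradiction a0 b0 C0 adm' Wu Wv nz h0 ha hb).
Qed.

(** * The theorem *)

Section Assembly.
Context {R : realType} (T : set {fset R[i]}) (w : R[i] -> R).
Local Notation l := (vertex_scaling w cdist).
Local Notation V := (int * int)%type.
Hypotheses (gT : geometric_triangulation T) (latT : lattice (vertices T))
  (delT : Delaunay T cdist) (plT : PL_metric T l) (delw : Delaunay T l).

Lemma developing_conj f : developing T l f -> developing T l (conjc \o f).
Proof.
move=> [fi fT]; split.
  by move=> x y /= e; apply: fi; case: (f x) (f y) e => x1 x2 [y1 y2] [-> /oppr_inj ->].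
move=> a b c t; have [h1 h2 h3] := fT a b c t; split.
- by rewrite -h1 /dot /=; case: (f a) (f b) => ? ? [? ?] /=; ring.
- apply: contraNN h2 => /eqP e; apply/eqP; rewrite -[RHS]oppr0 -[in RHS]e /area /cross /=.
  by case: (f a) (f b) (f c) => ? ? [? ?] [? ?] /=; ring.
- move=> x y x0 y0 xy; rewrite /= h3//.
  by case: (f a) (f b) (f c) => ? ? [? ?] [? ?] /=; congr (_ +i* _); ring.
Qed.

(** A triangle without obtuse angles has at most one right angle; its corner is called a, so that
    the edges from a form a [frame]. *)
Lemma acute_corner : exists a b c, [/\ T [fset a; b; c]%fset, 0 < area a b c,
  0 <= dot (b - a) (c - a), 0 < dot (a - b) (c - b) & 0 < dot (a - c) (b - c)].
Proof.
have [hull_tri _ cover _] := gT; have [t Tt _] := cover 0.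
have [a [b [c [te _]]]] := hull_tri t Tt; rewrite te in Tt.
wlog Db : a b c {te} Tt / 0 < dot (a - b) (c - b) /\ 0 < dot (a - c) (b - c).
  move=> H; have [ab ac bc] := area_neq (geometric_area gT Tt).
  have na := nonobtuse gT latT delT Tt.
  have Tb : T [fset b; c; a]%fset by rewrite -fset3_rot.
  have Tc : T [fset c; a; b]%fset by rewrite -fset3_rot.
  have nb := nonobtuse gT latT delT Tb; have nc := nonobtuse gT latT delT Tc.
  have sum x y z : dot (y - x) (z - x) + dot (z - y) (x - y) = dot (y - x) (y - x) :> R.
    by rewrite /dot; case: x y z => ? ? [? ?] [? ?] /=; ring.
  have pos (x y : R[i]) : x != y -> 0 < dot (y - x) (y - x).
    by move=> xy; apply: dot_gt0; rewrite subr_eq0 eq_sym.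
  have s1 := sum a b c; have s2 := sum b c a; have s3 := sum c a b.
  have p1 := pos _ _ ab; have p2 := pos _ _ bc; have p3 : 0 < dot (a - c) (a - c) by apply: pos; rewrite eq_sym.
  have [hb|hb] := ltP 0 (dot (c - b) (a - b)); last first.
    apply: (H b c a) => //.
    by split; [rewrite dotC|]; lra.
  have [hc|hc] := ltP 0 (dot (a - c) (b - c)); last first.
    apply: (H c a b) => //.
    by split; [rewrite dotC|]; lra.
  by apply: (H a b c) => //; rewrite dotC.
have An := geometric_area gT Tt; have na := nonobtuse gT latT delT Tt.
have [p|n] := ltP 0 (area a b c); first by exists a, b, c; case: Db.
exists a, c, b; rewrite -fset3_swap; split=> //.
- by rewrite areaN oppr_gt0 lt_neqAle An.
- by rewrite dotC.
- by case: Db.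
- by case: Db.
Qed.

Section Corner.
Variables (f : R[i] -> R[i]) (o u v : R[i]).
Hypotheses (fdev : developing T l f) (uv0 : 0 < cross u v) (cellT : forall z, cell T f o u v z (1, 0) (0, 1)).
Local Notation pos := (pos o u v).
Local Notation Tr := (fun x y z => tri T f o u v x y z /\ 0 < area (pos x) (pos y) (pos z)).

Lemma qform_dist (x y : V) : qform (dot u u) (dot v v) (dot u v) (x - y) = cdist (pos x) (pos y) ^+ 2.
Proof. by rewrite cdist_sqr pos_sub -/(bil u v (x - y) (x - y)) bilE /qform; ring. Qed.

Lemma scaled_length (x y : V) :
  l (pos x) (pos y) = expR (w (pos x)) * expR (w (pos y)) * cdist (pos x) (pos y).
Proof. by rewrite /vertex_scaling expRD. Qed.

Lemma area_pos (x y z : V) : area (pos x) (pos y) (pos z) = det2 (y - x) (z - x) * cross u v.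
Proof.
rewrite /area !pos_sub !vecE /det2 /cross; case: u v => ? ? [? ?] /=; ring.
Qed.

(** Only triangles that are counterclockwise in the lattice plane are kept; the coherence built into
    [tri] makes their images counterclockwise too. *)
Lemma embedded_of_triangulation :
  embedded (dot u u) (dot v v) (dot u v) (w \o pos) (f \o pos) Tr.
Proof.
have [fi fT] := fdev.
split.
- by move=> x y z [t A]; split; [exact: tri_rot|rewrite -areaC].
- move=> x y z [[t _] _]; have [-> _ _] := fT _ _ _ t.
  by rewrite scaled_length exprMn qform_dist mulrC.
- by move=> x y z [[_ +] A]; rewrite pmulr_rgt0.
- move=> x y c d [[t _] A] [[t' _] A'].
  have cd : pos c != pos d.
    apply/eqP => e; move: A'; rewrite -e areaC areaN oppr_gt0 -areaC => A'.
    by move: A; rewrite areaC areaC => A; have := lt_trans A A'; rewrite ltxx.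
  have {}t' : T [fset pos x; pos y; pos d]%fset by rewrite fset3_swap -fset3_rot.
  have E (r p q : V) : dcos (dot u u) (dot v v) (dot u v) (w \o pos) r p q = cosang l (pos r) (pos p) (pos q).
    have sq (p' q' : V) : Num.sqrt (cdist (pos p') (pos q') ^+ 2) = cdist (pos p') (pos q').
      by rewrite sqrtr_sqr ger0_norm// cdistE sqrtr_ge0.
    by rewrite /dcos /cosang !qform_dist !sq !scaled_length /=; congr (_ / _); ring.
  by rewrite !E; apply: (Delaunay_cosang gT plT delw t t').
- move=> z; have [[t1 t2]|[h0 t1 t2]] := cellT z; [left|right].
    have e : z + (1, 0) + (0, 1) = z + (1, 1) by apply: pair_ext => /=; ring.
    rewrite e in t2; split; split=> //; rewrite ?area_pos.
    + rewrite (_ : det2 _ _ = 1) ?mul1r// /det2 /= !rmorphB !rmorphD /=; ring.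
    + exact: tri_swap.
    + rewrite (_ : det2 _ _ = 1) ?mul1r// /det2 /= !rmorphB !rmorphD /=; ring.
  have e : z + (1, 0) + (0, 1) = z + (1, 1) by apply: pair_ext => /=; ring.
  rewrite e in t1 t2; split.
  + by move: h0; rewrite bilE /=; lra.
  + split=> //; rewrite area_pos (_ : det2 _ _ = 1) ?mul1r// /det2 /= !rmorphB !rmorphD /=; ring.
  + split; first exact: tri_swap.
    rewrite area_pos (_ : det2 _ _ = 1) ?mul1r// /det2 /= !rmorphB !rmorphD /=; ring.
- move=> x y z x' y' z' p q r p' q' r' [[t _] _] [[t' _] _] p0 q0 r0 s p0' q0' r0' s' /=.
  rewrite -(developing_comb fdev t p0 q0 r0 s) -(developing_comb fdev t' p0' q0' r0' s') => /fi.
  have comb (x1 x2 x3 : V) (k1 k2 k3 : R) : k1 + k2 + k3 = 1 ->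
     k1%:C * pos x1 + k2%:C * pos x2 + k3%:C * pos x3 = o +
     (k1 * x1.1%:~R + k2 * x2.1%:~R + k3 * x3.1%:~R)%:C * u +
     (k1 * x1.2%:~R + k2 * x2.2%:~R + k3 * x3.2%:~R)%:C * v.
    move=> ks; have e0 : o = (k1 + k2 + k3)%:C * o by rewrite ks mul1r.
    rewrite [in RHS]e0.
    by rewrite /pos !vecE !rmorphD !rmorphM /=; ring.
  rewrite !comb// => e.
  have /R_independentP ind : cross u v != 0 by rewrite gt_eqF.
  have uniq_coord (A B A' B' : R) : o + A%:C * u + B%:C * v = o + A'%:C * u + B'%:C * v -> A = A' /\ B = B'.
    move=> E; have [] := ind (A - A') (B - B'); last by move=> /subr0_eq ? /subr0_eq ?.
    by rewrite !rmorphB /=; move/eqP: E; rewrite -subr_eq0 => /eqP <-; ring.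
  exact: uniq_coord.
Qed.

End Corner.

(** Composing f with complex conjugation, if necessary, makes it respect the orientation of the
    chosen triangle; this triangle then provides the basis in which all vertices are written. *)
Lemma scaling_constant f : developing T l f -> exists k, forall x, vertices T x -> w x = k.
Proof.
move=> fdev; have [a [b [c [t A0 da db dc]]]] := acute_corner.
wlog fA : f fdev / 0 < area (f a) (f b) (f c).
  move=> H; have [p|n] := ltP 0 (area (f a) (f b) (f c)); first exact: (H f).
  apply: (H (conjc \o f)); first exact: developing_conj.
  have [_ An _] := fdev.2 _ _ _ t.
  have -> : area ((conjc \o f) a) ((conjc \o f) b) ((conjc \o f) c) = - area (f a) (f b) (f c).
    by rewrite /area /cross /=; case: (f a) (f b) (f c) => ? ? [? ?] [? ?] /=; ring.
  by rewrite oppr_gt0 lt_neqAle An.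
pose u := b - a; pose v := c - a.
have p0 : pos a u v 0 = a by rewrite /pos /vec /= !mulr0z !addr0.
have p1 : pos a u v (1, 0) = b by rewrite /pos /vec /= mulr1z mulr0z addr0 /u addrC subrK.
have p2 : pos a u v (0, 1) = c by rewrite /pos /vec /= mulr1z mulr0z add0r /v addrC subrK.
have uu : dot u u - dot u v = dot (a - b) (c - b).
  by rewrite /u /v /dot; case: (a) (b) (c) => ? ? [? ?] [? ?] /=; ring.
have vv : dot v v - dot u v = dot (a - c) (b - c).
  by rewrite /u /v /dot; case: (a) (b) (c) => ? ? [? ?] [? ?] /=; ring.
have uvv : dot u u + dot v v - 2 * dot u v = dot (u - v) (u - v).
  by rewrite /dot; case: (u) (v) => ? ? [? ?] /=; ring.
rewrite -/u -/v in da; rewrite -uu in db; rewrite -vv in dc.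
have cells : forall z, cell T f a u v z (1, 0) (0, 1).
  apply: (lattice_cells gT latT delT fdev).
    by rewrite /frame !bilE /=; split; lra.
  by rewrite /tri p0 p1 p2; split=> //; exact: mulr_gt0.
have emb := embedded_of_triangulation fdev A0 cells.
have u0 : 0 < dot u u by lra.
have v0 : 0 < dot v v by lra.
have C0 : 0 < dot u u + dot v v - 2 * dot u v by lra.
have cst := admissible_constant u0 v0 C0 da _ _ (embedded_admissible u0 v0 C0 emb).
exists (w a) => x /(lattice_basis gT latT t)[m [n ->]].
have := cst _ _ (m, n); rewrite /= p0 /pos /vec /= addrA; apply; lra.
Qed.

End Assembly.

Theorem theorem1p3 (R : realType) (T : set {fset R[i]}) (w : R[i] -> R)
    (hT : geometric_triangulation T)
    (hL : lattice (vertices T))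
    (hD : Delaunay T cdist)
    (hPL : PL_metric T (vertex_scaling w cdist))
    (hDw : Delaunay T (vertex_scaling w cdist))
    (hiso : isometric_to_open_set T (vertex_scaling w cdist)) :
  exists k : R, forall v, vertices T v -> w v = k.
Proof.
have [f fdev] := developing_exists hT hPL hiso.
exact: scaling_constant fdev.
Qed.
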